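(* Let $\mathcal V$ be a polarized arrangement and $\alpha,\beta\in\mathcal P$. Let $\tilde V_\alpha,\tilde V_\beta$ be the standard modules over $\tilde B(\mathcal V)$ (over $\mathbb Z$). Then $\mathrm{Ext}^i_{\tilde B(\mathcal V)}(\tilde V_\alpha,\tilde V_\beta)=0$ unless all of the following hold: $\mathcal B_{\mathbf x_\alpha}\cap\mathcal F_{\mathbf x_\beta}\ne\emptyset$; $\alpha(j)\ne\beta(j)$ for all $j\in\mathbf x_\alpha^c\cap\mathbf x_\beta$; and $$i=|\{j\in\mathbf x_\alpha^c\cap\mathbf x_\beta^c:\alpha(j)\ne\beta(j)\}|+|\mathbf x_\alpha^c\cap\mathbf x_\beta|.$$ In that case $$\mathrm{Ext}^i_{\tilde B(\mathcal V)}(\tilde V_\alpha,\tilde V_\beta)\cong q^i\,\mathbb Z[u_{\mathbf x_\beta}]/(u_j: j\in\mathbf x_\alpha^c\cap\mathbf x_\beta)\cong q^i\,\mathbb Z[u_{\mathbf x_\alpha\cap\mathbf x_\beta}].$$ In particular, $\mathrm{Hom}_{\tilde B(\mathcal V)}(\tilde V_\alpha,\tilde V_\beta)=\mathrm{Ext}^0_{\tilde B(\mathcal V)}(\tilde V_\alpha,\tilde V_\beta)=\delta_{\alpha\beta}$, where $\delta_{\alpha\beta}$ is the Kronecker delta.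
   Context: **Polarized arrangements.** Let $0\le k\le n$ and $I=\{1,\dots,n\}$. A polarized arrangement $\mathcal V=(V,\eta,\xi)$ consists of a $k$-dimensional subspace $V\subset\mathbb R^n$, $\eta\in\mathbb R^n/V$ and $\xi\in V^*=(\mathbb R^n)^*/V^\perp$ such that every lift of $\eta$ to $\mathbb R^n$ has at least $n-k$ nonzero entries and every lift of $\xi$ to $(\mathbb R^n)^*$ has at least $k$ nonzero entries. Put $V_\eta=\{x\in\mathbb R^n: x+V=\eta\}$, $H_i=\{x\in V_\eta:x_i=0\}$, $H_S=\bigcap_{i\in S}H_i$ ($H_\emptyset=V_\eta$). For $\alpha\in\{\pm1\}^n$ let $\Delta_\alpha=\{x\in V_\eta:\alpha(i)x_i\ge0\ \forall i\}$ and $\Sigma_\alpha=\{x\in V:\alpha(i)x_i\ge0\ \forall i\}$. Set $\mathcal F=\{\alpha:\Delta_\alpha\ne\emptyset\}$, $\mathcal B=\{\alpha:\xi(\Sigma_\alpha)\text{ bounded above}\}$, $\mathcal P=\mathcal F\cap\mathcal B$. Let $d_{\alpha,\beta}$ be the number of entries where $\alpha,\beta$ differ. Let $\mathbb B$ be the set of $k$-element subsets $\mathbf x\subset I$ with $H_{\mathbf x}\neq\emptyset$ (then a point). There is a bijection $\mu:\mathbb B\to\mathcal P$ sending $\mathbf x$ to the unique $\alpha\in\mathcal P$ such that $\xi$ attains its maximum on $\Delta_\alpha$ at $H_{\mathbf x}$; write $\mathbf x_\alpha=\mu^{-1}(\alpha)$ and $\mathbf x^c=I\setminus\mathbf x$.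 The partial order $\le$ on $\mathbb B\cong\mathcal P$ is generated by $\mathbf x<\mathbf x'$ whenever $|\mathbf x\cap\mathbf x'|=k-1$ and $\xi(H_{\mathbf x})<\xi(H_{\mathbf x'})$. Bounded and feasible cones: $\mathcal B_{\mathbf x}=\{\gamma\in\{\pm1\}^n:\gamma(i)=\mu(\mathbf x)(i)\ \forall i\in\mathbf x\}$, $\mathcal F_{\mathbf x}=\{\gamma\in\{\pm1\}^n:\gamma(i)=\mu(\mathbf x)(i)\ \forall i\in\mathbf x^c\}$. **The algebra $\tilde B(\mathcal V)$.** For $S\subset I$ put $u_S=\prod_{i\in S}u_i$. For $\alpha,\beta\in\mathcal P$ let $\tilde R_{\alpha\beta}=\mathbb Z[u_1,\dots,u_n]/(u_S: S\subset I,\ \Delta_\alpha\cap\Delta_\beta\cap H_S=\emptyset)$ with unit denoted $f_{\alpha,\beta}$. Then $\tilde B(\mathcal V)=\bigoplus_{\alpha,\beta\in\mathcal P}\tilde R_{\alpha\beta}$ with multiplication $f_{\alpha,\beta}f_{\beta,\gamma}=u_{S(\alpha\beta\gamma)}f_{\alpha,\gamma}$, $S(\alpha\beta\gamma)=\{i:\alpha(i)=\gamma(i)\ne\beta(i)\}$, extended $\mathbb Z[u_1,\dots,u_n]$-bilinearly. Grading: $\deg f_{\alpha,\beta}=d_{\alpha,\beta}$, $\deg u_i=2$. Put $e_\alpha=f_{\alpha,\alpha}$. The standard module over $\tilde B=\tilde B(\mathcal V)$ is the graded left module $\tilde V_\alpha=\tilde Be_\alpha/\sum_{\beta<\alpha}\tilde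 Be_\beta\tilde Be_\alpha$. For $\mathbf z\subset I$, $\mathbb Z[u_{\mathbf z}]=\mathbb Z[u_i:i\in\mathbf z]$. **Gradings.** $(qM)_m=M_{m-1}$. $\mathrm{Hom}(U,W)=\bigoplus_m\hom(q^mU,W)=\bigoplus_m\hom(U,q^{-m}W)$, where $\hom$ denotes degree-preserving module homomorphisms; $\mathrm{Ext}^i(U,W)=\bigoplus_m\mathrm{ext}^i(q^mU,W)$ analogously.
   Formalization: The shift q^i is false by parity (α, β may differ on x_α∩x_β) and is replaced by q^{d_{αβ}-2i}. ''Hom = δ_{αβ}'', false for k>0, is read as: Hom is 0 if α≠β, Z[u_{x_α}] if α=β, with degree-0 part Z^{δ_{αβ}}. *)

(* Defs.v *)
From HB Require Import structures.
From mathcomp Require Import all_boot all_order all_algebra.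
From mathcomp Require Import boolp functions reals.
From mathcomp Require Import mpoly.
From mathcomp Require Import ring.

Set Implicit Arguments.
Unset Strict Implicit.
Unset Printing Implicit Defensive.

Import Order.TTheory GRing.Theory Num.Theory.

Local Open Scope ring_scope.

Section Gradings.
Variables (M : zmodType) (D : int -> M -> Prop).

(* [h] is a finitely supported family of homogeneous elements with sum [x];
   [is_grading D] then says that the group is the direct sum of the [D m]. *)
Definition hdecomp (x : M) (h : int -> M) : Prop :=
  (forall m, D m (h m)) /\
  exists s : seq int,
    [/\ uniq s, forall m, m \notin s -> h m = 0 & x = \sum_(m <- s) h m].

Definition is_grading : Prop :=
  (forall m, D m 0 /\ (forall x y, D m x -> D m y -> D m (x - y))) /\
  (forall x, exists! h : int -> M, hdecomp x h).

End Gradings.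

Lemma big_widen (I : eqType) (M : nmodType) (s t : seq I) (h : I -> M) :
  uniq s -> uniq t -> (forall i, i \notin s -> h i = 0) ->
  (forall i, i \notin t -> h i = 0) ->
  \sum_(i <- s) h i = \sum_(i <- t) h i.
Proof.
suff H (u v : seq I) : uniq u -> uniq v ->
    (forall i, i \notin v -> h i = 0) ->
    \sum_(i <- u) h i = \sum_(i <- [seq i <- u | i \in v]) h i.
  move=> us ut hs ht; rewrite (H s t) // (H t s) //.
  apply: perm_big; apply: uniq_perm; rewrite ?filter_uniq // => i.
  by rewrite !mem_filter andbC.
move=> uu uv hv; rewrite big_filter [RHS]big_mkcond /=.
by apply: eq_bigr => i _; case: ifPn => // /hv.
Qed.

Lemma big_widen_cat (I : eqType) (M : nmodType) (s t : seq I) (h : I -> M) :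
  uniq s -> (forall i, i \notin s -> h i = 0) ->
  \sum_(i <- undup (s ++ t)) h i = \sum_(i <- s) h i.
Proof.
move=> us hs; apply: big_widen; rewrite ?undup_uniq // => i.
by rewrite mem_undup mem_cat negb_or => /andP[/hs].
Qed.

Lemma sumB_widen (I : eqType) (M : zmodType) (s t : seq I) (h k : I -> M) :
  uniq s -> uniq t -> (forall i, i \notin s -> h i = 0) ->
  (forall i, i \notin t -> k i = 0) ->
  \sum_(i <- undup (s ++ t)) (h i - k i) =
  \sum_(i <- s) h i - \sum_(i <- t) k i.
Proof.
move=> us ut hs kt; rewrite sumrB big_widen_cat //; congr (_ - _).
apply: big_widen; rewrite ?undup_uniq // => i.
by rewrite mem_undup mem_cat negb_or => /andP[_ /kt].
Qed.

Section GradingTheory.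
Variables (M : zmodType) (D : int -> M -> Prop).

Lemma is_gradingI :
  (forall m, D m 0 /\ (forall x y, D m x -> D m y -> D m (x - y))) ->
  (forall x, exists h, hdecomp D x h) ->
  (forall h, hdecomp D 0 h -> forall m, h m = 0) ->
  is_grading D.
Proof.
move=> DB ex un; split => // x; have [h hx] := ex x.
exists h; split => // k kx; apply/funext => m; apply/eqP; rewrite -subr_eq0.
apply/eqP; apply: (un (fun m => h m - k m)); split.
  by move=> i; apply: (DB i).2; [apply: hx.1|apply: kx.1].
have [s [us hs xs]] := hx.2; have [t [ut kt xt]] := kx.2.
exists (undup (s ++ t)); split; first exact: undup_uniq.
  move=> i; rewrite mem_undup mem_cat negb_or => /andP[/hs -> /kt ->].
  by rewrite subrr.
by rewrite sumB_widen // -xs -xt subrr.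
Qed.

Hypothesis G : is_grading D.

Lemma grading0 m : D m 0. Proof. exact: (G.1 m).1. Qed.
Lemma gradingB m x y : D m x -> D m y -> D m (x - y).
Proof. exact: (G.1 m).2. Qed.
Lemma gradingN m x : D m x -> D m (- x).
Proof. by rewrite -[- x]add0r => ?; apply: gradingB => //; apply: grading0. Qed.
Lemma gradingD m x y : D m x -> D m y -> D m (x + y).
Proof. by move=> ? ?; rewrite -[y]opprK; apply: gradingB => //; exact: gradingN. Qed.
Lemma grading_sum m (I : Type) (s : seq I) (P : pred I) (F : I -> M) :
  (forall i, P i -> D m (F i)) -> D m (\sum_(i <- s | P i) F i).
Proof. by move=> H; elim/big_ind: _ => //; [exact: grading0|move=> *; exact: gradingD]. Qed.

Definition hc (x : M) : int -> M := projT1 (cid (G.2 x)).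

Lemma hcP x : hdecomp D x (hc x).
Proof. by rewrite /hc; case: cid => h /= []. Qed.

Lemma hc_uniq x h : hdecomp D x h -> h = hc x.
Proof. by rewrite /hc; case: cid => k /= [_ ku] /ku ->. Qed.

Lemma hc_deg m x : D m (hc x m). Proof. exact: (hcP x).1. Qed.

Lemma hdecomp0 : hdecomp D 0 (fun=> 0).
Proof. by split; [move=> m; exact: grading0|exists [::]; split => //; rewrite big_nil]. Qed.

Lemma hdecompB x y h k : hdecomp D x h -> hdecomp D y k ->
  hdecomp D (x - y) (fun m => h m - k m).
Proof.
move=> [Dh [s [us hs xs]]] [Dk [t [ut kt xt]]]; split.
  by move=> i; apply: gradingB.
exists (undup (s ++ t)); split; first exact: undup_uniq.
  move=> i; rewrite mem_undup mem_cat negb_or => /andP[/hs -> /kt ->].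
  by rewrite subrr.
by rewrite sumB_widen // -xs -xt.
Qed.

Lemma hc0 m : hc 0 m = 0. Proof. by rewrite -(hc_uniq hdecomp0). Qed.
Lemma hcB x y m : hc (x - y) m = hc x m - hc y m.
Proof. by rewrite -(hc_uniq (hdecompB (hcP x) (hcP y))). Qed.
Lemma hcN x m : hc (- x) m = - hc x m.
Proof. by rewrite -[- x]sub0r hcB hc0 sub0r. Qed.
Lemma hcD x y m : hc (x + y) m = hc x m + hc y m.
Proof. by rewrite -{1}[y]opprK hcB hcN opprK. Qed.
Lemma hc_sum (I : Type) (s : seq I) (P : pred I) (F : I -> M) m :
  hc (\sum_(i <- s | P i) F i) m = \sum_(i <- s | P i) hc (F i) m.
Proof. by apply: (big_morph (fun x => hc x m)) => [x y|]; rewrite ?hcD ?hc0. Qed.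

Lemma hdecomp_hom m x : D m x -> hdecomp D x (fun k => if k == m then x else 0).
Proof.
move=> Dx; split; first by move=> k; case: eqP => [->|_] //; exact: grading0.
exists [:: m]; split => //; last by rewrite big_seq1 eqxx.
by move=> k; rewrite inE; case: eqP.
Qed.

Lemma hc_hom m x k : D m x -> hc x k = if k == m then x else 0.
Proof. by move=> /hdecomp_hom/hc_uniq <-. Qed.

Lemma grading_sep m k x : D m x -> D k x -> m <> k -> x = 0.
Proof.
move=> Dm Dk mk; have := hc_hom k Dm; rewrite (hc_hom k Dk) eqxx.
by case: eqP => // km; case: mk.
Qed.

Definition hsupp (x : M) : seq int := projT1 (cid (hcP x).2).
Lemma hsupp_uniq x : uniq (hsupp x).
Proof. by rewrite /hsupp; case: cid => s []. Qed.
Lemma hsuppN x m : m \notin hsupp x -> hc x m = 0.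
Proof. by rewrite /hsupp; case: cid => s /= [_ + _]; apply. Qed.
Lemma hsupp_sum x : x = \sum_(m <- hsupp x) hc x m.
Proof. by rewrite /hsupp; case: cid => s /= []. Qed.
Lemma hc_sumE x (s : seq int) : uniq s -> (forall m, m \notin s -> hc x m = 0) ->
  x = \sum_(m <- s) hc x m.
Proof.
by move=> us hs; rewrite {1}[x]hsupp_sum (@big_widen _ _ _ s) ?hsupp_uniq //;
  exact: hsuppN.
Qed.

End GradingTheory.

Record grRing := GrRing {
  gr_ring :> pzRingType;
  gr_deg : int -> gr_ring -> Prop;
  gr_grading : is_grading gr_deg;
  gr_one : gr_deg 0 1;
  gr_mul : forall i j x y, gr_deg i x -> gr_deg j y -> gr_deg (i + j) (x * y)
}.

Record grMod (A : grRing) := GrMod {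
  gm_mod :> lmodType A;
  gm_deg : int -> gm_mod -> Prop;
  gm_grading : is_grading gm_deg;
  gm_scale : forall i j (a : A) x,
    gr_deg i a -> gm_deg j x -> gm_deg (i + j) (a *: x)
}.

(* [is_ghom m f]: f is A-linear and raises degrees by [m], i.e. it is a
   degree-preserving homomorphism [q^m U -> W], where [(q M)_m = M_(m-1)]. *)
Definition is_ghom (A : grRing) (U W : grMod A) (m : int) (f : U -> W) : Prop :=
  (forall (a : A) x y, f (a *: x + y) = a *: f x + f y) /\
  (forall j x, gm_deg j x -> gm_deg (j + m) (f x)).

(* A bijective homogeneous map of degree 0 has an inverse of the same kind. *)
Definition giso (A : grRing) (U W : grMod A) : Prop :=
  exists f : U -> W, is_ghom 0 f /\ bijective f.

(* [gshift d U] is [q^d U]. *)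
Section Shift.
Variables (A : grRing) (d : int) (U : grMod A).

Let sdeg (m : int) (x : U) := gm_deg (m - d) x.

Fact gshift_grading : is_grading sdeg.
Proof.
have G := gm_grading U.
apply: is_gradingI => [m|x|h [Dh [s [us hs xs]]] m].
- by split; [exact: grading0 G _|move=> *; exact: gradingB G _ _ _ _ _].
- exists (fun m => hc G x (m - d)); split; first by move=> m; exact: hc_deg.
  exists [seq m + d | m <- hsupp G x]; split.
  + by rewrite map_inj_uniq ?hsupp_uniq //; exact: addIr.
  + move=> m ms; apply: hsuppN; apply: contra ms => ms.
    by apply/mapP; exists (m - d) => //; rewrite subrK.
  + rewrite big_map {1}[x](hsupp_sum G); by under [RHS]eq_bigr do rewrite addrK.
- have E : hdecomp (@gm_deg _ U) 0 (fun m => h (m + d)).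
    split; first by move=> k; have := Dh (k + d); rewrite /sdeg addrK.
    exists [seq k - d | k <- s]; split.
    + by rewrite map_inj_uniq //; exact: addIr.
    + move=> k ks; apply: hs; apply: contra ks => ks.
      by apply/mapP; exists (k + d) => //; rewrite addrK.
    + by rewrite big_map; under eq_bigr do rewrite subrK; exact: xs.
  have /(congr1 (fun f => f (m - d))) := hc_uniq G E.
  by rewrite /= subrK hc0.
Qed.

Fact gshift_scale i j (a : A) x : gr_deg i a -> sdeg j x -> sdeg (i + j) (a *: x).
Proof. by rewrite /sdeg -addrA; exact: gm_scale. Qed.

Definition gshift : grMod A := GrMod gshift_grading gshift_scale.

End Shift.

Section Submodules.
Variables (A : pzRingType) (M : lmodType A).

Record submodule := Submodule {
  sm_pred :> M -> Prop;
  sm_zero : sm_pred 0;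
  sm_lin : forall (a : A) x y, sm_pred x -> sm_pred y -> sm_pred (a *: x + y)
}.

Definition sm_mem (N : submodule) : {pred M} := fun x => `[< N x >].

Lemma sm_memP (N : submodule) x : reflect (N x) (x \in sm_mem N).
Proof. exact: asboolP. Qed.

Fact sm_closed (N : submodule) : GRing.submod_closed (sm_mem N).
Proof.
split; first by apply/sm_memP; exact: sm_zero.
by move=> a x y /sm_memP ? /sm_memP ?; apply/sm_memP; exact: sm_lin.
Qed.

HB.instance Definition _ (N : submodule) :=
  GRing.isSubmodClosed.Build A M (sm_mem N) (sm_closed N).

Lemma sm_scale (N : submodule) (a : A) x : N x -> N (a *: x).
Proof. by move=> Nx; rewrite -[_ *: x]addr0; apply: sm_lin => //; exact: sm_zero. Qed.

Lemma sm_add (N : submodule) x y : N x -> N y -> N (x + y).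
Proof. by move=> Nx Ny; rewrite -[x]scale1r; exact: sm_lin. Qed.

Lemma sm_sub (N : submodule) x y : N x -> N y -> N (x - y).
Proof. by move=> Nx Ny; apply: sm_add => //; rewrite -scaleN1r; exact: sm_scale. Qed.

Lemma sm_sum (N : submodule) (I : Type) (s : seq I) (P : pred I) (F : I -> M) :
  (forall i, P i -> N (F i)) -> N (\sum_(i <- s | P i) F i).
Proof. by move=> H; elim/big_ind: _ => //; [exact: sm_zero|exact: sm_add]. Qed.

Definition sub_mod (N : submodule) : Type := {x : M | x \in sm_mem N}.

HB.instance Definition _ (N : submodule) := SubChoice.on (sub_mod N).
HB.instance Definition _ (N : submodule) :=
  [SubChoice_isSubLmodule of sub_mod N by <:].

Definition smk (N : submodule) (x : M) (Nx : N x) : sub_mod N :=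
  exist _ x (introT (sm_memP N x) Nx).

Lemma smkE (N : submodule) (x : M) (Nx : N x) : val (smk Nx) = x.
Proof. by []. Qed.

Lemma smP (N : submodule) (x : sub_mod N) : N (val x).
Proof. exact/sm_memP/valP. Qed.

Lemma smv0 (N : submodule) : val (0 : sub_mod N) = 0.
Proof. exact: raddf0. Qed.
Lemma smvD (N : submodule) (x y : sub_mod N) : val (x + y) = val x + val y.
Proof. exact: raddfD. Qed.
Lemma smvB (N : submodule) (x y : sub_mod N) : val (x - y) = val x - val y.
Proof. exact: raddfB. Qed.
Lemma smvZ (N : submodule) a (x : sub_mod N) : val (a *: x) = a *: val x.
Proof. exact: linearZ. Qed.
Lemma smv_sum (N : submodule) (I : Type) (s : seq I) (P : pred I)
    (F : I -> sub_mod N) :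
  val (\sum_(i <- s | P i) F i) = \sum_(i <- s | P i) val (F i).
Proof. exact: raddf_sum. Qed.

Definition quot_mod (N : submodule) : Type := Quotient.quot (sm_mem N).

HB.instance Definition _ (N : submodule) := GRing.Zmodule.on (quot_mod N).

Definition qpi (N : submodule) (x : M) : quot_mod N :=
  (\pi_(Quotient.quot (sm_mem N)) x)%qT.

Definition qrepr (N : submodule) (y : quot_mod N) : M :=
  repr (y : Quotient.quot (sm_mem N)).

Section Quot.
Variable N : submodule.

Lemma qreprK (y : quot_mod N) : qpi N (qrepr y) = y.
Proof. exact: reprK. Qed.

Lemma qpi_eq (x y : M) : qpi N x = qpi N y <-> N (x - y).
Proof.
rewrite /qpi; split => [H|H].
  by apply/sm_memP; rewrite Quotient.idealrBE; apply/eqP.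
by apply/eqP; rewrite -Quotient.idealrBE; apply/sm_memP.
Qed.

Lemma qpiD (x y : M) : qpi N (x + y) = qpi N x + qpi N y.
Proof. exact: Quotient.pi_add. Qed.

Lemma qpi0 : qpi N 0 = 0.
Proof. by apply: (addIr (qpi N 0)); rewrite -qpiD !add0r. Qed.

Lemma qpiN (x : M) : qpi N (- x) = - qpi N x.
Proof. by apply: (addIr (qpi N x)); rewrite -qpiD !addNr qpi0. Qed.

Lemma qpiB (x y : M) : qpi N (x - y) = qpi N x - qpi N y.
Proof. by rewrite qpiD qpiN. Qed.

Lemma qpi_sum (I : Type) (s : seq I) (P : pred I) (F : I -> M) :
  qpi N (\sum_(i <- s | P i) F i) = \sum_(i <- s | P i) qpi N (F i).
Proof. by apply: (big_morph (qpi N)) => [x y|]; rewrite ?qpiD ?qpi0. Qed.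

Lemma qpi_eq0 (x : M) : qpi N x = 0 <-> N x.
Proof. by rewrite -qpi0 qpi_eq subr0. Qed.

Lemma qreprP (x : M) : N (qrepr (qpi N x) - x).
Proof. by apply/qpi_eq; rewrite qreprK. Qed.

Definition qscale (a : A) (y : quot_mod N) : quot_mod N := qpi N (a *: qrepr y).

Lemma qscaleE a (x : M) : qscale a (qpi N x) = qpi N (a *: x).
Proof. by apply/qpi_eq; rewrite -scalerBr; apply: sm_scale; exact: qreprP. Qed.

Fact qscaleA a b y : qscale a (qscale b y) = qscale (a * b) y.
Proof. by rewrite -[y]qreprK !qscaleE scalerA. Qed.
Fact qscale1 : left_id 1 qscale.
Proof. by move=> y; rewrite -[y]qreprK qscaleE scale1r. Qed.
Fact qscaleDr : right_distributive qscale +%R.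
Proof.
by move=> a x y; rewrite -[x]qreprK -[y]qreprK -qpiD !qscaleE -qpiD scalerDr.
Qed.
Fact qscaleDl y : {morph qscale^~ y : a b / a + b}.
Proof. by move=> a b; rewrite -[y]qreprK !qscaleE -qpiD scalerDl. Qed.

HB.instance Definition _ := GRing.Zmodule_isLmodule.Build A (quot_mod N)
  qscaleA qscale1 qscaleDr qscaleDl.

Lemma qpiZ a (x : M) : qpi N (a *: x) = a *: qpi N x.
Proof. by rewrite -qscaleE. Qed.

End Quot.
End Submodules.

Section GradedSub.
Variables (A : grRing) (M : grMod A).

Record hsubmodule := HSubmodule {
  hs_sub :> submodule M;
  hs_hom : forall x h, hs_sub x -> hdecomp (@gm_deg A M) x h ->
    forall m, hs_sub (h m)
}.

Variable N : hsubmodule.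

Let G := gm_grading M.

Definition sub_deg (m : int) (x : sub_mod N) : Prop := gm_deg m (val x).

Fact gsub_grading : is_grading sub_deg.
Proof.
apply: is_gradingI => [m|x|h [Dh [s [us hs xs]]] m].
- split; first by rewrite /sub_deg smv0; exact: grading0 G _.
  by move=> x y dx dy; rewrite /sub_deg smvB; exact: gradingB G _ _ _ _ _.
- have Nh m : N (hc G (val x) m) by exact: hs_hom (smP x) (hcP G _) m.
  exists (fun m => smk (Nh m)); split; first by move=> m; exact: hc_deg.
  exists (hsupp G (val x)); split => [|m ms|]; first exact: hsupp_uniq.
    by apply: val_inj; rewrite smkE smv0; exact: hsuppN.
  by apply: val_inj; rewrite smv_sum [LHS](hsupp_sum G).
- apply: val_inj; rewrite smv0.
  have E : hdecomp (@gm_deg _ M) 0 (fun m => val (h m)).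
    split; first exact: Dh.
    exists s; split => // [k /hs ->|]; first by rewrite smv0.
    by rewrite -(smv0 N) [in LHS]xs smv_sum.
  by have /(congr1 (fun f => f m)) := hc_uniq G E; rewrite hc0.
Qed.

Fact gsub_scale i j (a : A) x :
  gr_deg i a -> sub_deg j x -> sub_deg (i + j) (a *: x).
Proof. by move=> ? ?; rewrite /sub_deg smvZ; exact: gm_scale. Qed.

Definition gsub : grMod A := GrMod gsub_grading gsub_scale.

Definition quot_deg (m : int) (y : quot_mod N) : Prop :=
  exists x : M, gm_deg m x /\ y = qpi N x.

Fact gquot_grading : is_grading quot_deg.
Proof.
apply: is_gradingI => [m|y|h [Dh [s [us hs xs]]] m].
- split; first by exists 0; rewrite qpi0; split => //; exact: grading0 G _.
  move=> _ _ [x [dx ->]] [y [dy ->]]; exists (x - y); rewrite qpiB.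
  by split => //; exact: gradingB G _ _ _ _ _.
- exists (fun m => qpi N (hc G (qrepr y) m)); split.
    by move=> m; exists (hc G (qrepr y) m); split => //; exact: hc_deg.
  exists (hsupp G (qrepr y)); split => [|m ms|]; first exact: hsupp_uniq.
    by rewrite hsuppN ?qpi0.
  by rewrite -qpi_sum -hsupp_sum qreprK.
- have /choice[k kP] : forall m, exists x, (gm_deg m x /\ h m = qpi N x).
    by move=> i; have [x] := Dh i; exists x.
  pose l := fun m => if m \in s then k m else 0.
  have E : hdecomp (@gm_deg _ M) (\sum_(m <- s) l m) l.
    split; first by move=> i; rewrite /l; case: ifP => _; [have [] := kP i|exact: grading0 G _].
    by exists s; split => // i; rewrite /l => /negPf ->.
  have : N (\sum_(m <- s) l m).
    have e i : i \in s -> qpi N (l i) = h i by rewrite /l => ->; rewrite (kP i).2.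
    by apply/qpi_eq0; rewrite qpi_sum (eq_big_seq _ e); exact/esym/xs.
  move=> /hs_hom/(_ E m); rewrite /l; case: ifP => [ms|/negbT/hs //].
  by move=> /qpi_eq0; rewrite (kP m).2.
Qed.

Fact gquot_scale i j (a : A) y :
  gr_deg i a -> quot_deg j y -> quot_deg (i + j) (a *: y).
Proof.
move=> da [x [dx ->]]; exists (a *: x); rewrite qpiZ; split => //.
exact: gm_scale.
Qed.

Definition gquot : grMod A := GrMod gquot_grading gquot_scale.

End GradedSub.
Section GHomTheory.
Variables (A : grRing) (U W : grMod A) (d : int) (f : U -> W).
Hypothesis Hf : is_ghom d f.

Lemma ghomD x y : f (x + y) = f x + f y.
Proof. by rewrite -[x in LHS]scale1r Hf.1 scale1r. Qed.
Lemma ghom0 : f 0 = 0.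
Proof. by apply: (addIr (f 0)); rewrite -ghomD !add0r. Qed.
Lemma ghomZ a x : f (a *: x) = a *: f x.
Proof. by rewrite -[a *: x]addr0 Hf.1 ghom0 addr0. Qed.
Lemma ghom_sum (I : Type) (s : seq I) (P : pred I) (F : I -> U) :
  f (\sum_(i <- s | P i) F i) = \sum_(i <- s | P i) f (F i).
Proof. by apply: (big_morph f) => [x y|]; rewrite ?ghomD ?ghom0. Qed.

Lemma ghom_hc x m : f (hc (gm_grading U) x m) = hc (gm_grading W) (f x) (m + d).
Proof.
rewrite {2}[x](hsupp_sum (gm_grading U)) ghom_sum hc_sum.
have D k : gm_deg (k + d) (f (hc (gm_grading U) x k)).
  by apply: Hf.2; exact: hc_deg.
have [ms|ms] := boolP (m \in hsupp (gm_grading U) x).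
  rewrite (bigD1_seq m) ?hsupp_uniq //= (hc_hom _ _ (D m)) eqxx big1 ?addr0 //.
  move=> k km; rewrite (hc_hom _ _ (D k)) (inj_eq (addIr d)) eq_sym.
  by rewrite (negPf km).
rewrite hsuppN // ghom0 big_seq big1 // => k ks.
rewrite (hc_hom _ _ (D k)) (inj_eq (addIr d)); case: eqP => // mk.
by rewrite mk ks in ms.
Qed.

End GHomTheory.

(* The free graded module on all homogeneous elements [(m, x)] of [U], where the
   generator of index [(m, x)] has degree [m] and is sent to [x]. *)
Section FreeCover.
Variables (A : grRing) (U : grMod A).

Definition hgen : Type := {p : int * U | `[< gm_deg p.1 p.2 >]}.

HB.instance Definition _ := Choice.on hgen.

Let dg (g : hgen) : int := (val g).1.

Definition ffree (f : hgen -> A^o) : Prop :=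
  exists s : seq hgen, forall g, g \notin s -> f g = 0.

Fact ffree0 : ffree 0. Proof. by exists [::]. Qed.
Fact ffree_lin (a : A) f k : ffree f -> ffree k -> ffree (a *: f + k).
Proof.
move=> [s fs] [t kt]; exists (s ++ t) => g; rewrite mem_cat negb_or.
by move=> /andP[/fs gs /kt gt]; rewrite !fctE gs gt scaler0 addr0.
Qed.

Definition free_sub : submodule (hgen -> A^o) := Submodule ffree0 ffree_lin.

Local Notation F := (sub_mod free_sub).

Definition fdeg (m : int) (f : F) : Prop :=
  forall g, gr_deg (m - dg g) (val f g : A).

Let GA := gr_grading A.

Fact free_grading : is_grading fdeg.
Proof.
apply: is_gradingI => [m|x|h [Dh [s [us hs xs]]] m].
- split; first by move=> g; exact: grading0 GA _.
  by move=> x y dx dy g; rewrite /fdeg smvB; exact: (gradingB GA (dx g) (dy g)).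
- have Fh m : free_sub (fun g => hc GA (val x g) (m - dg g)).
    have [s xs] := smP x; exists s => g /xs ->; exact: hc0.
  exists (fun m => smk (Fh m)); split; first by move=> m g; exact: hc_deg.
  have [s xs] := smP x.
  pose t := undup (flatten [seq [seq j + dg g | j <- hsupp GA (val x g)] | g <- s]).
  have tP m g : m \notin t -> hc GA (val x g) (m - dg g) = 0.
    rewrite mem_undup => mt; have [gs|/xs ->] := boolP (g \in s); last exact: hc0.
    apply: hsuppN; apply: contra mt => mt; apply/flattenP.
    exists [seq j + dg g | j <- hsupp GA (val x g)]; first exact: map_f.
    by apply/mapP; exists (m - dg g) => //; rewrite subrK.
  exists t; split; first exact: undup_uniq.
    by move=> m mt; apply: val_inj; apply/funext => g /=; rewrite tP.
  apply: val_inj; rewrite smv_sum; apply/funext => g.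
  rewrite fct_sumE /=.
  rewrite [LHS](@hc_sumE _ _ GA _ [seq m - dg g | m <- t]).
  + by rewrite big_map.
  + by rewrite map_inj_uniq ?undup_uniq //; exact: addIr.
  + move=> m mt; rewrite -[m](addrK (dg g)); apply: tP; apply: contra mt => mt.
    by apply/mapP; exists (m + dg g) => //; rewrite addrK.
- apply: val_inj; apply/funext => g.
  have E : hdecomp (@gr_deg A) 0 (fun m => val (h (m + dg g)) g).
    split; first by move=> k; have := Dh (k + dg g) g; rewrite addrK.
    exists [seq k - dg g | k <- s]; split.
    + by rewrite map_inj_uniq //; exact: addIr.
    + move=> k ks; rewrite hs //; apply: contra ks => ks.
      by apply/mapP; exists (k + dg g) => //; rewrite addrK.
    + rewrite big_map; under eq_bigr do rewrite subrK.
      have := congr1 (fun f : F => val f g) xs.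
      by rewrite smv_sum fct_sumE.
  have /(congr1 (fun f => f (m - dg g))) := hc_uniq GA E.
  by rewrite /= subrK hc0.
Qed.

Fact free_scale i j (a : A) (x : F) : gr_deg i a -> fdeg j x -> fdeg (i + j) (a *: x).
Proof. by move=> da dx g; rewrite -addrA smvZ; exact: (gr_mul da (dx g)). Qed.

Definition gfree : grMod A := GrMod free_grading free_scale.

Definition fsupp (f : F) : seq hgen := undup (projT1 (cid (smP f))).

Lemma fsuppN (f : F) g : g \notin fsupp f -> val f g = 0.
Proof. by rewrite /fsupp; case: cid => s /= sP; rewrite mem_undup => /sP. Qed.

Fact fbasis_subproof (g : hgen) : free_sub (fun k => if k == g then 1 else 0).
Proof. by exists [:: g] => k; rewrite inE => /negPf ->. Qed.

Definition fbasis (g : hgen) : gfree := smk (fbasis_subproof g).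

Lemma fbasis_deg g : gm_deg (dg g) (fbasis g).
Proof.
move=> k /=; case: eqP => [->|_]; last exact: grading0 GA _.
by rewrite subrr; exact: gr_one.
Qed.

Section Eval.
Variables (M : grMod A) (b : hgen -> M).

Definition feval (f : gfree) : M := \sum_(g <- fsupp f) (val f g : A) *: b g.

Lemma fevalE (f : gfree) (s : seq hgen) : uniq s ->
  (forall g, g \notin s -> val f g = 0) ->
  feval f = \sum_(g <- s) (val f g : A) *: b g.
Proof.
move=> us fs; apply: big_widen; rewrite ?undup_uniq //.
  by move=> g /fsuppN ->; rewrite scale0r.
by move=> g /fs ->; rewrite scale0r.
Qed.

Lemma feval_lin (a : A) x y : feval (a *: x + y) = a *: feval x + feval y.
Proof.
pose s := undup (fsupp x ++ fsupp y).
have sx g : g \notin s -> val x g = 0.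
  by rewrite mem_undup mem_cat negb_or => /andP[/fsuppN].
have sy g : g \notin s -> val y g = 0.
  by rewrite mem_undup mem_cat negb_or => /andP[_ /fsuppN].
have us : uniq s by exact: undup_uniq.
rewrite (fevalE us sx) (fevalE us sy) (@fevalE _ s us); last first.
  by move=> g gs; rewrite smvD smvZ !fctE sx // sy // scaler0 addr0.
rewrite scaler_sumr -big_split; apply: eq_bigr => g _ /=.
by rewrite scalerA -scalerDl.
Qed.

Lemma feval_basis g : feval (fbasis g) = b g.
Proof.
rewrite (@fevalE _ [:: g]) // ?big_seq1 /= ?eqxx ?scale1r //.
by move=> k; rewrite inE /= => /negPf ->.
Qed.

Lemma feval_ghom : (forall g, gm_deg (dg g) (b g)) -> is_ghom 0 feval.
Proof.
move=> bP; split; first exact: feval_lin.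
move=> j x dx; rewrite addr0; apply: grading_sum; first exact: gm_grading.
by move=> g _; have := gm_scale (dx g) (bP g); rewrite subrK.
Qed.

End Eval.

Lemma fbasis_sum (x : gfree) : x = \sum_(g <- fsupp x) (val x g : A) *: fbasis g.
Proof.
apply: val_inj; rewrite [RHS]smv_sum; apply/funext => k; rewrite fct_sumE.
have [ks|ks] := boolP (k \in fsupp x).
  rewrite (bigD1_seq k) ?undup_uniq //= big1 => [|g gk].
    rewrite addr0; change (val x k = (val x k : A) * (if k == k then 1 else 0)).
    by rewrite eqxx mulr1.
  change ((val x g : A) * (if k == g then 1 else 0) = 0).
  by rewrite eq_sym (negPf gk) mulr0.
rewrite fsuppN // big_seq big1 // => g gs.
change ((val x g : A) * (if k == g then 1 else 0) = 0).
by case: eqP => [kg|_]; [rewrite kg gs in ks|rewrite mulr0].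
Qed.

Definition faug : gfree -> U := feval (fun g => (val g).2).

Lemma faug_ghom : is_ghom 0 faug.
Proof. by apply: feval_ghom => g; exact/asboolP/(valP g). Qed.

Lemma faug_surj y : exists x, faug x = y.
Proof.
pose g m : hgen := exist _ (m, hc (gm_grading U) y m)
  (introT (asboolP _) (hc_deg (gm_grading U) m y)).
exists (\sum_(m <- hsupp (gm_grading U) y) fbasis (g m)).
rewrite (ghom_sum faug_ghom) [RHS](hsupp_sum (gm_grading U)).
by apply: eq_bigr => m _; rewrite /faug feval_basis.
Qed.

End FreeCover.

(* Projectivity in the category of graded modules and degree-preserving maps. *)
Definition gprojective (A : grRing) (P : grMod A) : Prop :=
  forall (M N : grMod A) (p : M -> N) (f : P -> N),
    is_ghom 0 p -> (forall y, exists x, p x = y) -> is_ghom 0 f ->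
    exists g : P -> M, is_ghom 0 g /\ forall x, p (g x) = f x.

Lemma gfree_projective (A : grRing) (U : grMod A) : gprojective (gfree U).
Proof.
move=> M N p f Hp sp Hf.
have /choice[b bP] : forall g : hgen U, exists x : M,
    gm_deg (val g).1 x /\ p x = f (fbasis g).
  move=> g; have [x px] := sp (f (fbasis g)).
  exists (hc (gm_grading M) x (val g).1); split; first exact: hc_deg.
  rewrite (ghom_hc Hp) px; have := Hf.2 _ _ (fbasis_deg g).
  by move=> D; rewrite (hc_hom _ _ D) eqxx.
exists (feval b); split; first by apply: feval_ghom => g; have [] := bP g.
move=> x; rewrite [in RHS](fbasis_sum x) (ghom_sum Hf) (ghom_sum Hp).
by apply: eq_bigr => g _; rewrite (ghomZ Hf) (ghomZ Hp) (bP g).2.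
Qed.

Section Kernel.
Variables (A : grRing) (U W : grMod A) (f : U -> W).
Hypothesis Hf : is_ghom 0 f.

Fact gker_lin (a : A) x y : f x = 0 -> f y = 0 -> f (a *: x + y) = 0.
Proof. by rewrite Hf.1 => -> ->; rewrite scaler0 addr0. Qed.

Definition gker_sub : submodule U := Submodule (ghom0 Hf) gker_lin.

Fact gker_hom x h : gker_sub x -> hdecomp (@gm_deg A U) x h ->
  forall m, gker_sub (h m).
Proof.
move=> fx /(hc_uniq (gm_grading U)) -> m; rewrite /= (ghom_hc Hf).
by rewrite (fx : f x = 0) hc0.
Qed.

Definition gker : hsubmodule U := HSubmodule gker_hom.

End Kernel.

Record gresolution (A : grRing) (U : grMod A) := GResolution {
  res_mod :> nat -> grMod A;
  res_d : forall i, res_mod i.+1 -> res_mod i;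
  res_aug : res_mod 0 -> U;
  res_proj : forall i, gprojective (res_mod i);
  res_d_ghom : forall i, is_ghom 0 (@res_d i);
  res_aug_ghom : is_ghom 0 res_aug;
  res_aug_surj : forall y, exists x, res_aug x = y;
  res_exact0 : forall x, res_aug x = 0 <-> exists y, res_d y = x;
  res_exact : forall i (x : res_mod i.+1),
    res_d x = 0 <-> exists y, res_d y = x
}.

Section FreeResolution.
Variables (A : grRing) (U : grMod A).

Definition syzygy (M : grMod A) : grMod A := gsub (gker (faug_ghom M)).

Definition fres_mod (i : nat) : grMod A := gfree (iter i syzygy U).

Definition fres_d (i : nat) (x : fres_mod i.+1) : fres_mod i :=
  val (faug x : syzygy (iter i syzygy U)).

Fact fres_d_ghom i : is_ghom 0 (@fres_d i).
Proof.
have [L D] := faug_ghom (iter i.+1 syzygy U); split; last by move=> j x /D.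
by move=> a x y; rewrite /fres_d L smvD smvZ.
Qed.

Fact fres_exact0 x :
  @faug A U x = 0 <-> exists y, @fres_d 0 y = x.
Proof.
split=> [H|[y <-]]; last exact: smP (faug y : syzygy U).
have [y yx] := faug_surj (smk (N := gker (faug_ghom U)) H : syzygy U).
by exists y; rewrite /fres_d yx.
Qed.

Fact fres_exact i (x : fres_mod i.+1) :
  fres_d x = 0 <-> exists y, @fres_d i.+1 y = x.
Proof.
split=> [H|[y <-]].
  have {}H : faug x = 0 by apply: val_inj; rewrite smv0.
  have [y yx] := faug_surj (smk (N := gker (faug_ghom (iter i.+1 syzygy U))) H :
     syzygy (iter i.+1 syzygy U)).
  by exists y; rewrite /fres_d yx.
rewrite {1}/fres_d.
have H : faug (fres_d y) = 0 by exact: smP (faug y : syzygy (iter i.+1 syzygy U)).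
by rewrite H smv0.
Qed.

Definition free_resolution : gresolution U :=
  @GResolution A U fres_mod fres_d (@faug A U)
    (fun i => @gfree_projective A _) fres_d_ghom (faug_ghom U) (@faug_surj A U)
    fres_exact0 fres_exact.

End FreeResolution.

(* A graded ring morphism with central image; it makes the groups of graded
   homomorphisms, hence [Ext], into graded [C]-modules. *)
Record central_map (C A : grRing) := CentralMap {
  cm :> C -> A;
  cm_add : forall x y, cm (x + y) = cm x + cm y;
  cm_one : cm 1 = 1;
  cm_mul : forall x y, cm (x * y) = cm x * cm y;
  cm_central : forall c a, cm c * a = a * cm c;
  cm_deg : forall m c, gr_deg m c -> gr_deg m (cm c)
}.

(* [Hom(U, W)] is the direct sum over [m] of [hom(q^m U, W)]: its elements are the
   finite sums of homogeneous linear maps, and the summand [hom(q^m U, W)] (the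
   linear maps raising degrees by [m]) is placed in degree [m]. *)
Section GradedHom.
Variables (C A : grRing) (phi : central_map C A) (U W : grMod A).

Definition hom_pred : {pred U -> W} :=
  fun f => `[< exists h, hdecomp (@is_ghom A U W) f h >].

Lemma is_ghom0 m : @is_ghom A U W m 0.
Proof.
split.
  move=> a x y; change (0 = a *: (0 : W) + 0); by rewrite scaler0 addr0.
by move=> j x _; exact: grading0 (gm_grading W) _.
Qed.

Lemma is_ghomB m (f g : U -> W) : is_ghom m f -> is_ghom m g -> is_ghom m (f - g).
Proof.
move=> [lf df] [lg dg]; split.
  move=> a x y.
  change (f (a *: x + y) - g (a *: x + y) = a *: (f x - g x) + (f y - g y)).
  by rewrite lf lg scalerBr opprD addrACA.
by move=> j x dx; apply: (gradingB (gm_grading W)); [exact: df|exact: dg].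
Qed.

Lemma is_ghomD m (f g : U -> W) : is_ghom m f -> is_ghom m g -> is_ghom m (f + g).
Proof.
move=> Hf Hg; rewrite -[g]opprK; apply: is_ghomB => //.
by rewrite -[- g]add0r; apply: is_ghomB => //; exact: is_ghom0.
Qed.

Fact hom_closed : zmod_closed hom_pred.
Proof.
split.
  apply/asboolP; exists (fun=> 0); split; first exact: is_ghom0.
  by exists [::]; split => //; rewrite big_nil.
move=> f g /asboolP[h [Dh [s [us hs fs]]]] /asboolP[k [Dk [t [ut kt gt]]]].
apply/asboolP; exists (fun m => h m - k m); split.
  by move=> m; exact: is_ghomB.
exists (undup (s ++ t)); split; first exact: undup_uniq.
  move=> i; rewrite mem_undup mem_cat negb_or => /andP[/hs -> /kt ->].
  by rewrite subrr.
by rewrite sumB_widen // -fs -gt.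
Qed.

HB.instance Definition _ := GRing.isZmodClosed.Build (U -> W) hom_pred hom_closed.

Definition hom_type : Type := {f : U -> W | f \in hom_pred}.

HB.instance Definition _ := SubChoice.on hom_type.
HB.instance Definition _ := [SubChoice_isSubZmodule of hom_type by <:].

Lemma hom_intro (f : U -> W) (h : int -> U -> W) :
  hdecomp (@is_ghom A U W) f h -> f \in hom_pred.
Proof. by move=> H; apply/asboolP; exists h. Qed.

Lemma homP (f : hom_type) : exists h, hdecomp (@is_ghom A U W) (val f) h.
Proof. exact/asboolP/(valP f). Qed.

Lemma homv_sum (I : Type) (s : seq I) (P : pred I) (F : I -> hom_type) :
  val (\sum_(i <- s | P i) F i) = \sum_(i <- s | P i) val (F i).
Proof. exact: raddf_sum. Qed.

Lemma is_ghom_scale i m c (f : U -> W) : gr_deg i c -> is_ghom m f ->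
  is_ghom (i + m) (fun x => phi c *: f x).
Proof.
move=> dc [lf df]; split.
  by move=> a x y; rewrite lf scalerDr !scalerA cm_central.
move=> j x dx; rewrite addrCA; apply: gm_scale; last exact: df.
exact: cm_deg.
Qed.

Lemma is_ghom_hom m (f : U -> W) : is_ghom m f -> f \in hom_pred.
Proof.
move=> Hf; apply/asboolP; exists (fun k => if k == m then f else 0); split.
  by move=> k; case: eqP => [->//|_]; exact: is_ghom0.
exists [:: m]; split => //; first by move=> k; rewrite inE => /negPf ->.
by rewrite big_seq1 eqxx.
Qed.

Lemma hom_pred_sum (I : eqType) (s : seq I) (F : I -> U -> W) :
  (forall i, i \in s -> F i \in hom_pred) -> \sum_(i <- s) F i \in hom_pred.
Proof. by move=> H; rewrite big_seq; apply: rpred_sum. Qed.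

Lemma cm0 : phi 0 = 0.
Proof. by apply: (addIr (phi 0)); rewrite -cm_add !add0r. Qed.

Lemma cm_sum (I : Type) (s : seq I) (P : pred I) (F : I -> C) :
  phi (\sum_(i <- s | P i) F i) = \sum_(i <- s | P i) phi (F i).
Proof. by apply: (big_morph phi) => [x y|]; rewrite ?cm_add ?cm0. Qed.

Fact hom_scale_subproof (c : C) (f : hom_type) :
  (fun x => phi c *: val f x) \in hom_pred.
Proof.
have [h [Dh [s [us hs fs]]]] := homP f.
have -> : (fun x => phi c *: val f x) =
    \sum_(p <- allpairs (fun i m => (i, m)) (hsupp (gr_grading C) c) s)
       (fun x => phi (hc (gr_grading C) c p.1) *: h p.2 x).
  apply/funext => x; rewrite fct_sumE.
  rewrite big_allpairs /=.
  rewrite {1}[c](hsupp_sum (gr_grading C)) cm_sum scaler_suml.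
  by apply: eq_bigr => i _; rewrite {1}fs fct_sumE scaler_sumr.
apply: hom_pred_sum => p _; apply: is_ghom_hom; apply: is_ghom_scale => //.
exact: hc_deg.
Qed.

Definition hom_scale (c : C) (f : hom_type) : hom_type :=
  exist (fun g => g \in hom_pred) _ (hom_scale_subproof c f).

Fact hom_scaleA a b f : hom_scale a (hom_scale b f) = hom_scale (a * b) f.
Proof. by apply: val_inj; apply/funext => x /=; rewrite scalerA cm_mul. Qed.
Fact hom_scale1 : left_id 1 hom_scale.
Proof. by move=> f; apply: val_inj; apply/funext => x /=; rewrite cm_one scale1r. Qed.
Fact hom_scaleDr : right_distributive hom_scale +%R.
Proof. by move=> a f g; apply: val_inj; apply/funext => x /=; rewrite -scalerDr. Qed.
Fact hom_scaleDl f : {morph hom_scale^~ f : a b / a + b}.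
Proof.
by move=> a b; apply: val_inj; apply/funext => x /=; rewrite cm_add scalerDl.
Qed.

HB.instance Definition _ := GRing.Zmodule_isLmodule.Build C hom_type
  hom_scaleA hom_scale1 hom_scaleDr hom_scaleDl.

Definition hom_deg (m : int) (f : hom_type) : Prop := is_ghom m (val f).

Lemma hdecomp_ghom (f : U -> W) (h : int -> U -> W) m j x :
  hdecomp (@is_ghom A U W) f h -> gm_deg j x ->
  h m x = hc (gm_grading W) (f x) (j + m).
Proof.
move=> [Dh [s [us hs ->]]] dx; rewrite fct_sumE hc_sum.
have D k := (Dh k).2 j x dx.
have E k : hc (gm_grading W) (h k x) (j + m) = if m == k then h k x else 0.
  by rewrite (hc_hom _ _ (D k)) (inj_eq (addrI j)).
under eq_bigr do rewrite E.
have [ms|ms] := boolP (m \in s).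
  rewrite (bigD1_seq m) //= eqxx big1 ?addr0 // => k km.
  by rewrite eq_sym (negPf km).
rewrite big_seq big1 ?hs // => k ks; case: eqP => // mk.
by rewrite mk ks in ms.
Qed.

Lemma hdecomp_ghom_uniq (f : U -> W) (h k : int -> U -> W) :
  hdecomp (@is_ghom A U W) f h -> hdecomp (@is_ghom A U W) f k -> h = k.
Proof.
move=> H K; apply/funext => m; apply/funext => x.
rewrite [x](hsupp_sum (gm_grading U)) (ghom_sum (H.1 m)) (ghom_sum (K.1 m)).
apply: eq_bigr => j _; have dj := hc_deg (gm_grading U) j x.
by rewrite (hdecomp_ghom m H dj) (hdecomp_ghom m K dj).
Qed.

Fact hom_grading : is_grading hom_deg.
Proof.
apply: is_gradingI => [m|f|h [Dh [s [us hs xs]]] m].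
- split; first exact: is_ghom0.
  by move=> f g; exact: is_ghomB.
- have [h [Dh [s [us hs fs]]]] := homP f.
  exists (fun m => exist (fun g => g \in hom_pred) (h m) (is_ghom_hom (Dh m))); split => //.
  exists s; split => //; first by move=> m /hs hm; apply: val_inj.
  by apply: val_inj; rewrite homv_sum.
- apply: val_inj.
  have E : hdecomp (@is_ghom A U W) 0 (fun m => val (h m)).
    split; first exact: Dh.
    exists s; split => //; first by move=> k /hs ->.
    by rewrite -homv_sum -xs.
  have E0 : hdecomp (@is_ghom A U W) 0 (fun=> 0).
    split; first exact: is_ghom0.
    by exists [::]; split => //; rewrite big_nil.
  exact: (congr1 (fun f => f m) (hdecomp_ghom_uniq E E0)).
Qed.

Fact hom_gscale i j (c : C) f : gr_deg i c -> hom_deg j f -> hom_deg (i + j) (c *: f).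
Proof. exact: is_ghom_scale. Qed.

Definition gHom : grMod C := GrMod hom_grading hom_gscale.

End GradedHom.

(* The cohomology of the graded complex [Hom(P_*, W)].  Its degree [m] part is
   the cohomology of [hom(q^m P_*, W)], so the cohomology is the direct sum of
   the groups [ext^i(q^m U, W)] when [P] resolves [U]. *)
Section ExtDef.
Variables (C A : grRing) (phi : central_map C A) (U W : grMod A).
Variable P : gresolution U.

Local Notation Hom i := (gHom phi (P i) W).

Definition cocycle (i : nat) (f : Hom i) : Prop :=
  forall x : P i.+1, val f (res_d x) = 0.

Fact cocycle0 i : @cocycle i 0. Proof. by []. Qed.
Fact cocycle_lin i (c : C) (f g : Hom i) :
  cocycle f -> cocycle g -> cocycle (c *: f + g).
Proof.
move=> Hf Hg x.
by rewrite [LHS](_ : _ = phi c *: val f (res_d x) + val g (res_d x)) // Hf Hg scaler0 addr0.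
Qed.

Definition cocycle_sub i : submodule (Hom i) :=
  Submodule (@cocycle0 i) (@cocycle_lin i).

Lemma hdecomp_homv (V : grMod A) (f : gHom phi V W) h :
  hdecomp (@gm_deg C (gHom phi V W)) f h ->
  hdecomp (@is_ghom A V W) (val f) (fun m => val (h m)).
Proof.
move=> [Dh [s [us hs xs]]]; split; first exact: Dh.
exists s; split => //; first by move=> k /hs ->.
by rewrite -[RHS](homv_sum s xpredT) -xs.
Qed.

Lemma hdecomp_comp (V V' : grMod A) (d : V -> V') (f : V' -> W) h :
  is_ghom 0 d -> hdecomp (@is_ghom A V' W) f h ->
  hdecomp (@is_ghom A V W) (f \o d) (fun m => h m \o d).
Proof.
move=> [ld dd] [Dh [s [us hs xs]]]; split.
  move=> m; have [lh dh] := Dh m; split; first by move=> a x y /=; rewrite ld lh.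
  by move=> j x /dd; rewrite addr0 => /dh.
exists s; split => //; first by move=> k /hs ->.
by apply/funext => x /=; rewrite xs !fct_sumE.
Qed.

Fact cocycle_hom i f h : cocycle_sub i f -> hdecomp (@gm_deg C (Hom i)) f h ->
  forall m, cocycle_sub i (h m).
Proof.
move=> Hf /hdecomp_homv/(hdecomp_comp (res_d_ghom P i)) E m x.
have E0 : hdecomp (@is_ghom A (P i.+1) W) (val f \o @res_d _ _ P i) (fun=> 0).
  have -> : val f \o @res_d _ _ P i = 0 by apply/funext => y; exact: Hf.
  split; first exact: is_ghom0.
  by exists [::]; split => //; rewrite big_nil.
exact: (congr1 (fun k => k m x) (hdecomp_ghom_uniq E E0)).
Qed.

Definition gcocycles i : hsubmodule (Hom i) := HSubmodule (@cocycle_hom i).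

Definition coboundary (i : nat) : Hom i -> Prop :=
  match i with
  | 0 => fun f => f = 0
  | j.+1 => fun f => exists g : Hom j, forall x, val f x = val g (res_d x)
  end.

Fact coboundary0 i : @coboundary i 0.
Proof. by case: i => //= i; exists 0. Qed.

Fact coboundary_lin i (c : C) (f g : Hom i) :
  coboundary f -> coboundary g -> coboundary (c *: f + g).
Proof.
case: i f g => [f g -> ->|i f g [f' Hf] [g' Hg]]; first by rewrite /= scaler0 addr0.
exists (c *: f' + g') => x.
rewrite [LHS](_ : _ = phi c *: val f x + val g x) // Hf Hg.
by [].
Qed.

Fact coboundary_hom i f h : @coboundary i f -> hdecomp (@gm_deg C (Hom i)) f h ->
  forall m, coboundary (h m).
Proof.
case: i f h => [f h -> E m|i f h [g Hg] E m].
  by rewrite /= (hc_uniq (gm_grading (Hom 0)) E) hc0.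
have /hdecomp_homv/(hdecomp_comp (res_d_ghom P i)) G := hcP (gm_grading (Hom i)) g.
have fg : val f = val g \o @res_d _ _ P i by apply/funext => x; exact: Hg.
have {}E := hdecomp_homv E; rewrite fg in E.
exists (hc (gm_grading (Hom i)) g m) => x.
exact: (congr1 (fun k => k m x) (hdecomp_ghom_uniq E G)).
Qed.

Definition cocycles i : grMod C := gsub (gcocycles i).

Fact cobound_lin i (c : C) (f g : cocycles i) :
  coboundary (val f) -> coboundary (val g) -> coboundary (val (c *: f + g)).
Proof. by rewrite smvD smvZ; exact: coboundary_lin. Qed.

Definition coboundary_sub i : submodule (cocycles i) :=
  Submodule (sm_pred := fun f : cocycles i => coboundary (val f))
    (@coboundary0 i) (@cobound_lin i).

Fact cobound_hom i f h : coboundary_sub i f ->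
  hdecomp (@gm_deg C (cocycles i)) f h -> forall m, coboundary_sub i (h m).
Proof.
move=> Bf [Dh [s [us hs xs]]] m; apply: (coboundary_hom Bf (h := fun k => val (h k))).
split; first exact: Dh.
exists s; split => //; first by move=> k /hs ->; rewrite smv0.
by rewrite -[RHS](smv_sum s xpredT) -xs.
Qed.

Definition gcoboundaries i : hsubmodule (cocycles i) := HSubmodule (@cobound_hom i).

Definition cohomology (i : nat) : grMod C := gquot (gcoboundaries i).

End ExtDef.

(* [Ext] is computed with the standard free resolution; as usual any other graded
   projective resolution yields an isomorphic graded module. *)
Definition Ext (C A : grRing) (phi : central_map C A) (i : nat) (U W : grMod A)
  : grMod C := cohomology phi W (free_resolution U) i.

Lemma hc_mulr (A : grRing) e (x y : A) m : gr_deg e y ->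
  hc (gr_grading A) (x * y) m = hc (gr_grading A) x (m - e) * y.
Proof.
move=> dy; have G := gr_grading A.
suff H : hdecomp (@gr_deg A) (x * y) (fun m => hc (gr_grading A) x (m - e) * y).
  by rewrite -(hc_uniq _ H).
split.
  move=> k; have := gr_mul (hc_deg (gr_grading A) (k - e) x) dy.
  by rewrite subrK.
exists [seq j + e | j <- hsupp (gr_grading A) x]; split.
- by rewrite map_inj_uniq ?hsupp_uniq //; exact: addIr.
- move=> k ks; rewrite hsuppN ?mul0r //; apply: contra ks => ks.
  by apply/mapP; exists (k - e) => //; rewrite subrK.
- rewrite big_map -mulr_suml; under eq_bigr do rewrite addrK.
  by rewrite -hsupp_sum.
Qed.

Lemma gens_hom (A : grRing) (M : grMod A) (N : submodule M) :
  (forall x, N x -> exists (T : eqType) (s : seq T) (F : T -> M) (d : T -> int),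
     (forall t, t \in s -> N (F t) /\ gm_deg (d t) (F t)) /\
     x = \sum_(t <- s) F t) ->
  forall x h, N x -> hdecomp (@gm_deg A M) x h -> forall m, N (h m).
Proof.
move=> H x h Nx /(hc_uniq (gm_grading M)) -> m.
have [T [s [F [d [FP ->]]]]] := H x Nx.
rewrite hc_sum big_seq; apply: sm_sum => t /FP[Nt dt].
by rewrite (hc_hom _ _ dt); case: eqP => // _; exact: sm_zero.
Qed.

Section RegularModule.
Variable A : grRing.

Fact greg_scale i j (a : A) (x : A^o) :
  gr_deg i a -> gr_deg j (x : A) -> gr_deg (i + j) (a *: x : A^o).
Proof. exact: gr_mul. Qed.

Definition greg : grMod A :=
  @GrMod A (A^o : lmodType A) (@gr_deg A) (gr_grading A) greg_scale.

End RegularModule.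

Section PolynomialRing.
Variable n : nat.
Local Notation Zu := {mpoly int[n]}.

(* The grading of [Z[u_1, ..., u_n]] with every [u_i] in degree 2. *)
Definition mpoly_deg (m : int) (p : Zu) : Prop :=
  forall k, k \in msupp p -> (2 * mdeg k)%:Z = m.

Lemma mpoly_degP m p :
  mpoly_deg m p <-> forall k, (2 * mdeg k)%:Z <> m -> p@_k = 0.
Proof.
split=> H k.
  by move=> km; apply: memN_msupp_eq0; apply/negP => /H.
by rewrite mcoeff_msupp => pk; apply: contrapT => /H/eqP; exact/negP.
Qed.

Lemma mcoeff_filter (P : pred 'X_{1..n}) (p : Zu) k :
  (\sum_(j <- msupp p | P j) p@_j *: 'X_[j])@_k = if P k then p@_k else 0.
Proof.
rewrite raddf_sum /=; under eq_bigr do rewrite mcoeffZ mcoeffX.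
have [ks|ks] := boolP (k \in msupp p); last first.
  rewrite (memN_msupp_eq0 ks) if_same big_seq_cond big1 // => j /andP[js _].
  by case: eqP => [jk|_]; [rewrite -jk js in ks|rewrite mulr0].
case: ifP => Pk.
  rewrite big_mkcond (bigD1_seq k) ?msupp_uniq //= Pk eqxx mulr1 big1 ?addr0 //.
  by move=> j jk; rewrite (negPf jk) mulr0 if_same.
rewrite big1_seq // => j /andP[Pj _].
by case: eqP => [jk|_]; [rewrite jk Pk in Pj|rewrite mulr0].
Qed.

Definition mpoly_hc (p : Zu) (m : int) : Zu :=
  \sum_(j <- msupp p | (2 * mdeg j)%:Z == m) p@_j *: 'X_[j].

Lemma mcoeff_hc p m k : (mpoly_hc p m)@_k = if (2 * mdeg k)%:Z == m then p@_k else 0.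
Proof. exact: mcoeff_filter. Qed.

Lemma mpoly_hdecomp p : hdecomp mpoly_deg p (mpoly_hc p).
Proof.
split; first by move=> m; apply/mpoly_degP => k /eqP/negPf km; rewrite mcoeff_hc km.
exists (undup [seq (2 * mdeg k)%:Z | k <- msupp p]); split.
- exact: undup_uniq.
- move=> m; rewrite mem_undup => ms; apply/mpolyP => k; rewrite mcoeff_hc mcoeff0.
  case: eqP => // km; apply: memN_msupp_eq0; apply: contra ms => ks.
  by rewrite -km; apply: (map_f (fun k : 'X_{1..n} => (2 * mdeg k)%:Z)).
- apply/mpolyP => k; rewrite raddf_sum /=; under eq_bigr do rewrite mcoeff_hc.
  have [ks|ks] := boolP (k \in msupp p).
    rewrite (bigD1_seq (2 * mdeg k)%:Z) ?undup_uniq //=; last first.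
      by rewrite mem_undup; apply: (map_f (fun k : 'X_{1..n} => (2 * mdeg k)%:Z)).
    by rewrite eqxx big1 ?addr0 // => m; rewrite eq_sym => /negPf ->.
  by rewrite (memN_msupp_eq0 ks) big1 // => m _; rewrite if_same.
Qed.

Fact mpoly_grading : is_grading mpoly_deg.
Proof.
apply: is_gradingI => [m|p|h [Dh [s [us hs xs]]] m].
- split; first by move=> k; rewrite msupp0 in_nil.
  move=> p q /mpoly_degP dp /mpoly_degP dq; apply/mpoly_degP => k km.
  by rewrite mcoeffB dp // dq // subrr.
- by exists (mpoly_hc p); exact: mpoly_hdecomp.
- have [ms|/hs //] := boolP (m \in s).
  apply/mpolyP => k; rewrite mcoeff0; case: ((2 * mdeg k)%:Z =P m) => [km|km].
    have := congr1 (mcoeff k) xs.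
    rewrite mcoeff0 raddf_sum /= (bigD1_seq m) //= big1 ?addr0 // => j jm.
    by have /mpoly_degP := Dh j; apply; rewrite km; apply/eqP; rewrite eq_sym.
  by have /mpoly_degP := Dh m; apply.
Qed.

Fact mpoly_deg1 : mpoly_deg 0 1.
Proof. by move=> k; rewrite msupp1 inE => /eqP ->; rewrite mdeg0 muln0. Qed.

Fact mpoly_degM i j p q :
  mpoly_deg i p -> mpoly_deg j q -> mpoly_deg (i + j) (p * q).
Proof.
move=> dp dq k /msuppM_le/allpairsP[[a b] /= [/dp <- /dq <- ->]].
by rewrite mdegD mulnDr PoszD.
Qed.

Definition Zu_gr : grRing :=
  @GrRing (Zu : pzRingType) mpoly_deg mpoly_grading mpoly_deg1 mpoly_degM.

Lemma hc_mpoly p m : hc (gr_grading Zu_gr) p m = mpoly_hc p m.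
Proof.
by have := hc_uniq (gr_grading Zu_gr) (mpoly_hdecomp p) => ->.
Qed.

Definition umon (S : {set 'I_n}) : Zu := \prod_(i in S) 'X_i.

Lemma mpolyX_deg (i : 'I_n) : mpoly_deg 2 'X_i.
Proof. by move=> k; rewrite msuppX inE => /eqP ->; rewrite mdeg1. Qed.

Lemma umon_deg (S : {set 'I_n}) : mpoly_deg (2 * #|S|)%:Z (umon S).
Proof.
rewrite /umon -sum1_card; elim/big_rec2: _ => [|i p k _ dk].
  by rewrite muln0; exact: mpoly_deg1.
rewrite mulnDr PoszD; apply: mpoly_degM => //; exact: mpolyX_deg.
Qed.

(* [Z[u_z]] as a graded module over [Z[u_1, ..., u_n]], where [u_j] acts as zero
   for [j] outside [z] (this is what [set_zero] implements), and its quotient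
   [Z[u_z] / (u_j : j in y)]. *)
Section SubPolynomialRing.
Variable z : {set 'I_n}.

Definition polyin_pred : {pred Zu} := fun p =>
  all (fun k : 'X_{1..n} => [forall j, (j \notin z) ==> (k j == 0%N)]) (msupp p).

Definition mon_in (k : 'X_{1..n}) := [forall j, (j \notin z) ==> (k j == 0%N)].

Definition set_zero (p : Zu) : Zu :=
  p \mPo [tuple (if j \in z then 'X_j else 0) | j < n].

Lemma set_zeroM p q : set_zero (p * q) = set_zero p * set_zero q.
Proof. exact: rmorphM. Qed.
Lemma set_zeroD p q : set_zero (p + q) = set_zero p + set_zero q.
Proof. exact: rmorphD. Qed.
Lemma set_zero1 : set_zero 1 = 1.
Proof. exact: rmorph1. Qed.

Lemma set_zeroX k : set_zero 'X_[k] = if mon_in k then 'X_[k] else 0.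
Proof.
rewrite /set_zero comp_mpolyX; under eq_bigr do rewrite tnth_mktuple.
case: ifPn => [/forallP kz|/forallPn[j]].
  rewrite [RHS]mpolyXE_id; apply: eq_bigr => j _; case: ifPn => // jz.
  by have /implyP/(_ jz)/eqP -> := kz j; rewrite !expr0.
rewrite negb_imply => /andP[jz kj]; rewrite (bigD1 j) //= (negPf jz).
by rewrite expr0n (negPf kj) mul0r.
Qed.

Lemma mcoeff_set_zero p k : (set_zero p)@_k = if mon_in k then p@_k else 0.
Proof.
have -> : set_zero p = \sum_(j <- msupp p | mon_in j) p@_j *: 'X_[j].
  rewrite {1}[p]mpolyE /set_zero raddf_sum /= [RHS]big_mkcond /=.
  apply: eq_bigr => j _; rewrite comp_mpolyZ -/(set_zero _) set_zeroX.
  by case: ifP => // _; rewrite scaler0.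
exact: mcoeff_filter.
Qed.

Lemma polyin_mon p : reflect (forall k, ~~ mon_in k -> p@_k = 0) (p \in polyin_pred).
Proof.
apply: (iffP allP) => [H k kz|H k].
  by apply: memN_msupp_eq0; apply/negP => /H; exact/negP.
by rewrite mcoeff_msupp; apply: contraNT => kz; rewrite H.
Qed.

Lemma polyinP p : reflect (set_zero p = p) (p \in polyin_pred).
Proof.
apply: (iffP (polyin_mon p)) => [H|<- k kz].
  apply/mpolyP => k; rewrite mcoeff_set_zero; case: ifPn => // kz.
  by rewrite H.
by rewrite mcoeff_set_zero (negPf kz).
Qed.

Fact polyin_closed : zmod_closed polyin_pred.
Proof.
split; first by apply/polyin_mon => k _; rewrite mcoeff0.
move=> p q /polyin_mon dp /polyin_mon dq; apply/polyin_mon => k kz.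
by rewrite mcoeffB dp // dq // subrr.
Qed.

HB.instance Definition _ := GRing.isZmodClosed.Build Zu polyin_pred polyin_closed.

Definition polyin : Type := {p : Zu | p \in polyin_pred}.

HB.instance Definition _ := SubChoice.on polyin.
HB.instance Definition _ := [SubChoice_isSubZmodule of polyin by <:].

Fact polyin_scale_subproof (c : Zu) (p : polyin) : set_zero c * val p \in polyin_pred.
Proof.
apply/polyinP; rewrite set_zeroM.
have /polyinP -> := valP p; congr (_ * _).
by apply/mpolyP => k; rewrite !mcoeff_set_zero; case: (mon_in k).
Qed.

Definition polyin_scale (c : Zu) (p : polyin) : polyin :=
  exist (fun q => q \in polyin_pred) _ (polyin_scale_subproof c p).

Fact polyin_scaleA a b p : polyin_scale a (polyin_scale b p) = polyin_scale (a * b) p.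
Proof. by apply: val_inj; rewrite /= mulrA set_zeroM. Qed.
Fact polyin_scale1 : left_id 1 polyin_scale.
Proof. by move=> p; apply: val_inj; rewrite /= set_zero1 mul1r. Qed.
Fact polyin_scaleDr : right_distributive polyin_scale +%R.
Proof. by move=> a p q; apply: val_inj; rewrite /= mulrDr. Qed.
Fact polyin_scaleDl p : {morph polyin_scale^~ p : a b / a + b}.
Proof. by move=> a b; apply: val_inj; rewrite /= set_zeroD mulrDl. Qed.

HB.instance Definition _ := GRing.Zmodule_isLmodule.Build Zu polyin
  polyin_scaleA polyin_scale1 polyin_scaleDr polyin_scaleDl.

Definition polyin_deg (m : int) (p : polyin) : Prop := mpoly_deg m (val p).

Lemma mpoly_hc_in p m : p \in polyin_pred -> mpoly_hc p m \in polyin_pred.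
Proof.
move=> /polyin_mon H; apply/polyin_mon => k kz.
by rewrite mcoeff_hc H // if_same.
Qed.

Definition polyin_hc (p : polyin) (m : int) : polyin :=
  exist (fun q => q \in polyin_pred) _ (mpoly_hc_in m (valP p)).

Lemma polyinv_sum (I : Type) (s : seq I) (P : pred I) (F : I -> polyin) :
  val (\sum_(i <- s | P i) F i) = \sum_(i <- s | P i) val (F i).
Proof. exact: raddf_sum. Qed.

Lemma polyin_hdecomp p : hdecomp polyin_deg p (polyin_hc p).
Proof.
have [D [s [us hs ps]]] := mpoly_hdecomp (val p).
split; first by move=> m; exact: D.
exists s; split => //; first by move=> m /hs hm; apply: val_inj.
by apply: val_inj; rewrite polyinv_sum.
Qed.

Fact polyin_grading : is_grading polyin_deg.
Proof.
apply: is_gradingI => [m|p|h [Dh [s [us hs xs]]] m].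
- split; first exact: (grading0 mpoly_grading).
  by move=> p q dp dq; apply: (gradingB mpoly_grading).
- by exists (polyin_hc p); exact: polyin_hdecomp.
- apply: val_inj.
  have E : hdecomp mpoly_deg 0 (fun m => val (h m)).
    split; first exact: Dh.
    exists s; split => //; first by move=> k /hs ->.
    by rewrite -polyinv_sum -xs.
  by have /(congr1 (fun f => f m)) := hc_uniq mpoly_grading E; rewrite hc0.
Qed.

Fact polyin_gscale i j (c : Zu_gr) (p : polyin) :
  gr_deg i c -> polyin_deg j p -> polyin_deg (i + j) ((c : Zu) *: p).
Proof.
move=> dc dp; apply: mpoly_degM => //; apply/mpoly_degP => k km.
by have /mpoly_degP dc' := dc; rewrite mcoeff_set_zero dc' // if_same.
Qed.

Definition gpolyin : grMod Zu_gr :=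
  @GrMod Zu_gr (polyin : lmodType Zu) polyin_deg polyin_grading polyin_gscale.

Variable y : {set 'I_n}.

Definition var_ideal_pred (p : gpolyin) : Prop :=
  exists c : 'I_n -> polyin, val p = \sum_(j in y) 'X_j * val (c j).

Fact var_ideal0 : var_ideal_pred 0.
Proof. by exists (fun=> 0); rewrite big1 // => j _; rewrite mulr0. Qed.

Fact var_ideal_lin (a : Zu) (p q : gpolyin) :
  var_ideal_pred p -> var_ideal_pred q -> var_ideal_pred (a *: p + q).
Proof.
move=> [c cp] [d dq]; exists (fun j => a *: c j + d j).
rewrite (_ : val (a *: p + q) = set_zero a * val p + val q) // cp dq mulr_sumr.
rewrite -big_split; apply: eq_bigr => j _.
rewrite (_ : val (a *: c j + d j) = set_zero a * val (c j) + val (d j)) //.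
by rewrite mulrDr mulrCA.
Qed.

Definition var_ideal_sub : submodule gpolyin := Submodule var_ideal0 var_ideal_lin.

Fact var_ideal_hom p h : var_ideal_sub p -> hdecomp (@gm_deg _ gpolyin) p h ->
  forall m, var_ideal_sub (h m).
Proof.
move=> [c cp] /(hc_uniq (gm_grading gpolyin)) -> m.
have <- := hc_uniq (gm_grading gpolyin) (polyin_hdecomp p).
exists (fun j => polyin_hc (c j) (m - 2)) => /=.
rewrite -hc_mpoly cp (hc_sum (gr_grading Zu_gr)); apply: eq_bigr => j _.
rewrite mulrC (@hc_mulr Zu_gr 2); last exact: mpolyX_deg.
by rewrite mulrC hc_mpoly.
Qed.

Definition var_ideal : hsubmodule gpolyin := HSubmodule var_ideal_hom.

Definition gpolyquot : grMod Zu_gr := gquot var_ideal.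

End SubPolynomialRing.
End PolynomialRing.
(* The pairing of [(R^n)^*] with [R^n]. *)
Definition dotv (R : realType) (n : nat) (w x : 'rV[R]_n) : R :=
  \sum_(i < n) w 0 i * x 0 i.

(* [eta] in [R^n / V] and [xi] in [(R^n)^* / V^perp] are given by chosen lifts
   [pa_eta] and [pa_xi]; the two genericity conditions range over all lifts.
   Nothing below depends on the choice: [Veta] is the coset of [pa_eta], and
   [xi] is only used on [V] and, up to an additive constant, on [Veta]. *)
Record polarized (R : realType) (n k : nat) := Polarized {
  pa_V : {vspace 'rV[R]_n};
  pa_eta : 'rV[R]_n;
  pa_xi : 'rV[R]_n;
  pa_dim : \dim pa_V = k;
  pa_eta_generic : forall v, v \in pa_V ->
    (n - k <= #|[set i | (pa_eta + v)%R ord0 i != 0%R]|)%N;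
  pa_xi_generic : forall w, (forall v, v \in pa_V -> dotv w v = 0) ->
    (k <= #|[set i | (pa_xi + w)%R ord0 i != 0%R]|)%N
}.

(* [true] stands for +1 and [false] for -1. *)
Definition signvec (n : nat) := {ffun 'I_n -> bool}.

Section SignVectors.
Variable n : nat.
Implicit Types a b c : signvec n.

Definition sgn (R : realType) a (i : 'I_n) : R := if a i then 1 else -1.

Definition sdist a b : nat := #|[set i | a i != b i]|.

Definition sset a b c : {set 'I_n} := [set i | (a i == c i) && (c i != b i)].

End SignVectors.

Section Arrangement.
Variables (R : realType) (n k : nat) (V : polarized R n k).
Implicit Types (a b c : signvec n) (S : {set 'I_n}) (x y : 'rV[R]_n).

Definition xi x : R := dotv (pa_xi V) x.

Definition Veta x : Prop := x - pa_eta V \in pa_V V.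

Definition Hset (S : {set 'I_n}) x : Prop := Veta x /\ forall i, i \in S -> x 0 i = 0.

Definition Delta a x : Prop := Veta x /\ forall i, 0 <= sgn R a i * x 0 i.

Definition Sigma a x : Prop :=
  x \in pa_V V /\ forall i, 0 <= sgn R a i * x 0 i.

Definition feasible_signs : {set signvec n} := [set a | `[< exists x, Delta a x >]].

Definition bounded_signs : {set signvec n} :=
  [set a | `[< exists M : R, forall x, Sigma a x -> xi x <= M >]].

Definition Pset : {set signvec n} := feasible_signs :&: bounded_signs.

Definition bases : {set {set 'I_n}} :=
  [set S : {set 'I_n} | (#|S| == k) && `[< exists x, Hset S x >]].

(* [Hset S] is a point when [S] is in [bases]. *)
Definition max_at a S : Prop :=
  exists p, [/\ Hset S p, Delta a p & forall x, Delta a x -> xi x <= xi p].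

(* The default value is irrelevant: for [S] in [bases] there is exactly one [a] in
   [Pset] with [max_at a S], and [mu] is a bijection from [bases] to [Pset]. *)
Definition mu S : signvec n :=
  odflt [ffun=> true] [pick a in Pset | `[< max_at a S >]].

Definition bas_of a : {set 'I_n} :=
  odflt set0 [pick S in bases | mu S == a].

Definition bcone (S : {set 'I_n}) : {set signvec n} :=
  [set c : signvec n | [forall i in S, c i == mu S i]].

Definition fcone (S : {set 'I_n}) : {set signvec n} :=
  [set c : signvec n | [forall i in ~: S, c i == mu S i]].

(* The strict relation generating the order; [(#|S :&: S'|).+1 == k] is
   [#|S :&: S'| = k - 1] without truncated subtraction. *)
Definition bas_step (S S' : {set 'I_n}) : bool :=
  [&& S \in bases, S' \in bases, (#|S :&: S'|).+1 == k &
      `[< exists p p', [/\ Hset S p, Hset S' p' & xi p < xi p'] >]].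

Definition bas_le (S S' : {set 'I_n}) : bool := connect bas_step S S'.

(* The index set [P] of sign vectors that are feasible and bounded. *)
Definition chamber : Type := {a : signvec n | a \in Pset}.
HB.instance Definition _ := Finite.on chamber.

Definition signs (a : chamber) : signvec n := val a.

Definition chamber_lt (a b : chamber) : bool :=
  (a != b) && bas_le (bas_of (val a)) (bas_of (val b)).

Local Notation Zu := {mpoly int[n]}.

(* The ideal generated by the [u_S] with [Delta a], [Delta b] and [H_S] having no
   common point. *)
Definition rel_ideal_pred (a b : signvec n) (p : (Zu)^o) : Prop :=
  exists c : {set 'I_n} -> Zu,
    p = \sum_(S : {set 'I_n} |
           `[< ~ exists x, [/\ Delta a x, Delta b x & Hset S x] >]) c S * umon S.

Fact rel_ideal0 a b : rel_ideal_pred a b 0.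
Proof. by exists (fun=> 0); rewrite big1 // => S _; rewrite mul0r. Qed.

Fact rel_ideal_lin a b (q : Zu) (p p' : (Zu)^o) :
  rel_ideal_pred a b p -> rel_ideal_pred a b p' -> rel_ideal_pred a b (q *: p + p').
Proof.
move=> [c ->] [c' ->]; exists (fun S => q * c S + c' S).
rewrite [q *: _]mulr_sumr -big_split; apply: eq_bigr => S _.
by rewrite mulrDl mulrA.
Qed.

Definition rel_ideal a b : submodule (Zu)^o :=
  Submodule (@rel_ideal0 a b) (@rel_ideal_lin a b).

Lemma rel_ideal_hc a b p m : rel_ideal a b p -> rel_ideal a b (mpoly_hc p m).
Proof.
move=> [c ->]; exists (fun S => mpoly_hc (c S) (m - (2 * #|S|)%:Z)).
rewrite -hc_mpoly (hc_sum (gr_grading (Zu_gr n))); apply: eq_bigr => S _.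
by rewrite (@hc_mulr (Zu_gr n) (2 * #|S|)%:Z) ?hc_mpoly //; exact: umon_deg.
Qed.

Lemma umon_mul S S' : exists q, umon S * umon S' = q * umon (S :|: S') :> Zu.
Proof.
exists (umon (S :&: S')); rewrite /umon (big_setID S') /=.
rewrite -mulrA; congr (_ * _); rewrite [RHS](big_setID S') /= mulrC.
by rewrite setDUl setDv setU0 (setIidPr (subsetUr _ _)).
Qed.

Lemma rel_ideal_comp a b c p : rel_ideal a b p \/ rel_ideal b c p ->
  rel_ideal a c (umon (sset a b c) * p).
Proof.
have key S x : Delta a x -> Delta c x -> Hset (S :|: sset a b c) x -> Delta b x.
  move=> [Vx ax] [_ cx] [_ Hx]; split => // i.
  have [abi|abi] := eqVneq (a i) (b i); first by rewrite /sgn -abi; exact: ax.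
  have [cbi|cbi] := eqVneq (c i) (b i); first by rewrite /sgn -cbi; exact: cx.
  rewrite Hx ?mulr0 // !inE cbi andbT; apply/orP; right.
  by move: abi cbi; case: (a i); case: (b i); case: (c i).
have E (d d' : signvec n) : (forall S, `[< ~ exists x, [/\ Delta d x, Delta d' x & Hset S x] >] ->
      `[< ~ exists x, [/\ Delta a x, Delta c x & Hset (S :|: sset a b c) x] >]) ->
    rel_ideal d d' p -> rel_ideal a c (umon (sset a b c) * p).
  move=> H [q ->]; rewrite mulr_sumr; apply: sm_sum => S /H HS.
  have [r rE] := umon_mul S (sset a b c).
  exists (fun T => if T == S :|: sset a b c then q S * r else 0).
  rewrite (bigD1 (S :|: sset a b c)) //= eqxx big1 ?addr0.
    by rewrite mulrCA [umon _ * umon _]mulrC rE mulrA.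
  by move=> T /andP[_ /negPf ->]; rewrite mul0r.
case; apply: E => S /asboolP H; apply/asboolP => -[x [ax cx hx]]; apply: H; exists x.
  split => //; first exact: key hx.
  by case: hx => ? hx; split => // i iS; apply: hx; rewrite inE iS.
split => //; first exact: key hx.
by case: hx => ? hx; split => // i iS; apply: hx; rewrite inE iS.
Qed.

(* [bpre] is the direct sum, over pairs [(a, b)], of copies of [Z[u]] with
   generators [f_(a,b)] in degree [pdist (a, b)]; the algebra is its quotient by
   the direct sum of the ideals [rel_ideal a b], i.e. the direct sum of the
   rings [Z[u] / rel_ideal a b]. *)
Definition bpre : Type := {ffun chamber * chamber -> (Zu)^o}.
HB.instance Definition _ := GRing.Zmodule.on bpre.
HB.instance Definition _ := GRing.Lmodule.on bpre.

Definition pdist (p : chamber * chamber) : int := (sdist (val p.1) (val p.2))%:Z.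

Definition bpre_deg (m : int) (f : bpre) : Prop :=
  forall p, mpoly_deg (m - pdist p) (f p).

Definition bpre_hc (f : bpre) (m : int) : bpre :=
  [ffun p => mpoly_hc (f p) (m - pdist p)].

Let GZ := @mpoly_grading n.

Lemma bpre_sumE (I : Type) (s : seq I) (P : pred I) (F : I -> bpre) p :
  (\sum_(i <- s | P i) F i) p = \sum_(i <- s | P i) (F i p : Zu).
Proof. exact: sum_ffunE. Qed.

Lemma bpre_hdecomp f : hdecomp bpre_deg f (bpre_hc f).
Proof.
split; first by move=> m p; rewrite ffunE; exact: (mpoly_hdecomp _).1.
have hE p m : mpoly_hc (f p) m = hc GZ (f p) m.
  by rewrite -(hc_uniq GZ (mpoly_hdecomp (f p))).
pose t := undup (flatten [seq [seq j + pdist p | j <- hsupp GZ (f p)]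
                            | p <- enum {: chamber * chamber}]).
have tP m p : m \notin t -> mpoly_hc (f p) (m - pdist p) = 0.
  rewrite mem_undup => mt; rewrite hE; apply: hsuppN; apply: contra mt => mt.
  apply/flattenP; exists [seq j + pdist p | j <- hsupp GZ (f p)].
    by apply: (map_f (fun p => [seq j + pdist p | j <- hsupp GZ (f p)])); rewrite mem_enum.
  by apply/mapP; exists (m - pdist p) => //; rewrite subrK.
exists t; split; first exact: undup_uniq.
  by move=> m mt; apply/ffunP => p; rewrite !ffunE tP.
apply/ffunP => p; rewrite bpre_sumE; under eq_bigr do rewrite ffunE hE.
rewrite [LHS](@hc_sumE _ _ GZ _ [seq m - pdist p | m <- t]).
- by rewrite big_map.
- by rewrite map_inj_uniq ?undup_uniq //; exact: addIr.
- move=> m mt; rewrite -hE -[m](addrK (pdist p)); apply: tP; apply: contra mt => mt.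
  by apply/mapP; exists (m + pdist p) => //; rewrite addrK.
Qed.

Fact bpre_grading : is_grading bpre_deg.
Proof.
apply: is_gradingI => [m|f|h [Dh [s [us hs xs]]] m].
- split; first by move=> p; rewrite ffunE; exact: (grading0 GZ).
  by move=> f g df dg p; rewrite !ffunE; apply: (gradingB GZ).
- by exists (bpre_hc f); exact: bpre_hdecomp.
- apply/ffunP => p; rewrite ffunE.
  have E : hdecomp (@mpoly_deg n) 0 (fun m => h (m + pdist p) p).
    split; first by move=> j; have := Dh (j + pdist p) p; rewrite addrK.
    exists [seq j - pdist p | j <- s]; split.
    + by rewrite map_inj_uniq //; exact: addIr.
    + move=> j js; rewrite hs ?ffunE //; apply: contra js => js.
      by apply/mapP; exists (j + pdist p) => //; rewrite addrK.
    + rewrite big_map; under eq_bigr do rewrite subrK.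
      by have := congr1 (fun f : bpre => f p) xs; rewrite bpre_sumE ffunE.
  have /(congr1 (fun f => f (m - pdist p))) := hc_uniq GZ E.
  by rewrite subrK hc0.
Qed.

Fact bpre_gscale i j (q : Zu_gr n) (f : bpre) :
  gr_deg i q -> bpre_deg j f -> bpre_deg (i + j) ((q : Zu) *: f).
Proof. by move=> dq df p; rewrite ffunE -addrA; apply: mpoly_degM. Qed.

Definition gbpre : grMod (Zu_gr n) :=
  @GrMod (Zu_gr n) (bpre : lmodType Zu) bpre_deg bpre_grading bpre_gscale.

Definition brel_pred (f : gbpre) : Prop :=
  forall p : chamber * chamber, rel_ideal (val p.1) (val p.2) ((f : bpre) p).

Fact brel0 : brel_pred 0.
Proof. by move=> p; rewrite ffunE; exact: sm_zero. Qed.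

Fact brel_lin (q : Zu_gr n) (f g : gbpre) :
  brel_pred f -> brel_pred g -> brel_pred (q *: f + g).
Proof. by move=> Hf Hg p; rewrite !ffunE; exact: sm_lin. Qed.

Definition brel_sub : submodule gbpre := Submodule brel0 brel_lin.

Fact brel_hom f h : brel_sub f -> hdecomp (@gm_deg _ gbpre) f h ->
  forall m, brel_sub (h m).
Proof.
move=> Hf /(hc_uniq (gm_grading gbpre)) -> m.
have <- := hc_uniq (gm_grading gbpre) (bpre_hdecomp f).
by move=> p; rewrite ffunE; apply: rel_ideal_hc; exact: Hf.
Qed.

Definition brel : hsubmodule gbpre := HSubmodule brel_hom.

Definition gB : grMod (Zu_gr n) := gquot brel.

Definition Bcarrier : Type := quot_mod brel.
HB.instance Definition _ := GRing.Zmodule.on Bcarrier.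

(* [f_(a,b) f_(b,c) = u_(S(abc)) f_(a,c)], extended [Z[u]]-bilinearly. *)
Definition bmul_pre (f g : bpre) : bpre :=
  [ffun p => \sum_(b : chamber)
     (f (p.1, b) : Zu) * (g (b, p.2) : Zu) * umon (sset (val p.1) (val b) (val p.2))].

Definition bone_pre : bpre := [ffun p => if p.1 == p.2 then 1 else 0].

Lemma umon_sset a b c d : umon (sset a b c) * umon (sset a c d) =
  umon (sset a b d) * umon (sset b c d) :> Zu.
Proof.
rewrite /umon !(big_mkcond (fun i => i \in _)) -!big_split /=.
apply: eq_bigr => i _; rewrite !inE.
by case: (a i); case: (b i); case: (c i); case: (d i); rewrite /= ?(mul1r, mulr1).
Qed.

Lemma sset_aab a b : sset a a b = set0.
Proof. by apply/setP => i; rewrite !inE; case: (a i); case: (b i). Qed.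
Lemma sset_abb a b : sset a b b = set0.
Proof. by apply/setP => i; rewrite !inE; case: (a i); case: (b i). Qed.
Lemma umon0 : umon set0 = 1 :> Zu.
Proof. by rewrite /umon big_set0. Qed.

Lemma bmul_preA f g h : bmul_pre f (bmul_pre g h) = bmul_pre (bmul_pre f g) h.
Proof.
apply/ffunP => -[a d]; rewrite !ffunE /=.
transitivity (\sum_(b : chamber) \sum_(c : chamber)
  (f (a, b) : Zu) * (g (b, c) : Zu) * (h (c, d) : Zu) *
  (umon (sset (val a) (val b) (val c)) * umon (sset (val a) (val c) (val d)))).
  apply: eq_bigr => b _; rewrite ffunE /= mulr_sumr mulr_suml.
  by apply: eq_bigr => c _; rewrite umon_sset; ring.
rewrite exchange_big /=; apply: eq_bigr => c _; rewrite ffunE /= 2!mulr_suml.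
by apply: eq_bigr => b _; ring.
Qed.

Lemma bmul_pre1l f : bmul_pre bone_pre f = f.
Proof.
apply/ffunP => -[a c]; rewrite !ffunE /= (bigD1 a) //= ffunE eqxx big1.
  by rewrite sset_aab umon0 mulr1 mul1r addr0.
by move=> b ba; rewrite ffunE /= eq_sym (negPf ba) !mul0r.
Qed.

Lemma bmul_pre1r f : bmul_pre f bone_pre = f.
Proof.
apply/ffunP => -[a c]; rewrite !ffunE /= (bigD1 c) //= ffunE eqxx big1.
  by rewrite sset_abb umon0 !mulr1 addr0.
by move=> b bc; rewrite ffunE /= (negPf bc) mulr0 mul0r.
Qed.

Lemma bmul_preDl f g h : bmul_pre (f + g) h = bmul_pre f h + bmul_pre g h.
Proof.
apply/ffunP => -[a c]; rewrite !ffunE -big_split; apply: eq_bigr => b _.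
by rewrite ffunE /= !mulrDl.
Qed.

Lemma bmul_preDr f g h : bmul_pre f (g + h) = bmul_pre f g + bmul_pre f h.
Proof.
apply/ffunP => -[a c]; rewrite !ffunE -big_split; apply: eq_bigr => b _.
by rewrite ffunE /= mulrDr mulrDl.
Qed.

Lemma bmul_preBl f g h : bmul_pre (f - g) h = bmul_pre f h - bmul_pre g h.
Proof. by apply/eqP; rewrite eq_sym subr_eq -bmul_preDl subrK. Qed.

Lemma bmul_preBr f g h : bmul_pre f (g - h) = bmul_pre f g - bmul_pre f h.
Proof. by apply/eqP; rewrite eq_sym subr_eq -bmul_preDr subrK. Qed.

Lemma bmul_preZl (q : Zu) f g : bmul_pre (q *: f) g = q *: bmul_pre f g.
Proof.
apply/ffunP => -[a c]; rewrite !ffunE [RHS]mulr_sumr; apply: eq_bigr => b _.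
by rewrite ffunE /= !mulrA.
Qed.

Lemma bmul_preZr (q : Zu) f g : bmul_pre f (q *: g) = q *: bmul_pre f g.
Proof.
apply/ffunP => -[a c]; rewrite !ffunE [RHS]mulr_sumr; apply: eq_bigr => b _.
rewrite ffunE /=; set u := umon _.
change ((f (a, b) : Zu) * (q * (g (b, c) : Zu)) * u =
  q * ((f (a, b) : Zu) * (g (b, c) : Zu) * u)).
by rewrite mulrCA -!mulrA.
Qed.

Lemma brel_mull f g : brel g -> brel (bmul_pre f g).
Proof.
move=> Hg [a c]; rewrite ffunE; apply: (sm_sum (N := rel_ideal (val a) (val c))) => b _ /=.
rewrite -mulrA [_ * umon _]mulrC; apply: (sm_scale (N := rel_ideal _ _)).
by apply: rel_ideal_comp; right; exact: (Hg (b, c)).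
Qed.

Lemma brel_mulr f g : brel f -> brel (bmul_pre f g).
Proof.
move=> Hf [a c]; rewrite ffunE; apply: (sm_sum (N := rel_ideal (val a) (val c))) => b _ /=.
rewrite mulrAC mulrC; apply: (sm_scale (N := rel_ideal _ _)); rewrite mulrC.
by apply: rel_ideal_comp; left; exact: (Hf (a, b)).
Qed.

Definition bpi (f : bpre) : Bcarrier := qpi brel (f : gbpre).

Definition bmul (x y : Bcarrier) : Bcarrier :=
  bpi (bmul_pre (qrepr (x : quot_mod brel)) (qrepr (y : quot_mod brel))).

Lemma bpi_repr (x : Bcarrier) : bpi (qrepr (x : quot_mod brel)) = x.
Proof. exact: qreprK. Qed.

Lemma bmul_pi f g : bmul (bpi f) (bpi g) = bpi (bmul_pre f g).
Proof.
apply/(qpi_eq brel).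
set f' := qrepr _; set g' := qrepr _.
have -> : bmul_pre f' g' - bmul_pre f g = bmul_pre (f' - f) g' + bmul_pre f (g' - g).
  by rewrite bmul_preBl bmul_preBr addrA subrK.
apply: sm_add; first by apply: brel_mulr; exact: (@qreprP _ _ brel f).
by apply: brel_mull; exact: (@qreprP _ _ brel g).
Qed.

Lemma bpiD f g : bpi (f + g) = bpi f + bpi g.
Proof. exact: qpiD. Qed.

Fact bmulA : associative bmul.
Proof.
move=> x y z; rewrite -[x]bpi_repr -[y]bpi_repr -[z]bpi_repr !bmul_pi.
by rewrite bmul_preA.
Qed.
Fact bmul1l : left_id (bpi bone_pre) bmul.
Proof. by move=> x; rewrite -[x]bpi_repr bmul_pi bmul_pre1l. Qed.
Fact bmul1r : right_id (bpi bone_pre) bmul.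
Proof. by move=> x; rewrite -[x]bpi_repr bmul_pi bmul_pre1r. Qed.
Fact bmulDl : left_distributive bmul +%R.
Proof.
move=> x y z; rewrite -[x]bpi_repr -[y]bpi_repr -[z]bpi_repr -bpiD !bmul_pi.
by rewrite bmul_preDl bpiD.
Qed.
Fact bmulDr : right_distributive bmul +%R.
Proof.
move=> x y z; rewrite -[x]bpi_repr -[y]bpi_repr -[z]bpi_repr -bpiD !bmul_pi.
by rewrite bmul_preDr bpiD.
Qed.

HB.instance Definition _ := GRing.Zmodule_isPzRing.Build Bcarrier
  bmulA bmul1l bmul1r bmulDl bmulDr.

Lemma bpiM f g : bpi f * bpi g = bpi (bmul_pre f g).
Proof. exact: bmul_pi. Qed.

(* Same as the degrees of the quotient module [gB]. *)
Definition Bdeg (m : int) (x : Bcarrier) : Prop := exists f, bpre_deg m f /\ x = bpi f.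

Fact B_grading : is_grading Bdeg.
Proof. exact: (gm_grading gB). Qed.

Lemma sdist_refl a : sdist a a = 0%N.
Proof. by apply: eq_card0 => i; rewrite inE eqxx. Qed.

Fact Bdeg1 : Bdeg 0 1.
Proof.
exists bone_pre; split => // -[a b]; rewrite ffunE /=; case: eqP => [->|_].
  by rewrite /pdist sdist_refl subr0; exact: mpoly_deg1.
exact: (grading0 GZ).
Qed.

Lemma sdist_tri a b c : (sdist a b + sdist b c = sdist a c + 2 * #|sset a b c|)%N.
Proof.
rewrite /sdist -!sum1_card !(big_mkcond (fun i => i \in _)) big_distrr -!big_split.
apply: eq_bigr => i _; rewrite !inE.
by case: (a i); case: (b i); case: (c i).
Qed.

Fact BdegM (i j : int) (x y : Bcarrier) : Bdeg i x -> Bdeg j y -> Bdeg (i + j) (x * y).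
Proof.
move=> [f [df ->]] [g [dg ->]]; exists (bmul_pre f g); split; last exact: bpiM.
move=> [a c]; rewrite ffunE /=; apply: (grading_sum GZ) => b _.
have H := mpoly_degM (mpoly_degM (df (a, b)) (dg (b, c)))
  (@umon_deg n (sset (val a) (val b) (val c))).
have E := sdist_tri (val a) (val b) (val c).
suff -> : i + j - pdist (a, c) = i - pdist (a, b) + (j - pdist (b, c)) +
  (2 * #|sset (val a) (val b) (val c)|)%:Z by exact: H.
move: E; rewrite /pdist /=; set t := #|_|; clearbody t; clear => E.
have {}E : (sdist (val a) (val b))%:Z + (sdist (val b) (val c))%:Z =
  (sdist (val a) (val c))%:Z + (2 * t)%:Z by rewrite -!PoszD E.
move: E; set u := (sdist (val a) (val b))%:Z; set v := (sdist (val b) (val c))%:Z.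
set w := (sdist (val a) (val c))%:Z; set z := (2 * t)%:Z => E.
apply/eqP; rewrite -subr_eq0.
have -> : i + j - w - (i - u + (j - v) + z) = (u + v) - (w + z) by ring.
by rewrite E subrr.
Qed.

Definition Btilde : grRing := @GrRing (Bcarrier : pzRingType) Bdeg B_grading Bdeg1 BdegM.

Definition fgen (a b : chamber) : Btilde :=
  bpi [ffun p => if p == (a, b) then 1 else 0].

Definition egen (a : chamber) : Btilde := fgen a a.

Lemma egen_deg (a : chamber) : gr_deg 0 (egen a).
Proof.
eexists; split; last reflexivity; move=> p; rewrite ffunE; case: eqP => [->|_].
  by rewrite /pdist sdist_refl subr0; exact: mpoly_deg1.
exact: (grading0 GZ).
Qed.

Definition Zu_scalar_pre (q : Zu) : bpre := q *: bone_pre.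
Definition Zu_scalar (q : Zu_gr n) : Btilde := bpi (Zu_scalar_pre q).

Fact Zu_scalar_add p q : Zu_scalar (p + q) = Zu_scalar p + Zu_scalar q.
Proof. by rewrite /Zu_scalar -bpiD /Zu_scalar_pre scalerDl. Qed.
Fact Zu_scalar_one : Zu_scalar 1 = 1.
Proof. by rewrite /Zu_scalar /Zu_scalar_pre scale1r. Qed.
Fact Zu_scalar_mul p q : Zu_scalar (p * q) = Zu_scalar p * Zu_scalar q.
Proof. by rewrite [RHS]bpiM /Zu_scalar_pre bmul_preZl bmul_pre1l scalerA. Qed.
Fact Zu_scalar_central q (x : Btilde) : Zu_scalar q * x = x * Zu_scalar q.
Proof.
rewrite -[x]bpi_repr [LHS]bpiM [RHS]bpiM /Zu_scalar_pre.
by rewrite bmul_preZl bmul_preZr bmul_pre1l bmul_pre1r.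
Qed.
Fact Zu_scalar_deg m q : gr_deg m q -> gr_deg m (Zu_scalar q).
Proof.
move=> dq; exists (Zu_scalar_pre q); split => //.
have [f [df _]] := Bdeg1; rewrite -[m]addr0; apply: bpre_gscale => // -[a b].
rewrite ffunE /=; case: eqP => [->|_]; last exact: (grading0 GZ).
by rewrite /pdist sdist_refl subr0; exact: mpoly_deg1.
Qed.

Definition Zu_to_Btilde : central_map (Zu_gr n) Btilde :=
  CentralMap Zu_scalar_add Zu_scalar_one Zu_scalar_mul Zu_scalar_central Zu_scalar_deg.

Section Standard.
Variable a : chamber.

Definition proj_pred (x : greg Btilde) : Prop := exists b : Btilde, x = b * egen a :> Btilde.

Fact proj0 : proj_pred 0. Proof. by exists 0; rewrite mul0r. Qed.
Fact proj_lin (b : Btilde) (x y : greg Btilde) :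
  proj_pred x -> proj_pred y -> proj_pred (b *: x + y).
Proof. by move=> [c ->] [d ->]; exists (b * c + d); rewrite mulrDl -mulrA. Qed.

Definition proj_sub : submodule (greg Btilde) := Submodule proj0 proj_lin.

Fact proj_hom (x : greg Btilde) h : proj_sub x -> hdecomp (@gm_deg _ (greg Btilde)) x h ->
  forall m, proj_sub (h m).
Proof.
move=> [b ->] /(hc_uniq (gm_grading (greg Btilde))) -> m.
exists (hc (gr_grading Btilde) b m).
by rewrite /= (hc_mulr _ _ (egen_deg a)) subr0.
Qed.

Definition projective_mod : grMod Btilde := gsub (HSubmodule proj_hom).

(* The sum of the [Btilde e_b Btilde e_a] over [b < a]; a triple [(x, b, y)] of
   the list stands for the product [x e_b y e_a]. *)
Definition lower_pred (x : projective_mod) : Prop :=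
  exists s : seq (Btilde * chamber * Btilde),
    all (fun t => chamber_lt t.1.2 a) s /\
    val x = \sum_(t <- s) t.1.1 * egen t.1.2 * t.2 * egen a.

Fact lower0 : lower_pred 0.
Proof. by exists [::]; split => //; rewrite big_nil. Qed.

Fact lower_lin (b : Btilde) (x y : projective_mod) :
  lower_pred x -> lower_pred y -> lower_pred (b *: x + y).
Proof.
move=> [s [sa xs]] [t [ta yt]].
exists ([seq (b * u.1.1, u.1.2, u.2) | u <- s] ++ t); split.
  by rewrite all_cat ta andbT all_map.
rewrite big_cat big_map -yt.
transitivity (b * (val x : Btilde) + (val y : Btilde)); first by [].
rewrite xs mulr_sumr; congr (_ + _).
by apply: eq_bigr => u _; rewrite !mulrA.
Qed.

Definition lower_sub : submodule projective_mod := Submodule lower0 lower_lin.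

Fact proj_intro (b : Btilde) : proj_sub (b * egen a : Btilde).
Proof. by exists b. Qed.

Fact lower_gens (x : projective_mod) : lower_sub x ->
  exists (T : eqType) (s : seq T) (F : T -> projective_mod) (d : T -> int),
     (forall t, t \in s -> lower_sub (F t) /\ gm_deg (d t) (F t)) /\
     x = \sum_(t <- s) F t.
Proof.
move=> [s [sa xs]]; pose G := gr_grading Btilde.
exists (Btilde * chamber * Btilde * (int * int))%type.
exists (flatten [seq [seq (t, p) | p <- allpairs pair (hsupp G t.1.1) (hsupp G t.2)] | t <- s]).
exists (fun u => smk (N := proj_sub)
   (proj_intro (hc G u.1.1.1 u.2.1 * egen u.1.1.2 * hc G u.1.2 u.2.2))).
exists (fun u => u.2.1 + u.2.2); split.
  move=> u /flattenP[_ /mapP[t ts ->] /mapP[p _ ->]] /=; split.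
    exists [:: (hc G t.1.1 p.1, t.1.2, hc G t.2 p.2)].
    by rewrite big_seq1 /= (allP sa _ ts).
  have H := gr_mul (gr_mul (gr_mul (hc_deg G p.1 t.1.1) (egen_deg t.1.2))
    (hc_deg G p.2 t.2)) (egen_deg a).
  by rewrite !addr0 in H.
apply: val_inj; rewrite xs smv_sum big_flatten big_map; apply: eq_bigr => t _.
rewrite big_map big_allpairs /= {1}[t.1.1](hsupp_sum G) !mulr_suml.
apply: eq_bigr => i _; rewrite {1}[t.2](hsupp_sum G) mulr_sumr mulr_suml.
by [].
Qed.

Definition lower : hsubmodule projective_mod := HSubmodule (gens_hom lower_gens).

Definition standard : grMod Btilde := gquot lower.

End Standard.

End Arrangement.

(* [Ext^i(V_a, V_b)], when nonzero, is generated in degree [d(a, b) - 2 i].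
   Indeed, in the linear projective resolution of [V_a] the relevant summand of
   homological degree [i] is [q^i Btilde e_c], where [c] is obtained from [a] by
   flipping [i] signs at which [a] and [b] differ, so that
   [d(c, b) = d(a, b) - i]; and [Hom(q^i Btilde e_c, V_b) = q^(-i) e_c V_b] is
   generated by [f_(c,b)], in degree [d(c, b) - i]. *)
Definition ext_shift (n : nat) (a b : signvec n) (i : nat) : int :=
  (sdist a b)%:Z - (2 * i)%:Z.

(* Main.v *)
Require Import Defs.
From HB Require Import structures.
From mathcomp Require Import all_boot all_order all_algebra.
From mathcomp Require Import boolp functions reals.
From mathcomp Require Import mpoly.
From mathcomp Require Import ring lra zify.

(** Write x_a for the basis at which xi is maximal on the chamber Delta a, and a^S for
    the sign vector obtained from a by flipping the signs in S. The proof computes Ext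
    with an explicit resolution of the standard module of a, which has one summand
    q^|S| B e_(a^S) for each set S disjoint from x_a, read as zero when a^S is not
    feasible; a^S is always bounded, because boundedness is decided by the signs in the
    basis. The differential is right multiplication by the elements f_(a^(S+j), a^S),
    with signs.

    Exactness ([res_exact_of_parts]) is checked on each row e_b B and on the monomials
    with a given support T. There, after multiplication by a suitable monomial, the
    complex becomes the signed complex of a family of sets S. If T contains an index
    off x_a, that index can be freely added to or removed from S, and the family is
    acyclic. Otherwise the sets S describe the complex formed by the walls of a face
    of Delta b which separate it from the optimal vertex of a. These are the walls
    visible from a point outside a polyhedron, and their union is contractible
    ([visible_acyclic]): the outside point moves towards the polyhedron and the walls
    that it meets are peeled off one by one. The only exceptions are the rows b in the
    feasible cone of x_a and the supports T inside x_a, where only S empty occurs; they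
    give the standard module. That the cokernel is the standard module as defined by
    the partial order ([lower_entries]) rests on the simplex method ([simplex_path]),
    which shows that crossing one wall away from the optimal vertex leads to a smaller
    chamber ([flip1_lt]). As a by-product, e_c times the standard module of b is
    Z[u_(x_b)] when c is in the feasible cone of x_b, and zero otherwise.

    Ext is independent of the resolution ([cohomology_iso]), so it is the cohomology of
    the complex with terms e_(a^S) times the standard module of b. The terms that
    survive are those for which a^S agrees with b off x_b. They exist if and only if
    the cones of the two bases intersect, and then S is the union of the fixed set N of
    indices outside both bases where a and b differ, and of an arbitrary subset of the
    set Y of indices in x_b and not in x_a. The component of the differential which
    adds j in Y is multiplication by u_j if a and b differ at j, and by 1 otherwise. So
    the complex is contractible if a and b agree somewhere on Y ([hom_exact]); else it
    is the Koszul complex of the variables u_j, j in Y, on Z[u_(x_b)], whose cohomology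
    is Z[u_(x_b)] / (u_j : j in Y) in degree |N| + |Y| ([top_iso]). Both vanishing
    statements are again proved one support at a time, by toggling an element of Y. *)

Set Implicit Arguments.
Unset Strict Implicit.
Unset Printing Implicit Defensive.

Import Order.TTheory GRing.Theory Num.Theory.

Local Open Scope ring_scope.

(** * Optimal vertices of the chambers *)

Section Vertices.
Variables (R : realType) (n k : nat) (V : polarized R n k).
Implicit Types (a b c : signvec n) (S Z : {set 'I_n}) (x y p v : 'rV[R]_n).

Lemma dotvDZ (w x y : 'rV[R]_n) (t : R) : dotv w (x + t *: y) = dotv w x + t * dotv w y.
Proof.
rewrite /dotv mulr_sumr -big_split; apply: eq_bigr => i _ /=.
by rewrite !mxE; ring.
Qed.

Lemma xiDZ x v t : xi V (x + t *: v) = xi V x + t * xi V v.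
Proof. exact: dotvDZ. Qed.

Lemma xi0 : xi V 0 = 0.
Proof. by rewrite /xi /dotv big1 // => i _; rewrite mxE mulr0. Qed.

Lemma xiZ v t : xi V (t *: v) = t * xi V v.
Proof. by rewrite -[t *: v]add0r xiDZ xi0 add0r. Qed.

Lemma xiN v : xi V (- v) = - xi V v.
Proof. by rewrite -scaleN1r xiZ mulN1r. Qed.

Lemma xiD x v : xi V (x + v) = xi V x + xi V v.
Proof. by rewrite -[v in LHS]scale1r xiDZ mul1r. Qed.

Lemma sgn_sqr a i : sgn R a i * sgn R a i = 1.
Proof. by rewrite /sgn; case: (a i); ring. Qed.

Lemma sgn_neq0 a i : sgn R a i != 0.
Proof. by rewrite /sgn; case: (a i); rewrite ?oppr_eq0 oner_eq0. Qed.

Lemma sgn_mul_eq0 a i (r : R) : (sgn R a i * r == 0) = (r == 0).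
Proof. by rewrite mulf_eq0 (negPf (sgn_neq0 a i)). Qed.

Lemma sgn_flip a b i (r : R) : a i != b i -> sgn R a i * r = - (sgn R b i * r).
Proof. by rewrite /sgn; case: (a i); case: (b i) => //= _; ring. Qed.

Lemma VetaD x v t : Veta V x -> v \in pa_V V -> Veta V (x + t *: v).
Proof.
by rewrite /Veta => xV vV; rewrite addrAC; apply: memvD => //; exact: memvZ.
Qed.

Lemma VetaB x y : Veta V x -> Veta V y -> x - y \in pa_V V.
Proof.
rewrite /Veta => xV yV; have := memvB xV yV.
by rewrite opprB addrA subrK.
Qed.

Definition zeros x : {set 'I_n} := [set i | x 0 i == 0].

Lemma zeros_le x : Veta V x -> (#|zeros x| <= k)%N.
Proof.
move=> xV; have := pa_eta_generic xV; rewrite addrC subrK.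
have := cardsC (zeros x); rewrite card_ord => E.
have -> : [set i | x 0 i != 0] = ~: zeros x by apply/setP => i; rewrite !inE.
move: E; set z := #|_|; set w := #|_|; clearbody z w; lia.
Qed.

Lemma Hset_zeros S p : Hset V S p -> S \subset zeros p.
Proof. by move=> [_ H]; apply/subsetP => i /H; rewrite inE => ->. Qed.

Lemma Hset_zerosE S p : #|S| = k -> Hset V S p -> zeros p = S.
Proof.
move=> Sk Hp; apply/esym/eqP; rewrite eqEcard Hset_zeros //= Sk.
by case: Hp => /zeros_le.
Qed.

(** Otherwise moving from the vertex p along v would produce a point of the affine
    space with more than k zero entries, against the genericity of eta. *)
Lemma vertex_free S p v : #|S| = k -> Hset V S p -> v \in pa_V V ->
  (forall i, i \in S -> v 0 i = 0) -> v = 0.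
Proof.
move=> Sk Hp vV vS; apply/rowP; apply: contrapT => nv.
suff [j vj] : exists j, v 0 j != 0.
  pose q := p + (- (p 0 j / v 0 j)) *: v.
  have qV : Veta V q by apply: VetaD => //; case: Hp.
  have jS : j \notin S by apply/negP => /vS /eqP; rewrite (negPf vj).
  have : (j |: S) \subset zeros q.
    apply/subsetP => i; rewrite !inE !mxE => /orP[/eqP ->|iS].
      by rewrite mulNr divfK // subrr.
    by rewrite (vS i iS) mulr0 addr0; case: Hp => _ /(_ _ iS) ->.
  by move=> /subset_leq_card; rewrite cardsU1 jS Sk => /leq_trans/(_ (zeros_le qV)); lia.
apply: contrapT => nj; apply: nv => i; rewrite mxE; apply/eqP/negPn/negP => vi.
by apply: nj; exists i.
Qed.

Definition coord_proj Z : 'M[R]_n := diag_mx (\row_i (i \in Z)%:R).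

Lemma coord_projE Z v i : (v *m coord_proj Z) 0 i = if i \in Z then v 0 i else 0.
Proof. by rewrite mul_mx_diag !mxE; case: (i \in Z); rewrite ?mulr1 ?mulr0. Qed.

(** The projection of V to the coordinates in Z is injective; when #|Z| = k the
    dimensions agree, so it is onto. *)
Lemma coord_interp Z :
  (forall v, v \in pa_V V -> (forall i, i \in Z -> v 0 i = 0) -> v = 0) ->
  (k <= #|Z|)%N /\ (#|Z| = k -> forall t : 'rV[R]_n,
     exists v, v \in pa_V V /\ forall i, i \in Z -> v 0 i = t 0 i).
Proof.
move=> inj.
pose f := linfun (mulmxr (coord_proj Z)) : 'Hom('rV[R]_n, 'rV[R]_n).
have fE v i : f v 0 i = if i \in Z then v 0 i else 0 by rewrite lfunE /= coord_projE.
pose W := (f @: fullv)%VS.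
have dimW : (\dim W <= #|Z|)%N.
  have sub : (W <= <<[seq delta_mx (0%R : 'I_1) i | i in Z]>>)%VS.
    apply/subvP => _ /memv_imgP[v _ ->].
    rewrite [f v]row_sum_delta; apply: memv_suml => i _; rewrite fE.
    case: ifP => iZ; last by rewrite scale0r mem0v.
    by apply: memvZ; apply: memv_span; apply: image_f.
  apply: leq_trans (dimvS sub) _; apply: leq_trans (dim_span _) _.
  by rewrite size_image.
have dimf : \dim (f @: pa_V V) = k.
  rewrite limg_dim_eq ?pa_dim //; apply/eqP; rewrite -subv0; apply/subvP => v.
  rewrite memv_cap memv_ker memv0 => /andP[vV /eqP fv]; apply/eqP/inj => // i iZ.
  by have := fE v i; rewrite iZ => <-; rewrite fv mxE.
have subW : (f @: pa_V V <= W)%VS by apply: limgS; exact: subvf.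
split; first by rewrite -dimf; apply: leq_trans (dimvS subW) dimW.
move=> Zk t.
have : f t \in (f @: pa_V V)%VS.
  have /eqP -> : (f @: pa_V V)%VS == W by rewrite eqEdim subW dimf -Zk.
  by rewrite memv_img ?memvf.
move=> /memv_imgP[v vV fv]; exists v; split => // i iZ.
by have := fE v i; rewrite iZ => <-; rewrite -fv fE iZ.
Qed.

Lemma basesP S : reflect (#|S| = k /\ exists p, Hset V S p) (S \in bases V).
Proof.
rewrite inE; apply: (iffP andP) => [[/eqP ? /asboolP]|[/eqP ? ?]] //.
by split => //; apply/asboolP.
Qed.

Lemma Hset_uniq S p q : S \in bases V -> Hset V S p -> Hset V S q -> p = q.
Proof.
move=> /basesP[Sk _] Hp Hq; apply/eqP; rewrite -subr_eq0; apply/eqP.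
apply: (vertex_free Sk Hp); first by apply: VetaB; [case: Hp|case: Hq].
by move=> i iS; rewrite !mxE Hp.2 // Hq.2 // subrr.
Qed.

(** By [vertex_free] the entries indexed by a basis are linear coordinates on V.
    If a coefficient c i of xi in these coordinates vanished, xi would have a lift
    with fewer than k nonzero entries. *)
Lemma basis_coord S : S \in bases V -> exists (v : 'I_n -> 'rV[R]_n) (c : 'I_n -> R),
  [/\ forall i, v i \in pa_V V,
      forall i j, j \in S -> v i 0 j = (j == i)%:R,
      forall x, x \in pa_V V -> xi V x = \sum_(i in S) x 0 i * c i &
      forall i, i \in S -> c i != 0 /\ xi V (v i) = c i].
Proof.
move=> /basesP[Sk [p Hp]].
have inj := fun v => @vertex_free S p v Sk Hp.
have [_ /(_ Sk) ex] := coord_interp inj.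
have /choice[v vP] : forall i, exists v, v \in pa_V V /\
    forall j, j \in S -> v 0 j = (delta_mx 0 i : 'rV[R]_n) 0 j by move=> i; exact: ex.
have vE i j : j \in S -> v i 0 j = (j == i)%:R.
  by move=> /((vP i).2) ->; rewrite mxE eqxx.
have xE x : x \in pa_V V -> x = \sum_(i in S) x 0 i *: v i.
  move=> xV; apply/eqP; rewrite -subr_eq0; apply/eqP/inj.
    by apply: memvB => //; apply: memv_suml => i _; apply: memvZ; case: (vP i).
  move=> j jS; rewrite !mxE summxE (bigD1 j) //= big1 ?addr0.
    by rewrite mxE vE // eqxx mulr1 subrr.
  by move=> i /andP[_ ij]; rewrite mxE vE // eq_sym (negPf ij) mulr0.
pose c i := xi V (v i).
have xiE x : x \in pa_V V -> xi V x = \sum_(i in S) x 0 i * c i.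
  move=> xV; rewrite {1}[x]xE // (big_morph (xi V) xiD xi0).
  by apply: eq_bigr => i _; rewrite xiZ.
exists v, c; split => //; first by move=> i; case: (vP i).
move=> i iS; split => //.
pose w : 'rV[R]_n := \row_j (if j \in S then c j else 0) - pa_xi V.
have wP u : u \in pa_V V -> dotv w u = 0.
  move=> uV.
  have -> : dotv w u = dotv (\row_j (if j \in S then c j else 0)) u - xi V u.
    rewrite /xi /dotv -sumrB; apply: eq_bigr => j _; rewrite !mxE; ring.
  rewrite xiE // /dotv [in X in _ - X]big_mkcond -sumrB big1 // => j _.
  by rewrite mxE; case: ifP => _; ring.
have := pa_xi_generic wP; rewrite addrC subrK => kle.
apply: contraTneq kle => ci0; rewrite -ltnNge -Sk (cardsD1 i S) iS add1n ltnS.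
apply: subset_leq_card; apply/subsetP => j; rewrite !inE mxE.
case: ifP => jS; last by rewrite eqxx.
by move=> cj; rewrite andbT; apply: contraNneq cj => ->; rewrite ci0.
Qed.

Lemma Delta_lt0 a p j : Delta V a p -> p 0 j != 0 -> 0 < sgn R a j * p 0 j.
Proof.
by move=> [_ /(_ j)]; rewrite le_eqVlt eq_sym sgn_mul_eq0 => /orP[->|].
Qed.

(** The ray leaves the chamber where the first of its decreasing coordinates
    vanishes, after a time t that is the smallest ratio of distance to speed. *)
Lemma ray_exit a x v : Delta V a x -> v \in pa_V V ->
  (exists i, sgn R a i * v 0 i < 0) ->
  (forall i, x 0 i = 0 -> 0 <= sgn R a i * v 0 i) ->
  exists t j, [/\ 0 < t, Delta V a (x + t *: v), sgn R a j * v 0 j < 0 &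
                 (x + t *: v) 0 j = 0].
Proof.
move=> [xV xa] vV [i0 i0P] vz.
pose r i := (sgn R a i * x 0 i) / - (sgn R a i * v 0 i).
pose j := [arg min_(i < i0 | sgn R a i * v 0 i < 0) r i]%O.
have [jP jmin] : sgn R a j * v 0 j < 0 /\
    forall i, sgn R a i * v 0 i < 0 -> r j <= r i.
  by rewrite /j; case: arg_minP.
have r0 i : sgn R a i * v 0 i < 0 -> 0 < r i.
  move=> iP; apply: divr_gt0; last by rewrite oppr_gt0.
  rewrite lt_neqAle xa andbT eq_sym sgn_mul_eq0; apply/eqP => /vz.
  by rewrite leNgt iP.
exists (r j), j; split => //; first exact: r0.
- split; first exact: VetaD.
  move=> i; rewrite !mxE mulrDr mulrCA.
  have [iP|iP] := ltP (sgn R a i * v 0 i) 0.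
    have := jmin i iP; rewrite {2}/r ler_pdivlMr ?oppr_gt0 //.
    by rewrite mulrN; lra.
  by apply: addr_ge0 => //; apply: mulr_ge0 => //; apply/ltW/r0.
- apply/eqP; rewrite -(sgn_mul_eq0 a j) !mxE mulrDr mulrCA.
  apply/eqP; rewrite {1}/r; have := jP; set s := sgn R a j * v 0 j => sP.
  by rewrite invrN mulrN mulNr divfK ?lt_eqF // subrr.
Qed.

Lemma ray_small a x v : Delta V a x -> v \in pa_V V ->
  (forall i, x 0 i = 0 -> 0 <= sgn R a i * v 0 i) ->
  exists t, 0 < t /\ Delta V a (x + t *: v).
Proof.
move=> xD vV vz.
have [ex|nex] := pselect (exists i, sgn R a i * v 0 i < 0).
  by have [t [j []]] := ray_exit xD vV ex vz; exists t.
exists 1; split => //; case: xD => xV xa; split; first exact: VetaD.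
move=> i; rewrite !mxE mul1r mulrDr addr_ge0 // leNgt.
by apply/negP => ?; apply: nex; exists i.
Qed.

(** Otherwise xi would be unbounded above along the ray spanned by v. *)
Lemma bounded_ray a v : a \in bounded_signs V -> Sigma V a v -> xi V v <= 0.
Proof.
rewrite inE => /asboolP[M MP] vS; rewrite leNgt; apply/negP => xv.
have M0 : 0 <= M.
  by have := MP 0; rewrite xi0; apply; split => [|i]; rewrite ?mem0v // mxE mulr0.
have := MP (((M + 1) / xi V v) *: v); rewrite xiZ divfK ?gt_eqF // => H.
have : M + 1 <= M; last lra.
apply: H; case: vS => vV vi; split; first exact: memvZ.
by move=> i; rewrite mxE mulrCA mulr_ge0 // divr_ge0 // ltW //; lra.
Qed.

Section Optimum.
Variables (S : {set 'I_n}) (v : 'I_n -> 'rV[R]_n) (c : 'I_n -> R) (p : 'rV[R]_n).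
Hypothesis SB : S \in bases V.
Hypothesis vV : forall i, v i \in pa_V V.
Hypothesis vE : forall i j, j \in S -> v i 0 j = (j == i)%:R.
Hypothesis xiE : forall x, x \in pa_V V -> xi V x = \sum_(i in S) x 0 i * c i.
Hypothesis cP : forall i, i \in S -> c i != 0 /\ xi V (v i) = c i.
Hypothesis Hp : Hset V S p.

Let Sk : #|S| = k. Proof. by have /basesP[] := SB. Qed.

Lemma vertex_neq0 j : j \notin S -> p 0 j != 0.
Proof. by rewrite -(Hset_zerosE Sk Hp) inE. Qed.

Lemma vertex_zeroP j : p 0 j = 0 -> j \in S.
Proof. by move=> pj; rewrite -(Hset_zerosE Sk Hp) inE pj. Qed.

Lemma edge_dir a i : i \in S -> forall j, p 0 j = 0 ->
  0 <= sgn R a j * (sgn R a i *: v i) 0 j.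
Proof.
move=> iS j /vertex_zeroP jS; rewrite mxE vE //; case: eqVneq => [->|_].
  by rewrite mulr1 sgn_sqr.
by rewrite !mulr0.
Qed.

(** A short segment of the edge of direction v i at p lies in Delta a, so xi does
    not increase along it. *)
Lemma max_at_signs a i : Delta V a p -> (forall x, Delta V a x -> xi V x <= xi V p) ->
  i \in S -> sgn R a i * c i < 0.
Proof.
move=> pD pmax iS.
have [t [t0 tD]] := ray_small pD (memvZ (sgn R a i) (vV i)) (edge_dir a iS).
have := pmax _ tD; rewrite xiDZ xiZ (cP iS).2 => le0.
rewrite lt_neqAle sgn_mul_eq0 (cP iS).1 /=.
have := le0; set s := _ * c i => le; rewrite -(pmulr_rle0 s t0); lra.
Qed.

Lemma signs_xi_le a x : (forall i, i \in S -> sgn R a i * c i < 0) ->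
  x \in pa_V V -> (forall i, i \in S -> 0 <= sgn R a i * x 0 i) -> xi V x <= 0.
Proof.
move=> ac xV xa; rewrite xiE //; apply: sumr_le0 => i iS.
have := ac i iS; have := xa i iS; rewrite /sgn; case: (a i); nra.
Qed.

Lemma signs_max a : Delta V a p -> (forall i, i \in S -> sgn R a i * c i < 0) ->
  max_at V a S.
Proof.
move=> pD ac; exists p; split => // x [xV xa].
have -> : x = p + (x - p) by rewrite addrC subrK.
rewrite xiD gerDl; apply: (signs_xi_le ac).
  by apply: VetaB => //; case: Hp.
by move=> i iS; rewrite !mxE (Hp.2 i iS) subr0.
Qed.

Lemma signs_bounded a : (forall i, i \in S -> sgn R a i * c i < 0) ->
  a \in bounded_signs V.
Proof.
move=> ac; rewrite inE; apply/asboolP; exists 0 => x [xV xa].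
by apply: (signs_xi_le ac) => // i _.
Qed.

(** The signs forced by optimality at the vertex p: off the basis those of p itself,
    on the basis those opposite to the coefficients of xi. *)
Definition opt_sign : signvec n := [ffun i => if i \in S then c i < 0 else 0 < p 0 i].

Lemma opt_signS i : i \in S -> sgn R opt_sign i * c i < 0.
Proof.
move=> iS; rewrite /sgn ffunE iS; have [+ _] := cP iS.
by case: (ltgtP (c i) 0) => // h _; lra.
Qed.

Lemma opt_Delta : Delta V opt_sign p.
Proof.
split; first by case: Hp.
move=> i; rewrite /sgn ffunE; have [iS|iS] := boolP (i \in S); first by rewrite (Hp.2 i iS) mulr0.
by have := vertex_neq0 iS; case: (ltgtP (p 0 i) 0) => // h _; lra.
Qed.

Lemma opt_Pset : opt_sign \in Pset V.
Proof.
rewrite inE (signs_bounded opt_signS) andbT inE; apply/asboolP.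
by exists p; exact: opt_Delta.
Qed.

Lemma opt_uniq a : Delta V a p -> (forall x, Delta V a x -> xi V x <= xi V p) ->
  a = opt_sign.
Proof.
move=> pD pmax; apply/ffunP => i; have [iS|iS] := boolP (i \in S).
  have := max_at_signs pD pmax iS; rewrite ffunE iS /sgn.
  by have [+ _] := cP iS; case: (a i); case: (ltgtP (c i) 0) => // h _; lra.
have p0 := vertex_neq0 iS.
have := Delta_lt0 pD p0; rewrite ffunE (negPf iS) /sgn.
by case: (a i); case: (ltgtP (p 0 i) 0) p0 => // h _; lra.
Qed.

End Optimum.

(** The signs [opt_sign] rule out the default value in the definition of [mu], so that
    [mu V S = a] does express optimality. *)
Lemma mu_max S : S \in bases V -> mu V S \in Pset V /\ max_at V (mu V S) S.
Proof.
move=> SB; have /basesP[Sk [p Hp]] := SB.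
have [v [c [vV vE xiE cP]]] := basis_coord SB.
rewrite /mu; case: pickP => [a /andP[aP /asboolP] //|].
move=> /(_ (opt_sign S c p)); rewrite (opt_Pset SB xiE cP Hp) /=.
move=> /negbT/asboolPn[]; apply: (signs_max (c := c) (p := p)) => //.
  exact: (opt_Delta c SB Hp).
by move=> i iS; exact: (opt_signS p cP).
Qed.

Lemma mu_uniq a S : S \in bases V -> max_at V a S -> mu V S = a.
Proof.
move=> SB [p [Hp pD pmax]]; have [_ [q [Hq qD qmax]]] := mu_max SB.
have [v [c [vV vE xiE cP]]] := basis_coord SB.
have pq := Hset_uniq SB Hp Hq; subst q.
rewrite (opt_uniq SB vV vE cP Hp pD pmax).
exact: (opt_uniq SB vV vE cP Hp qD qmax).
Qed.

(** A point that is not a vertex can be moved along a direction v of V vanishing on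
    its zero entries, chosen so that xi does not decrease; the motion hits a new
    wall because xi is bounded on the recession cone. *)
Lemma improve_vertex a x : a \in bounded_signs V -> Delta V a x ->
  exists q, [/\ Delta V a q, zeros q \in bases V & xi V x <= xi V q].
Proof.
move=> aB; have [m] := ubnP (#|~: zeros x|); elim: m x => // m IH x xm xD.
have [inj|] := pselect (forall v, v \in pa_V V ->
    (forall i, i \in zeros x -> v 0 i = 0) -> v = 0).
  exists x; split => //; apply/basesP; split.
    apply/eqP; rewrite eqn_leq zeros_le ?(coord_interp inj).1 //.
    by case: xD.
  by exists x; split=> [|i]; [case: xD|rewrite inE => /eqP].
move=> /existsNP[v /not_implyP[vV /not_implyP[vz v0]]].
wlog [xiv vex] : v vV vz v0 / 0 <= xi V v /\ exists i, sgn R a i * v 0 i < 0.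
  move=> W.
  have H u : u \in pa_V V -> 0 < xi V u -> exists i, sgn R a i * u 0 i < 0.
    move=> uV up; apply: contrapT => nex; have := up.
    rewrite ltNge (@bounded_ray a) //; split => // i.
    by rewrite leNgt; apply/negP => ?; apply: nex; exists i.
  have NV : - v \in pa_V V by rewrite memvN.
  have Nz i : i \in zeros x -> (- v) 0 i = 0 by move=> /vz; rewrite mxE => ->; rewrite oppr0.
  have N0 : - v <> 0 by move=> /eqP; rewrite oppr_eq0 => /eqP.
  have [xv|xv|xv] := ltgtP 0 (xi V v).
  - by apply: (W v) => //; split; [exact: ltW|exact: H].
  - have Nx : 0 < xi V (- v) by rewrite xiN oppr_gt0.
    by apply: (W (- v)) => //; split; [exact: ltW|exact: H].
  - have [i vi] : exists i, v 0 i != 0.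
      apply: contrapT => nex; apply: v0; apply/rowP => i; rewrite mxE.
      by apply/eqP/negP => ?; apply: nex; exists i; exact/negP.
    have [s|s|/eqP] := ltgtP (sgn R a i * v 0 i) 0.
    + by apply: (W v) => //; split; [rewrite -xv|exists i].
    + apply: (W (- v)) => //; split; first by rewrite xiN -xv oppr0.
      by exists i; rewrite mxE mulrN oppr_lt0.
    + by rewrite sgn_mul_eq0 (negPf vi).
have vz' i : x 0 i = 0 -> 0 <= sgn R a i * v 0 i.
  by move=> xi0; rewrite vz ?mulr0 // inE xi0.
have [t [j [t0 yD jP yj]]] := ray_exit xD vV vex vz'.
have [|q [qD qB le]] := IH (x + t *: v) _ yD.
  apply: leq_trans (_ : #|~: zeros x| <= m)%N; last by rewrite -ltnS.
  apply: proper_card; rewrite properC; apply/properP; split.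
    apply/subsetP => i iz; move: (iz); rewrite !inE !mxE vz // mulr0 addr0.
    by rewrite eq_sym eq_sym.
  exists j; first by rewrite inE yj.
  by apply/negP => /vz vj; rewrite vj mulr0 ltxx in jP.
exists q; split => //; apply: le_trans le.
by rewrite xiDZ lerDl mulr_ge0 // ltW.
Qed.

(** The value 0 is a dummy for sets S without a vertex. *)
Definition vertex_val S : R :=
  if pselect (exists p, Hset V S p) is left e then xi V (projT1 (cid e)) else 0.

Lemma vertex_valE S p : S \in bases V -> Hset V S p -> vertex_val S = xi V p.
Proof.
move=> SB Hp; rewrite /vertex_val; case: pselect => [e|[]]; last by exists p.
by case: cid => q /= Hq; rewrite (Hset_uniq SB Hp Hq).
Qed.

(** The best of the finitely many vertices of Delta a is optimal among all points by
    [improve_vertex]. *)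
Lemma optimum a : a \in Pset V -> exists S, S \in bases V /\ max_at V a S.
Proof.
rewrite inE => /andP[+ aB]; rewrite inE => /asboolP[x0 x0D].
pose ok S := (S \in bases V) && `[< exists p, Hset V S p /\ Delta V a p >].
have okq q : Delta V a q -> zeros q \in bases V -> ok (zeros q) /\ Hset V (zeros q) q.
  move=> qD qB; have Hq : Hset V (zeros q) q.
    by split=> [|i]; [case: qD|rewrite inE => /eqP].
  by split => //; rewrite /ok qB; apply/asboolP; exists q.
have [q0 [q0D q0B _]] := improve_vertex aB x0D; have [ok0 _] := okq _ q0D q0B.
pose S := [arg max_(S > zeros q0 | ok S) vertex_val S]%O.
have [Sok Smax] : ok S /\ forall S', ok S' -> vertex_val S' <= vertex_val S by rewrite /S; case: arg_maxP.
have /andP[SB /asboolP[p [Hp pD]]] := Sok.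
exists S; split => //; exists p; split => // x xD.
have [q [qD qB le]] := improve_vertex aB xD; apply: le_trans le _.
have [okz Hq] := okq _ qD qB.
by rewrite -(vertex_valE qB Hq) -(vertex_valE SB Hp); exact: Smax.
Qed.

Lemma bas_ofP a : a \in Pset V -> bas_of V a \in bases V /\ mu V (bas_of V a) = a.
Proof.
move=> aP; rewrite /bas_of; case: pickP => [S /andP[SB /eqP] //|].
by have [S [SB /(mu_uniq SB) Sa]] := optimum aP; move=> /(_ S); rewrite SB Sa eqxx.
Qed.

Lemma chamber_vertex a : a \in Pset V -> exists p,
  [/\ Hset V (bas_of V a) p, Delta V a p, forall x, Delta V a x -> xi V x <= xi V p &
     forall i, i \notin bas_of V a -> 0 < sgn R a i * p 0 i].
Proof.
move=> aP; have [SB aE] := bas_ofP aP.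
have [_ [p [Hp pD pmax]]] := mu_max SB; rewrite aE in pD pmax.
exists p; split => // i iS; apply: Delta_lt0 => //.
have /basesP[Sk _] := SB.
by rewrite -(Hset_zerosE Sk Hp) inE in iS.
Qed.

(** xi does not increase along the directions leaving the optimal vertex, and the
    inequalities defining these directions only involve the signs in the basis. *)
Lemma bounded_of_basis a b : a \in Pset V ->
  (forall i, i \in bas_of V a -> b i = a i) -> b \in bounded_signs V.
Proof.
move=> aP ba; have [SB aE] := bas_ofP aP.
have [p [Hp pD pmax _]] := chamber_vertex aP.
have [v [c [vV vE xiE cP]]] := basis_coord SB.
apply: (signs_bounded (S := bas_of V a) (c := c)) => // i iS.
by have := max_at_signs SB vV vE cP Hp pD pmax iS; rewrite /sgn ba.
Qed.

Lemma bas_step_val S S' : bas_step V S S' -> vertex_val S < vertex_val S'.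
Proof.
move=> /and4P[SB SB' _ /asboolP[p [q [Hp Hq lt]]]].
by rewrite (vertex_valE SB Hp) (vertex_valE SB' Hq).
Qed.

Lemma bas_le_val S S' : bas_le V S S' -> S = S' \/ vertex_val S < vertex_val S'.
Proof.
move=> /connectP[s]; elim: s S => [|T s IH] S /=; first by move=> _ ->; left.
move=> /andP[/bas_step_val lt Ts] lastE; right.
by have [<- //|] := IH T Ts lastE; exact: lt_trans.
Qed.

(** The inequalities off the basis are not active at the optimal vertex, so it remains
    optimal, and the only optimum, when they are dropped. *)
Lemma basis_cone_max a p y : a \in Pset V -> Hset V (bas_of V a) p -> Veta V y ->
  (forall i, i \in bas_of V a -> 0 <= sgn R a i * y 0 i) ->
  xi V y <= xi V p /\ (xi V y = xi V p -> y = p).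
Proof.
move=> aP Hp yV ya; have [SB aE] := bas_ofP aP.
have [q [Hq qD qmax _]] := chamber_vertex aP.
have pq := Hset_uniq SB Hp Hq; subst q.
have [v [c [vV vE xiE cP]]] := basis_coord SB.
have ac := max_at_signs SB vV vE cP Hp qD qmax.
have dV : y - p \in pa_V V by apply: VetaB => //; case: Hp.
have term j : j \in bas_of V a -> (y - p) 0 j * c j <= 0.
  move=> jS; have := ac j jS; have := ya j jS; rewrite !mxE (Hp.2 j jS).
  by rewrite /sgn subr0; case: (a j); nra.
have dE : xi V (y - p) = xi V y - xi V p by rewrite xiD xiN.
have le : xi V (y - p) <= 0 by rewrite xiE //; apply: sumr_le0.
split; first by rewrite -subr_le0 -dE.
move=> yp; apply/eqP; rewrite -subr_eq0; apply/eqP.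
have /basesP[Sk _] := SB; apply: (vertex_free Sk Hp) => // i iS.
have := xiE _ dV; rewrite dE yp subrr (bigD1 i) //= => sum0.
have : \sum_(j in bas_of V a | j != i) (y - p) 0 j * c j <= 0.
  by apply: sumr_le0 => j /andP[jS _]; exact: term.
move=> le0; have ti := term i iS.
have /eqP : (y - p) 0 i * c i = 0 by lra.
by rewrite mulf_eq0 (negPf (cP i iS).1) orbF => /eqP.
Qed.

(** The simplex method: at a vertex of Delta a that is not optimal some edge increases
    xi; it ends, by boundedness, at an adjacent vertex with a larger value of xi, and
    the two bases are related by a step of the order. *)
Lemma simplex_path a S q : a \in Pset V -> S \in bases V -> Hset V S q ->
  Delta V a q -> bas_le V S (bas_of V a).
Proof.
move=> aP.
have [m] := ubnP #|[set T in bases V | vertex_val S < vertex_val T]|.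
elim: m S q => // m IH S q Sm SB Hq qD.
have [aB muE] := bas_ofP aP.
have [p [Hp pD pmax _]] := chamber_vertex aP.
have /basesP[Sk _] := SB; have /basesP[ak _] := aB.
have [v [c [vV vE xiE cP]]] := basis_coord SB.
have [opt|] := pselect (forall i, i \in S -> sgn R a i * c i < 0).
  have [le eq] : xi V q <= xi V p /\ (xi V q = xi V p -> q = p).
    by apply: (basis_cone_max aP Hp) => [|i _]; case: qD.
  have dV : p - q \in pa_V V by apply: VetaB; [case: Hp|case: Hq].
  have ge : xi V p <= xi V q.
    rewrite -subr_le0 -xiN -xiD; apply: (signs_xi_le xiE opt dV) => i iS.
    by rewrite !mxE (Hq.2 i iS) subr0; exact: pD.2.
  have pq : p = q by apply/esym/eq/eqP; rewrite eq_le le ge.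
  suff -> : S = bas_of V a by exact: connect0.
  by rewrite -(Hset_zerosE Sk Hq) -pq; apply: Hset_zerosE.
move=> /existsNP[i /not_implyP[iS /negP]]; rewrite -leNgt => ci.
pose u := sgn R a i *: v i.
have uV : u \in pa_V V by exact: memvZ.
have xu : 0 < xi V u.
  by rewrite xiZ (cP i iS).2 lt_neqAle ci andbT eq_sym sgn_mul_eq0; have [] := cP i iS.
have uE j : q 0 j = 0 -> 0 <= sgn R a j * u 0 j.
  exact: (edge_dir SB vE Hq).
have ex : exists j, sgn R a j * u 0 j < 0.
  apply: contrapT => nex; have := xu; rewrite ltNge.
  rewrite (@bounded_ray a) //; first by move: aP; rewrite inE => /andP[].
  by split => // j; rewrite leNgt; apply/negP => ?; apply: nex; exists j.
have [t [j [t0 q'D juP q'j]]] := ray_exit qD uV ex uE.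
set q' := q + t *: u in q'D q'j.
have jS : j \notin S.
  by apply/negP => jS; move: juP; rewrite ltNge uE // Hq.2.
pose T := j |: (S :\ i).
have Tk : #|T| = k.
  rewrite /T cardsU1 !inE (negPf jS) andbF /= -Sk (cardsD1 i S) iS.
  by [].
have HT : Hset V T q'.
  split; first by case: q'D.
  move=> l; rewrite !inE => /orP[/eqP -> //|/andP[li lS]].
  by rewrite !mxE (Hq.2 l lS) vE // (negPf li) !mulr0 addr0.
have TB : T \in bases V by apply/basesP; split => //; exists q'.
have lt : xi V q < xi V q' by rewrite xiDZ ltrDl mulr_gt0.
have step : bas_step V S T.
  rewrite /bas_step SB TB /=; apply/andP; split; last by apply/asboolP; exists q, q'.
  have -> : S :&: T = S :\ i.
    apply/setP => l; rewrite !inE; case: (eqVneq l j) => [->|lj] /=.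
      by rewrite (negPf jS) andbF.
    by case: (l \in S); rewrite ?andbF ?andbT.
  by rewrite -Sk (cardsD1 i S) iS.
apply: connect_trans (connect1 step) _; apply: (IH T q') => //.
rewrite -ltnS; apply: leq_trans Sm; rewrite ltnS; apply: proper_card.
apply/properP; split.
  apply/subsetP => W; rewrite !inE => /andP[-> /=].
  by apply: lt_trans; exact: bas_step_val step.
by exists T; rewrite inE ?ltxx ?andbF // TB bas_step_val.
Qed.

(** The maximum of xi over Delta c is at least xi p, whereas xi increases along the
    order. *)
Lemma chamber_lt_vertex (a c : chamber V) p : Hset V (bas_of V (val a)) p ->
  Delta V (val c) p -> ~~ chamber_lt c a.
Proof.
move=> Hp pD; have [aB aE] := bas_ofP (valP a); have [cB cE] := bas_ofP (valP c).
apply/negP => /andP[ca /bas_le_val[E|]].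
  by case/eqP: ca; apply: val_inj; rewrite -aE -cE E.
have [q [Hq qD qmax _]] := chamber_vertex (valP c).
by rewrite (vertex_valE cB Hq) (vertex_valE aB Hp) ltNge qmax.
Qed.

End Vertices.

(** * Acyclic families of subsets *)

Section Signed.
Variable M : zmodType.

Definition signed (b : bool) (x : M) : M := if b then - x else x.

Lemma signedK b : involutive (signed b).
Proof. by case: b => x //=; rewrite /signed opprK. Qed.
Lemma signed0 b : signed b 0 = 0.
Proof. by case: b; rewrite /signed ?oppr0. Qed.
Lemma signedD b x y : signed b (x + y) = signed b x + signed b y.
Proof. by case: b; rewrite /signed ?opprD. Qed.
Lemma signedB b x y : signed b (x - y) = signed b x - signed b y.
Proof. by case: b; rewrite /signed ?opprD. Qed.
Lemma signed_signed b c x : signed b (signed c x) = signed (b (+) c) x.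
Proof. by case: b; case: c; rewrite /signed ?opprK. Qed.
Lemma signed_neg b x : signed (~~ b) x = - signed b x.
Proof. by case: b; rewrite /signed ?opprK. Qed.
Lemma signed_sum b (I : Type) (s : seq I) (P : pred I) (F : I -> M) :
  signed b (\sum_(i <- s | P i) F i) = \sum_(i <- s | P i) signed b (F i).
Proof. by apply: (big_morph (signed b)) => [x y|]; rewrite ?signedD ?signed0. Qed.
End Signed.

Lemma signed_morph (M N : zmodType) (f : M -> N) b x :
  (forall x y, f (x - y) = f x - f y) -> f (signed b x) = signed b (f x).
Proof.
move=> fB; have f0 : f 0 = 0 by rewrite -{1}(subrr 0) fB subrr.
by case: b; rewrite /signed // -[- x]sub0r fB f0 sub0r.
Qed.

(** The terms with i < j cancel those with j < i; this avoids dividing by two. *)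
Lemma sum_alternating (n : nat) (M : zmodType) (G : 'I_n -> 'I_n -> M) :
  (forall i, G i i = 0) -> (forall i j, G j i = - G i j) ->
  \sum_i \sum_j G i j = 0.
Proof.
move=> G0 GN.
have E : \sum_i \sum_j G i j =
    \sum_(i < n) \sum_(j < n | (i < j)%N) G i j +
    \sum_(i < n) \sum_(j < n | (j < i)%N) G i j.
  rewrite -big_split; apply: eq_bigr => i _ /=.
  rewrite (bigD1 i) //= G0 add0r (bigID (fun j : 'I_n => (i < j)%N)) /=.
  congr (_ + _); apply: eq_bigl => j; rewrite -(inj_eq val_inj) /=.
    by case: ltngtP.
  by case: ltngtP.
rewrite E [X in _ + X](exchange_big_dep xpredT) //= -big_split big1 // => i _ /=.
rewrite -big_split big1 // => j _ /=; by rewrite GN addNr.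
Qed.

(** A chain is a function on a family of subsets of [1..n], and the differential is the
    simplicial one: its value at S is a signed sum over the sets with one more element.
    The sign rule is left abstract, because the complex of homomorphisms is read through
    complements, which changes the signs. *)
Section Cube.
Variables (n : nat) (M : zmodType).
Variable eps : 'I_n -> {set 'I_n} -> bool.

Definition sign_rule := forall i j (S : {set 'I_n}), i \notin S -> j \notin S -> i != j ->
  eps i S (+) eps j (i |: S) = ~~ (eps j S (+) eps i (j |: S)).

Hypothesis epsP : sign_rule.

Implicit Types (f g : {set 'I_n} -> M) (S T U : {set 'I_n}) (G : {set {set 'I_n}}).

Definition bd f S : M := \sum_(j | j \notin S) signed (eps j S) (f (j |: S)).

Lemma bd_ext f g S : (forall j, j \notin S -> f (j |: S) = g (j |: S)) -> bd f S = bd g S.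
Proof. by move=> fg; apply: eq_bigr => j jS; rewrite fg. Qed.

Lemma bdB f g S : bd (fun T => f T - g T) S = bd f S - bd g S.
Proof. by rewrite /bd -sumrB; apply: eq_bigr => j _; rewrite signedB. Qed.

Lemma bd_eq0 f S : (forall j, j \notin S -> f (j |: S) = 0) -> bd f S = 0.
Proof. by move=> f0; rewrite /bd big1 // => j jS; rewrite f0 ?signed0. Qed.

Lemma bd_bd f S : bd (bd f) S = 0.
Proof.
pose F i j := if (i \notin S) && (j \notin S) && (i != j) then
  signed (eps i S (+) eps j (i |: S)) (f (j |: (i |: S))) else 0.
rewrite -[RHS](@sum_alternating n M F).
- rewrite /bd big_mkcond; apply: eq_bigr => i _ /=.
  case: ifP => iS; last by rewrite big1 // => j _; rewrite /F iS.
  rewrite signed_sum big_mkcond; apply: eq_bigr => j _.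
  rewrite signed_signed /F iS /= !inE negb_or [j == i]eq_sym andbC.
  by [].
- by move=> i; rewrite /F eqxx andbF.
- move=> i j; rewrite /F [j == i]eq_sym [(j \notin S) && _]andbC.
  case: ifP; rewrite ?oppr0 // => /andP[/andP[iS jS] ij].
  by rewrite (epsP iS jS ij) signed_neg opprK setUCA.
Qed.

Definition supported G f := forall S, S \notin G -> f S = 0.

Definition acyclic G := forall f, supported G f -> (forall S, S \in G -> bd f S = 0) ->
  exists g, supported G g /\ forall S, S \in G -> bd g S = f S.

(** Convexity makes the restriction of [bd] to the family a differential, as
    [bd_bdG] shows. *)
Definition set_convex G := forall S T U, S \in G -> U \in G -> S \subset T ->
  T \subset U -> T \in G.

Lemma bd_bdG G f S : set_convex G -> supported G f -> S \in G ->
  bd (fun T => if T \in G then bd f T else 0) S = 0.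
Proof.
move=> Gc fG SG; rewrite -[RHS](bd_bd f S); apply: bd_ext => j jS.
case: ifPn => // jG; apply/esym/bd_eq0 => l lS.
apply: fG; apply: contra jG => lG; apply: (Gc S _ (l |: (j |: S))) => //.
  exact: subsetUr.
exact: subsetUr.
Qed.

Lemma acyclic0 : acyclic set0.
Proof.
by move=> f _ _; exists (fun=> 0); split => // S; rewrite inE.
Qed.

(** The chains supported on the sets avoiding j form a subcomplex, and the quotient by
    it consists of the chains on the sets containing j. *)
Lemma acyclic_split j G : set_convex G -> acyclic [set S in G | j \in S] ->
  acyclic [set S in G | j \notin S] -> acyclic G.
Proof.
move=> Gc ac1 ac0 f fG df.
pose f1 S := if j \in S then f S else 0.
have f1S : supported [set S in G | j \in S] f1.
  by move=> S; rewrite inE /f1; case: ifP => //; rewrite andbT => _ /fG.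
have [|g1 [g1S dg1]] := ac1 f1 f1S.
  move=> S; rewrite inE => /andP[SG jS]; rewrite -[RHS](df S SG).
  by apply: bd_ext => i _; rewrite /f1 !inE jS orbT.
have g1G : supported G g1.
  by move=> S SG; apply: g1S; rewrite inE (negPf SG).
pose f0 S := f S - (if S \in G then bd g1 S else 0).
have f0S : supported [set S in G | j \notin S] f0.
  move=> S; rewrite inE negb_and /f0; case: ifP => SG /=.
    by rewrite negbK => jS; rewrite dg1 ?inE ?SG // /f1 jS subrr.
  by rewrite fG ?SG // subr0.
have [|g0 [g0S dg0]] := ac0 f0 f0S.
  by move=> S; rewrite inE => /andP[SG jS]; rewrite /f0 bdB df // bd_bdG // subr0.
exists (fun S => g1 S + g0 S); split.
  by move=> S SG; rewrite g1G // g0S ?addr0 // inE (negPf SG).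
move=> S SG.
have -> : bd (fun S => g1 S + g0 S) S = bd g1 S + bd g0 S.
  by rewrite /bd -big_split; apply: eq_bigr => i _; rewrite signedD.
have [jS|jS] := boolP (j \in S).
  rewrite dg1 ?inE ?SG // /f1 jS [bd g0 S]bd_eq0 ?addr0 // => i _.
  by rewrite g0S // !inE jS orbT andbF.
by rewrite dg0 ?inE ?SG // /f0 SG addrC subrK.
Qed.

(** Up to sign, transporting the value at S to j |: S is a contracting homotopy. *)
Lemma acyclic_toggle j G : set_convex G ->
  (forall S, j \notin S -> (S \in G) = (j |: S \in G)) -> acyclic G.
Proof.
move=> Gc Gj f fG df.
pose g S := if j \in S then signed (eps j (S :\ j)) (f (S :\ j)) else 0.
have gS : supported G g.
  move=> S SG; rewrite /g; case: ifP => // jS.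
  by rewrite fG ?signed0 // (Gj (S :\ j)) ?setD1K // !inE eqxx.
have dg0 S : j \notin S -> bd g S = f S.
  move=> jS; rewrite /bd (bigD1 j) //= big1 ?addr0.
    rewrite /g !inE eqxx /= setU1K //; exact: signedK.
  move=> i /andP[iS ij]; rewrite /g !inE (negPf jS) orbF eq_sym (negPf ij).
  by rewrite signed0.
exists g; split => // S SG; have [jS|/dg0 //] := boolP (j \in S).
pose h T := f T - (if T \in G then bd g T else 0).
have jSD : j \notin S :\ j by rewrite !inE eqxx.
have DG : S :\ j \in G by rewrite Gj // setD1K.
have dh : bd h (S :\ j) = 0 by rewrite /h bdB df // bd_bdG // subr0.
apply/eqP; rewrite eq_sym -subr_eq0; apply/eqP.
have : bd h (S :\ j) = signed (eps j (S :\ j)) (h S).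
  rewrite /bd (bigD1 j) //= setD1K // big1 ?addr0 // => i /andP[iS ij].
  rewrite /h; case: ifP => iG; last by rewrite fG ?iG // subr0 signed0.
  by rewrite dg0 ?subrr ?signed0 // !inE eqxx orbF eq_sym.
rewrite dh => /(congr1 (signed (eps j (S :\ j)))); rewrite signedK signed0.
by rewrite /h SG.
Qed.

End Cube.

Definition std_sign (n : nat) (j : 'I_n) (S : {set 'I_n}) : bool :=
  odd #|[set i in S | (i < j)%N]|.

Lemma std_signU (n : nat) (i j : 'I_n) (S : {set 'I_n}) : i \notin S ->
  std_sign j (i |: S) = (i < j)%N (+) std_sign j S.
Proof.
move=> iS; rewrite /std_sign; case: (ltnP i j) => ij.
  have -> : [set l in i |: S | (l < j)%N] = i |: [set l in S | (l < j)%N].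
    by apply/setP => l; rewrite !inE; case: eqVneq => // ->; rewrite ij.
  by rewrite cardsU1 inE (negPf iS) /= oddD.
congr (odd _); apply: eq_card => l; rewrite !inE; case: eqVneq => // -> /=.
by rewrite ltnNge ij andbF.
Qed.

Lemma std_signP (n : nat) : sign_rule (@std_sign n).
Proof.
move=> i j S iS jS ij; rewrite !std_signU //.
have : (i < j)%N = ~~ (j < i)%N.
  by move: ij; rewrite -(inj_eq val_inj) /=; case: ltngtP.
by move=> ->; case: (std_sign i S); case: (std_sign j S); case: (j < i)%N.
Qed.

Definition dual_sign (n : nat) (j : 'I_n) (S : {set 'I_n}) : bool :=
  std_sign j (~: (j |: S)).

Lemma dual_signP (n : nat) : sign_rule (@dual_sign n).
Proof.
move=> i j S iS jS ij; rewrite /dual_sign.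
pose T := ~: (j |: (i |: S)).
have iT : i \notin T by rewrite !inE eqxx !orbT.
have jT : j \notin T by rewrite !inE eqxx.
have -> : ~: (i |: S) = j |: T.
  apply/setP => l; rewrite !inE; case: (eqVneq l j) => [->|] //=.
  by rewrite eq_sym (negPf ij) jS.
have E : i |: (j |: S) = j |: (i |: S) by rewrite setUCA.
have -> : ~: (j |: S) = i |: T.
  apply/setP => l; rewrite !inE; case: (eqVneq l i) => [->|] //=.
  by rewrite (negPf ij) iS.
rewrite E -/T; have := std_signP iT jT ij.
by case: (std_sign i T); case: (std_sign j T); case: (std_sign i _); case: (std_sign j _).
Qed.

(** * Visible walls of a polyhedron *)

Section Visible.
Variables (R : realType) (n k : nat) (V : polarized R n k) (M : zmodType).
Variable eps : 'I_n -> {set 'I_n} -> bool.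
Hypothesis epsP : sign_rule eps.
Variable b : signvec n.
Implicit Types (p : 'rV[R]_n) (E B D : {set 'I_n}).

(** For B empty, the complements in D of the sets of walls which have a common point
    with the face of Delta b cut out by the walls in E, that is, the faces of a
    simplicial complex seen through complements. The set B collects the walls deleted
    in an induction. *)
Definition wall_family E B D : {set {set 'I_n}} :=
  [set S : {set 'I_n} | [&& B \subset S, S \subset B :|: D &
     `[< exists x, Delta V b x /\ Hset V (E :|: (D :\: S)) x >]]].

Lemma wall_convex E B D : set_convex (wall_family E B D).
Proof.
move=> S T U; rewrite !inE => /and3P[BS _ /asboolP[x [xD [xV xH]]]].
move=> /and3P[_ UD _] ST TU; rewrite (subset_trans BS ST) (subset_trans TU UD) /=.
apply/asboolP; exists x; split => //; split => // i iT; apply: xH.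
by move: iT; rewrite !inE => /orP[->//|/andP[iT ->]]; rewrite andbT (contra _ iT) ?orbT //; apply/subsetP.
Qed.

Lemma wall_familyU E B D j : j \in D -> [disjoint B & D] ->
  [set S in wall_family E B D | j \in S] = wall_family E (j |: B) (D :\ j).
Proof.
move=> jD _; apply/setP => S; rewrite !inE subUset sub1set.
have [jS|jS] := boolP (j \in S); rewrite ?andbF ?andbT //=.
have -> : (j |: B) :|: D :\ j = B :|: D.
  by rewrite [j |: B]setUC -setUA setD1K.
have -> // : D :\ j :\: S = D :\: S.
by apply/setP => i; rewrite !inE; case: eqVneq => // ->; rewrite jS.
Qed.

Lemma wall_familyD E B D j : j \in D -> [disjoint B & D] ->
  [set S in wall_family E B D | j \notin S] = wall_family (j |: E) B (D :\ j).
Proof.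
move=> jD BD; apply/setP => S; rewrite !inE.
have jB : j \notin B by apply: contraTN jD => jB; rewrite (disjointFr BD jB).
have [jS|jS] := boolP (j \in S); rewrite ?andbF ?andbT /=.
  apply/esym/negbTE/negP => /and3P[_ /subsetP/(_ j jS)].
  by rewrite !inE (negPf jB) eqxx.
have -> : (S \subset B :|: D :\ j) = (S \subset B :|: D).
  apply/idP/idP => /subsetP H; apply/subsetP => i iS; have := H i iS; rewrite !inE.
    by case: (i \in B) => //= /andP[].
  by case: (eqVneq i j) => [ij|//]; rewrite -ij iS in jS.
have -> // : (j |: E) :|: (D :\ j :\: S) = E :|: (D :\: S).
apply/setP => i; rewrite !inE; case: (eqVneq i j) => [->|_] /=.
  by rewrite jS jD orbT.
by [].
Qed.

(** The walls of a polyhedron that are visible from an outside point have a contractible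
    union. The point p moves towards the polyhedron until it reaches one of the walls in
    D; this wall is peeled off, and the remaining ones are still visible from p, both
    for the face on that wall and after deleting the wall. As D may contain walls
    through p, the hypotheses persist. *)
Lemma visible_acyclic E B D p : Veta V p -> (forall i, i \in E -> p 0 i = 0) ->
  [disjoint B & D] ->
  (forall i, sgn R b i * p 0 i < 0 -> i \in D) ->
  (forall i, i \in D -> sgn R b i * p 0 i <= 0) ->
  (exists i, sgn R b i * p 0 i < 0) -> acyclic M eps (wall_family E B D).
Proof.
have [m] := ubnP #|D|; elim: m E B D p => // m IH E B D p Dm pV pE BD neg npos ex.
(* Both pieces obtained by peeling off the wall j are families of the same kind
   with the same outside point q, which lies on that wall. *)
have peel q j : Veta V q -> (forall i, i \in E -> q 0 i = 0) ->
    (forall i, sgn R b i * q 0 i < 0 -> i \in D) ->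
    (forall i, i \in D -> sgn R b i * q 0 i <= 0) ->
    (exists i, sgn R b i * q 0 i < 0) -> j \in D -> q 0 j = 0 ->
    acyclic M eps (wall_family E B D).
  move=> qV qE qneg qnpos qex jD qj.
  have Dm' : (#|D :\ j| < m)%N.
    by move: Dm; rewrite (cardsD1 j D) jD ltnS.
  have qneg' i : sgn R b i * q 0 i < 0 -> i \in D :\ j.
    move=> lt; rewrite !inE qneg // andbT; apply: contraTneq lt => ->.
    by rewrite qj mulr0 ltxx.
  have qnpos' i : i \in D :\ j -> sgn R b i * q 0 i <= 0.
    by rewrite !inE => /andP[_ /qnpos].
  apply: (acyclic_split epsP (j := j) (@wall_convex E B D)).
    rewrite wall_familyU //; apply: (IH E (j |: B) (D :\ j) q) => //.
    rewrite -setI_eq0; apply/eqP/setP => i; rewrite !inE.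
    case: (eqVneq i j) => //= _; rewrite andbC; apply/negbTE/negP => /andP[iD iB].
    by rewrite (disjointFr BD iB) in iD.
  rewrite wall_familyD //; apply: (IH (j |: E) B (D :\ j) q) => //.
    by move=> i; rewrite !inE => /orP[/eqP ->//|]; exact: qE.
  rewrite -setI_eq0; apply/eqP/setP => i; rewrite !inE.
  by apply/negbTE/negP => /and3P[iB _ iD]; rewrite (disjointFr BD iB) in iD.
have [[j [jD pj]]|nj] := pselect (exists j, j \in D /\ p 0 j = 0).
  exact: (peel p j).
have Dneg i : i \in D -> sgn R b i * p 0 i < 0.
  move=> iD; rewrite lt_neqAle npos // andbT sgn_mul_eq0.
  by apply/eqP => pi; apply: nj; exists i.
have [[y [yD yE]]|ney] := pselect (exists y, Delta V b y /\ forall i, i \in E -> y 0 i = 0);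
  last first.
  have -> : wall_family E B D = set0; last exact: acyclic0.
  apply/setP => S; rewrite !inE; apply/negbTE/negP.
  move=> /and3P[_ _ /asboolP[x [xD xH]]]; apply: ney; exists x; split => // i iE.
  by apply: xH.2; rewrite inE iE.
have [i0 i0P] := ex.
(* From now on p is strictly behind every wall in D, and y is a point of the face.
   The point q is the first one on the segment from p to y lying on such a wall j. *)
pose s i := sgn R b i * p 0 i; pose u i := sgn R b i * y 0 i.
pose r i := - s i / (u i - s i).
pose j := [arg min_(i < i0 | s i < 0) r i]%O.
have [jneg jmin] : s j < 0 /\ forall i, s i < 0 -> r j <= r i by rewrite /j; case: arg_minP.
have u0 i : 0 <= u i by exact: yD.2.
have den i : s i < 0 -> 0 < u i - s i by have := u0 i; lra.
have r0 : 0 < r j by rewrite divr_gt0 ?den // oppr_gt0.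
have r1 : r j <= 1 by rewrite ler_pdivrMr ?den // mul1r; have := u0 j; lra.
pose q := p + r j *: (y - p).
have qV : Veta V q by apply: VetaD => //; apply: VetaB => //; case: yD.
have qE i : i \in E -> q 0 i = 0.
  by move=> iE; rewrite !mxE pE // yE // subrr mulr0 addr0.
have qs i : sgn R b i * q 0 i = s i + r j * (u i - s i).
  by rewrite !mxE /s /u; ring.
have qj : q 0 j = 0.
  by apply/eqP; rewrite -(sgn_mul_eq0 b j) qs /r divfK ?addrN // gt_eqF ?den.
have qneg i : sgn R b i * q 0 i < 0 -> i \in D.
  move=> lt; apply: neg; move: lt; rewrite qs -/(s i); have := u0 i; nra.
have qnpos i : i \in D -> sgn R b i * q 0 i <= 0.
  move=> /Dneg si; rewrite qs; have := jmin i si.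
  by rewrite {2}/r ler_pdivlMr ?den //; lra.
have jD : j \in D by exact: neg.
have [qex|qnex] := pselect (exists i, sgn R b i * q 0 i < 0).
  exact: (peel q j).
(* Here q belongs to the face and to all the walls in D, so every set occurs. *)
have q0 i : 0 <= sgn R b i * q 0 i.
  by rewrite leNgt; apply/negP => ?; apply: qnex; exists i.
have qH i : i \in E :|: D -> q 0 i = 0.
  rewrite inE => /orP[/qE //|iD]; apply/eqP; rewrite -(sgn_mul_eq0 b i).
  by rewrite eq_le qnpos // q0.
apply: (acyclic_toggle epsP (j := j) (@wall_convex E B D)) => S jS.
have all T : (T \in wall_family E B D) = (B \subset T) && (T \subset B :|: D).
  rewrite inE; case: (B \subset T) => //=; case: (T \subset _) => //=.
  apply/asboolP; exists q; split => //; split => // i.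
  by rewrite in_setU in_setD => H; apply: qH; rewrite inE; case/orP: H => [->|/andP[_ ->]]; rewrite ?orbT.
rewrite !all [j |: S \subset _]subUset sub1set [j \in _]inE jD orbT /=.
have [/subsetP BS|/subsetPn BS] := boolP (B \subset S).
  have -> // : B \subset j |: S.
  by apply/subsetP => i /BS; rewrite inE => ->; rewrite orbT.
apply/esym/negbTE; rewrite negb_and; apply/orP; left; apply/subsetPn.
have [i iB iS] := BS; exists i => //; rewrite !inE negb_or iS andbT.
by apply: contraTneq iB => ->; rewrite (disjointFl BD jD).
Qed.

End Visible.

(** * Graded modules and resolutions *)

Lemma inj_surj_bij (T T' : Type) (f : T -> T') :
  injective f -> (forall y, exists x, f x = y) -> bijective f.
Proof.
move=> inj /choice[g gP]; exists g => // x; exact/inj/gP.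
Qed.

Lemma dependent_seq (T : nat -> Type) (r : forall i, T i -> T i.+1 -> Prop) (t0 : T 0%N) :
  (forall i t, exists t', r i t t') ->
  exists s : forall i, T i, s 0%N = t0 /\ forall i, r i (s i) (s i.+1).
Proof.
move=> ex; pose s := nat_rect T t0 (fun i t => projT1 (cid (ex i t))).
by exists s; split => // i /=; case: cid.
Qed.

Section GradedMaps.
Variable A : grRing.
Implicit Types (U W X : grMod A).

Lemma ghomB U W d (f : U -> W) x y : is_ghom d f -> f (x - y) = f x - f y.
Proof. by move=> Hf; rewrite (ghomD Hf) -scaleN1r (ghomZ Hf) scaleN1r. Qed.

Lemma ghom_id U : is_ghom 0 (@id U).
Proof. by split => // j x; rewrite addr0. Qed.

Lemma ghom_comp U W X d e (f : U -> W) (g : W -> X) :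
  is_ghom d f -> is_ghom e g -> is_ghom (d + e) (g \o f).
Proof.
move=> [fL fD] [gL gD]; split; first by move=> a x y /=; rewrite fL gL.
by move=> j x /fD /gD; rewrite addrA.
Qed.

Lemma ghom_comp0 U W X (f : U -> W) (g : W -> X) :
  is_ghom 0 f -> is_ghom 0 g -> is_ghom 0 (g \o f).
Proof. by move=> Hf Hg; have := ghom_comp Hf Hg; rewrite addr0. Qed.

Lemma giso_trans U W X : giso U W -> giso W X -> giso U X.
Proof.
move=> [f [Hf bf]] [g [Hg bg]]; exists (g \o f); split; first exact: ghom_comp0.
exact: bij_comp.
Qed.

Lemma ghom_inv U W (f : U -> W) g :
  is_ghom 0 f -> cancel f g -> cancel g f -> is_ghom 0 g.
Proof.
move=> Hf fK gK.
split=> [a x y|j x dx]; first by apply: (can_inj fK); rewrite gK Hf.1 !gK.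
rewrite addr0; suff -> : g x = hc (gm_grading U) (g x) j by exact: hc_deg.
apply: (can_inj fK); rewrite (ghom_hc Hf) gK addr0.
by rewrite (hc_hom _ _ dx) eqxx.
Qed.

Lemma giso_sym U W : giso U W -> giso W U.
Proof.
move=> [f [Hf [g fK gK]]]; exists g; split; last by exists f.
exact: ghom_inv Hf fK gK.
Qed.

Lemma giso_gshift U W d : giso U W -> giso (gshift d U) (gshift d W).
Proof.
move=> [f [[fL fD] bf]]; exists f; split => //; split => // j x /fD.
by rewrite !addr0.
Qed.

Lemma giso_gshift0 U : giso (gshift 0 U) U.
Proof.
exists id; split; last by exists id.
by split => // j x dx; rewrite addr0; rewrite /= subr0 in dx.
Qed.

Lemma giso_eq0 U W : giso U W -> (forall x : W, x = 0) -> forall x : U, x = 0.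
Proof.
move=> [f [Hf bf]] W0 x; apply: (bij_inj bf).
by rewrite (ghom0 Hf).
Qed.

Lemma giso_quot U W (N : hsubmodule U) (f : U -> W) : is_ghom 0 f ->
  (forall y, exists x, f x = y) -> (forall x, f x = 0 <-> N x) -> giso (gquot N) W.
Proof.
move=> Hf fS fN; pose g (y : gquot N) : W := f (qrepr y).
have gE x : g (qpi N x) = f x.
  apply/eqP; rewrite -subr_eq0 -(ghomB _ _ Hf); apply/eqP/fN.
  by apply/(qpi_eq N); rewrite qreprK.
exists g; split.
  split=> [a x y|j _ [x [dx ->]]]; last by rewrite gE; exact: Hf.2.
  by rewrite -[x](qreprK (N := N)) -[y](qreprK (N := N)) -qpiZ -qpiD !gE Hf.1.
apply: inj_surj_bij => [x y|y]; last by have [x <-] := fS y; exists (qpi N x).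
rewrite -[x](qreprK (N := N)) -[y](qreprK (N := N)) !gE => /eqP.
by rewrite -subr_eq0 -(ghomB _ _ Hf) => /eqP/fN/(qpi_eq N).
Qed.

Section Image.
Variables (U W : grMod A) (f : U -> W).
Hypothesis Hf : is_ghom 0 f.

Let im_pred (y : W) := exists x, f x = y.

Fact gim_zero : im_pred 0. Proof. by exists 0; rewrite (ghom0 Hf). Qed.
Fact gim_lin (a : A) x y : im_pred x -> im_pred y -> im_pred (a *: x + y).
Proof. by move=> [x' <-] [y' <-]; exists (a *: x' + y'); rewrite Hf.1. Qed.
Definition gim_sub : submodule W := Submodule gim_zero gim_lin.
Fact gim_hom x h : gim_sub x -> hdecomp (@gm_deg A W) x h -> forall m, gim_sub (h m).
Proof.
move=> [y <-] /(hc_uniq (gm_grading W)) -> m.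
by exists (hc (gm_grading U) y m); rewrite (ghom_hc Hf) addr0.
Qed.
Definition gim : hsubmodule W := HSubmodule gim_hom.
End Image.

(** Projectivity is applied to the map from U onto the image of g. *)
Lemma gprojective_lift (P U W : grMod A) (g : U -> W) (h : P -> W) : gprojective P ->
  is_ghom 0 g -> is_ghom 0 h -> (forall x, exists y, g y = h x) ->
  exists l : P -> U, is_ghom 0 l /\ forall x, g (l x) = h x.
Proof.
move=> pP Hg Hh ex.
have gI y : gim Hg (g y) by exists y.
pose g' (y : U) : gsub (gim Hg) := smk (gI y).
pose h' (x : P) : gsub (gim Hg) := smk (ex x : gim Hg (h x)).
have Hg' : is_ghom 0 g'.
  split; last by move=> j x /Hg.2.
  by move=> a x y; apply: val_inj; rewrite smvD smvZ /= Hg.1.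
have Hh' : is_ghom 0 h'.
  split; last by move=> j x /Hh.2.
  by move=> a x y; apply: val_inj; rewrite smvD smvZ /= Hh.1.
have [|l [Hl lP]] := pP _ _ g' h' Hg' _ Hh'.
  by move=> y; have [x xy] := smP y; exists x; apply: val_inj.
by exists l; split => // x; rewrite -[LHS]/(val (g' (l x))) lP.
Qed.

End GradedMaps.

(** Chain maps and homotopies are built one degree at a time, by a recursion that
    also carries the property of the last map needed to lift the next one. *)
Section Comparison.
Variables (A : grRing) (U : grMod A).

Definition res_cycle (P : gresolution U) i : P i -> Prop :=
  match i return P i -> Prop with
  | 0%N => fun x => res_aug x = 0
  | j.+1 => fun x => res_d x = 0
  end.

Lemma res_cycleP (P : gresolution U) i (x : P i) :
  res_cycle x <-> exists y, res_d y = x.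
Proof. by case: i x => [|i] x; [exact: res_exact0|exact: res_exact]. Qed.

Lemma res_cycle_d (P : gresolution U) i (x : P i.+1) : res_cycle (res_d x).
Proof. by apply/res_cycleP; exists x. Qed.

Definition chain_map (P Q : gresolution U) (F : forall i, P i -> Q i) :=
  (forall i, is_ghom 0 (F i)) /\ (forall i x, res_d (F i.+1 x) = F i (res_d x)).

Lemma chain_lift (P Q : gresolution U) : exists F : forall i, P i -> Q i,
  chain_map F /\ forall x, res_aug (F 0%N x) = res_aug x.
Proof.
(* Preserving cycles is what makes the next composite liftable. *)
pose T i := {F : P i -> Q i | is_ghom 0 F /\ forall x, res_cycle x -> res_cycle (F x)}.
have [F0 [HF0 F0P]] := gprojective_lift (@res_proj _ _ P 0) (res_aug_ghom Q) (res_aug_ghom P)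
  (fun x => @res_aug_surj _ _ Q (res_aug x)).
have F0c (x : P 0%N) : res_cycle x -> res_cycle (F0 x) by rewrite /= F0P.
pose r i (F : T i) (G : T i.+1) := forall x, res_d (sval G x) = sval F (res_d x).
have [|s [s0 sP]] := @dependent_seq T r (exist _ F0 (conj HF0 F0c)).
  move=> i [F [HF Fc]].
  have [||G [HG GP]] := @gprojective_lift _ _ _ _ _ (F \o @res_d _ _ P i) (@res_proj _ _ P i.+1)
    (res_d_ghom Q i).
  - by apply: ghom_comp0 => //; exact: res_d_ghom.
  - by move=> x; apply/res_cycleP/Fc/res_cycle_d.
  have Gc x : res_cycle x -> res_cycle (G x) by move=> /= xc; rewrite GP /= xc (ghom0 HF).
  by exists (exist _ G (conj HG Gc)).
exists (fun i => sval (s i)); split; last by rewrite s0.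
by split => // i; case: (s i) => F [].
Qed.

Lemma chain_homotopy (P Q : gresolution U) (G : forall i, P i -> Q i) :
  chain_map G -> (forall x, res_aug (G 0%N x) = 0) ->
  exists h : forall i, P i -> Q i.+1,
    [/\ forall i, is_ghom 0 (h i), forall x, G 0%N x = res_d (h 0%N x) &
        forall i x, G i.+1 x = res_d (h i.+1 x) + h i (res_d x)].
Proof.
move=> [HG Gd] G0.
(* On cycles, where the homotopy of the previous degree does not contribute, the
   differential of h must already be G. *)
pose T i := {h : P i -> Q i.+1 | is_ghom 0 h /\
  forall x, res_cycle x -> res_d (h x) = G i x}.
have [|h0 [Hh0 h0P]] := gprojective_lift (@res_proj _ _ P 0) (res_d_ghom Q 0) (HG 0%N).
  by move=> x; apply/res_cycleP/G0.
pose r i (h : T i) (h' : T i.+1) :=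
  forall x, G i.+1 x = res_d (sval h' x) + sval h (res_d x).
have [|s [s0 sP]] := @dependent_seq T r (exist _ h0 (conj Hh0 (fun x _ => h0P x))).
  move=> i [h [Hh hP]].
  have Hl : is_ghom 0 (fun x : P i.+1 => G i.+1 x - h (res_d x)).
    apply: is_ghomB => //; apply: ghom_comp0 Hh; exact: res_d_ghom.
  have [|h' [Hh' h'P]] := gprojective_lift (@res_proj _ _ P i.+1) (res_d_ghom Q i.+1) Hl.
    move=> x; apply/res_cycleP => /=.
    by rewrite (ghomB _ _ (res_d_ghom Q i)) Gd hP ?subrr //; exact: res_cycle_d.
  have h'c x : res_cycle x -> res_d (h' x) = G i.+1 x.
    by move=> /= xc; rewrite h'P xc (ghom0 Hh) subr0.
  by exists (exist _ h' (conj Hh' h'c)) => x /=; rewrite h'P subrK.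
exists (fun i => sval (s i)); split => //; last by rewrite s0.
by move=> i; case: (s i) => h [].
Qed.

End Comparison.

Section HomElements.
Variables (C A : grRing) (phi : central_map C A) (U W : grMod A).
Implicit Type f : gHom phi U W.

Lemma homE_lin f (a : A) x y : val f (a *: x + y) = a *: val f x + val f y.
Proof.
have [h [Dh [s [_ _ ->]]]] := homP f; rewrite !fct_sumE scaler_sumr -big_split.
by apply: eq_bigr => m _; rewrite (Dh m).1.
Qed.
Lemma homED f x y : val f (x + y) = val f x + val f y.
Proof. by rewrite -[x in LHS]scale1r homE_lin scale1r. Qed.
Lemma homE0 f : val f 0 = 0.
Proof. by apply: (addIr (val f 0)); rewrite -homED !add0r. Qed.
Lemma homEZ f (a : A) x : val f (a *: x) = a *: val f x.
Proof. by rewrite -[a *: x]addr0 homE_lin homE0 addr0. Qed.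
Lemma homEB f x y : val f (x - y) = val f x - val f y.
Proof. by rewrite homED -scaleN1r homEZ scaleN1r. Qed.
Lemma homE_sum f (I : Type) (s : seq I) (P : pred I) (F : I -> U) :
  val f (\sum_(i <- s | P i) F i) = \sum_(i <- s | P i) val f (F i).
Proof. by apply: (big_morph (val f)) => [x y|]; rewrite ?homED ?homE0. Qed.
End HomElements.

Section ExtInvariance.
Variables (C A : grRing) (phi : central_map C A) (U W : grMod A).

Section Precomp.
Variables (X Y : grMod A) (F : X -> Y).
Hypothesis HF : is_ghom 0 F.

Fact precomp_subproof (f : gHom phi Y W) : val f \o F \in @hom_pred A X W.
Proof. by have [h Hh] := homP f; exact: (hom_intro (hdecomp_comp HF Hh)). Qed.

Definition precomp (f : gHom phi Y W) : gHom phi X W :=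
  exist (fun g => g \in @hom_pred A X W) _ (precomp_subproof f).

Lemma precomp_ghom : is_ghom 0 precomp.
Proof.
split=> [c f g|j f Hf]; first exact: val_inj.
by have := ghom_comp HF Hf; rewrite add0r addr0.
Qed.
End Precomp.

Section Induced.
Variables (P Q : gresolution U) (F : forall i, P i -> Q i).
Hypothesis FP : chain_map F.

Lemma precomp_cocycle i (f : gHom phi (Q i) W) :
  cocycle f -> cocycle (precomp (FP.1 i) f).
Proof. by move=> Hf x /=; rewrite -FP.2 Hf. Qed.

Lemma precomp_coboundary i (f : gHom phi (Q i) W) :
  coboundary f -> coboundary (precomp (FP.1 i) f).
Proof.
case: i f => [|i] f /=; first by move=> ->; exact: (ghom0 (precomp_ghom (FP.1 0%N))).
move=> [g gP]; exists (precomp (FP.1 i) g) => x /=.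
by rewrite gP FP.2.
Qed.

Definition coh_map i (y : cohomology phi W Q i) : cohomology phi W P i :=
  qpi (gcoboundaries phi W P i)
    (smk (N := gcocycles phi W P i) (precomp_cocycle (smP (qrepr y)))).

Lemma coh_mapE i (f : cocycles phi W Q i) : coh_map (qpi (gcoboundaries phi W Q i) f) =
  qpi (gcoboundaries phi W P i)
    (smk (N := gcocycles phi W P i) (precomp_cocycle (smP f))).
Proof.
apply/(qpi_eq (gcoboundaries phi W P i)).
have := precomp_coboundary (@qreprP _ _ (gcoboundaries phi W Q i) f).
by congr coboundary; apply: val_inj.
Qed.

Lemma coh_map_ghom i : is_ghom 0 (@coh_map i).
Proof.
split=> [c x y|j _ [f [df ->]]].
  rewrite -[x](qreprK (N := gcoboundaries phi W Q i)).
  rewrite -[y](qreprK (N := gcoboundaries phi W Q i)).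
  rewrite -qpiZ -qpiD !coh_mapE -qpiZ -qpiD; congr (qpi _ _).
  by apply: val_inj; apply: val_inj.
rewrite coh_mapE; eexists; split; last reflexivity.
exact: (precomp_ghom (FP.1 i)).2 df.
Qed.

End Induced.

Lemma homotopic_id (P : gresolution U) (G : forall i, P i -> P i) :
  chain_map G -> (forall x, res_aug (G 0%N x) = res_aug x) ->
  forall i (f : gHom phi (P i) W), cocycle f ->
  forall g : gHom phi (P i) W, (forall x, val g x = val f (G i x)) -> coboundary (g - f).
Proof.
move=> [HG Gd] G0 i f fc g gP.
have DP : chain_map (fun i x => G i x - x).
  split=> [j|j x]; first by apply: is_ghomB => //; exact: ghom_id.
  by rewrite (ghomB _ _ (res_d_ghom P j)) Gd.
have [|h [Hh h0 hS]] := chain_homotopy DP.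
  by move=> x; rewrite (ghomB _ _ (res_aug_ghom P)) G0 subrr.
have E x : val (g - f) x = val f (G i x - x) by rewrite homEB -gP.
case: i f fc g gP E => [|i] f fc g gP E.
  by apply: val_inj; apply/funext => x; rewrite E h0 fc.
exists (precomp (Hh i) f) => x; rewrite E hS /=.
by rewrite homED fc add0r.
Qed.

(** The chain maps lifting the identity in both directions are homotopy inverse to
    each other, and homotopies act on cocycles by coboundaries. *)
Lemma cohomology_iso (P Q : gresolution U) i :
  giso (cohomology phi W P i) (cohomology phi W Q i).
Proof.
have [F [FP F0]] := chain_lift Q P; have [G [GP G0]] := chain_lift P Q.
exists (@coh_map Q P F FP i); split; first exact: coh_map_ghom.
have comp (X Y : gresolution U) (H : forall i, X i -> Y i) (K : forall i, Y i -> X i)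
    (HP : chain_map H) (KP : chain_map K) :
    (forall x, res_aug (H 0%N x) = res_aug x) -> (forall x, res_aug (K 0%N x) = res_aug x) ->
    cancel (@coh_map Y X K KP i) (@coh_map X Y H HP i).
  move=> H0 K0 y; rewrite -[y](qreprK (N := gcoboundaries phi W X i)) !coh_mapE.
  apply/(qpi_eq (gcoboundaries phi W X i)).
  have KHP : chain_map (fun j => K j \o H j).
    split=> [j|j x /=]; first by apply: ghom_comp0; [exact: HP.1|exact: KP.1].
    by rewrite KP.2 HP.2.
  apply: (homotopic_id KHP) => //; first by move=> x /=; rewrite K0 H0.
  exact: smP (qrepr y).
exists (@coh_map P Q G GP i); exact: comp.
Qed.

End ExtInvariance.

(** * Entries of elements of the algebra *)

Section SupportFilter.
Variable n : nat.
Local Notation Zu := {mpoly int[n]}.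
Implicit Types (p q : Zu) (m : 'X_{1..n}) (S T : {set 'I_n}) (P Q : pred {set 'I_n}).

Definition mnm_supp m : {set 'I_n} := [set i | m i != 0%N].

(** The ideals of relations, the specializations u_j = 0 and the multidegrees all
    select monomials according to their support only. *)
Definition sfilter P p : Zu := \sum_(m <- msupp p | P (mnm_supp m)) p@_m *: 'X_[m].

Lemma mcoeff_sfilter P p m : (sfilter P p)@_m = if P (mnm_supp m) then p@_m else 0.
Proof. exact: (mcoeff_filter (fun m => P (mnm_supp m))). Qed.

Lemma sfilterB P p q : sfilter P (p - q) = sfilter P p - sfilter P q.
Proof.
by apply/mpolyP => m; rewrite mcoeffB !mcoeff_sfilter mcoeffB; case: ifP; rewrite ?subrr.
Qed.

Lemma sfilter0 P : sfilter P 0 = 0.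
Proof. by have := sfilterB P 0 0; rewrite !subrr. Qed.

Lemma sfilterD P p q : sfilter P (p + q) = sfilter P p + sfilter P q.
Proof.
by apply/mpolyP => m; rewrite mcoeffD !mcoeff_sfilter mcoeffD; case: ifP; rewrite ?addr0.
Qed.

Lemma sfilter_sum P (I : Type) (s : seq I) (A : pred I) (F : I -> Zu) :
  sfilter P (\sum_(i <- s | A i) F i) = \sum_(i <- s | A i) sfilter P (F i).
Proof. by apply: (big_morph (sfilter P)) => [x y|]; rewrite ?sfilterD ?sfilter0. Qed.

Lemma sfilter_signed P b p : sfilter P (signed b p) = signed b (sfilter P p).
Proof. by apply: signed_morph => x y; exact: sfilterB. Qed.

Lemma sfilter_sfilter P Q p : sfilter P (sfilter Q p) = sfilter (fun T => P T && Q T) p.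
Proof.
by apply/mpolyP => m; rewrite !mcoeff_sfilter; case: (P _); case: (Q _).
Qed.

Lemma sfilter_idem P p : sfilter P (sfilter P p) = sfilter P p.
Proof. by apply/mpolyP => m; rewrite !mcoeff_sfilter; case: (P _). Qed.

Lemma eq_sfilter P Q p : P =1 Q -> sfilter P p = sfilter Q p.
Proof. by move=> PQ; apply/mpolyP => m; rewrite !mcoeff_sfilter PQ. Qed.

Lemma sfilter_false p : sfilter (fun=> false) p = 0.
Proof. by apply/mpolyP => m; rewrite mcoeff_sfilter mcoeff0. Qed.

Lemma sfilter_supp_sum p : p = \sum_(T : {set 'I_n}) sfilter (pred1 T) p.
Proof.
apply/mpolyP => m; rewrite raddf_sum /= (bigD1 (mnm_supp m)) //= big1.
  by rewrite mcoeff_sfilter /= eqxx addr0.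
by move=> T mT; rewrite mcoeff_sfilter /= eq_sym (negPf mT).
Qed.

Definition set_mnm S : 'X_{1..n} := [multinom (i \in S : nat) | i < n].

Lemma umonE S : umon S = 'X_[set_mnm S] :> Zu.
Proof.
rewrite mpolyXE_id /umon big_mkcond; apply: eq_bigr => i _.
by rewrite mnmE; case: (i \in S); rewrite ?expr1 ?expr0.
Qed.

Lemma set_mnm_le S m : (set_mnm S <= m)%MM = (S \subset mnm_supp m).
Proof.
apply/mnm_lepP/subsetP => [H i iS|H i].
  by have := H i; rewrite mnmE iS inE lt0n.
by rewrite mnmE; case: (boolP (i \in S)) => // /H; rewrite inE lt0n.
Qed.

Lemma mcoeff_umonM S p m : (umon S * p)@_m =
  if S \subset mnm_supp m then p@_(m - set_mnm S) else 0.
Proof.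
rewrite umonE mulrC -set_mnm_le; case: ifPn => Sm.
  by rewrite -{1}(submK Sm) [(_ - _ + _)%MM]addmC mcoeffMX.
apply: memN_msupp_eq0; apply: contra Sm.
rewrite (perm_mem (msuppMX _ _)) => /mapP[k _ ->]; exact: lem_addr.
Qed.

Lemma mnm_suppB S m : S \subset mnm_supp m -> mnm_supp (m - set_mnm S)%MM :|: S = mnm_supp m.
Proof.
move=> /subsetP Sm; apply/setP => i; rewrite !inE mnmBE mnmE.
have := Sm i; rewrite !inE; case: (i \in S) => [->|_] //; first by rewrite orbT.
by rewrite subn0 orbF.
Qed.

Lemma mnm_supp_mem P p : sfilter P p = p <-> forall m, p@_m != 0 -> P (mnm_supp m).
Proof.
split=> [<- m|H]; first by rewrite mcoeff_sfilter; case: ifP => //; rewrite eqxx.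
apply/mpolyP => m; rewrite mcoeff_sfilter; case: ifPn => // Pm.
by apply/esym/eqP; apply: contraNT Pm; exact: H.
Qed.

Lemma sfilter_umon S P Q p : (forall T, P T = Q (T :|: S)) ->
  umon S * sfilter P p = sfilter Q (umon S * p).
Proof.
move=> PQ; apply/mpolyP => m; rewrite mcoeff_sfilter !mcoeff_umonM mcoeff_sfilter PQ.
by case: ifPn => Sm; [rewrite mnm_suppB|rewrite if_same].
Qed.

Lemma sfilter_umon_sub S P p : sfilter P (umon S * p) =
  sfilter (fun T => (S \subset T) && P T) (umon S * p).
Proof.
apply/mpolyP => m; rewrite !mcoeff_sfilter mcoeff_umonM.
by case: (S \subset _); rewrite ?if_same.
Qed.

Lemma umon_div S p : sfilter (fun T => S \subset T) p = p -> exists q, umon S * q = p.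
Proof.
move=> /mnm_supp_mem H.
exists (\sum_(m <- msupp p) p@_m *: 'X_[m - set_mnm S]).
rewrite mulr_sumr [RHS]mpolyE; apply: eq_big_seq => m mp.
rewrite -scalerAr umonE -mpolyXD addmC submK // set_mnm_le; apply: H.
by rewrite -mcoeff_msupp.
Qed.

Lemma umon_neq0 S : umon S != 0 :> Zu.
Proof.
rewrite umonE; apply/eqP => /(congr1 (mcoeff (set_mnm S))).
by rewrite mcoeffX eqxx mcoeff0.
Qed.

Lemma umonU S T : [disjoint S & T] -> umon S * umon T = umon (S :|: T) :> Zu.
Proof.
move=> ST; rewrite /umon [RHS](big_setID S) /= setUK; congr (_ * _).
by apply: eq_bigl => i; rewrite !inE; case: (boolP (i \in S)) => //= /(disjointFr ST) ->.
Qed.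

Lemma set_zero_sfilter z p : set_zero z p = sfilter (fun T => T \subset z) p.
Proof.
apply/mpolyP => m; rewrite mcoeff_set_zero mcoeff_sfilter; congr (if _ then _ else _).
apply/forallP/subsetP => [H i|H i].
  by rewrite inE; have := H i; case: (i \in z) => //= /eqP ->.
by apply/implyP => iz; apply: contraNT iz => im; apply: H; rewrite inE.
Qed.

End SupportFilter.

Section Entries.
Variables (R : realType) (n k : nat) (V : polarized R n k).
Local Notation Zu := {mpoly int[n]}.
Local Notation B := (Btilde V).
Implicit Types (p q : Zu) (S T : {set 'I_n}) (x y z : Btilde V).

Definition meets (b c : signvec n) (T : {set 'I_n}) : bool :=
  `[< exists x : 'rV[R]_n, [/\ Delta V b x, Delta V c x & Hset V T x] >].

Lemma meetsS b c S T : S \subset T -> meets b c T -> meets b c S.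
Proof.
move=> /subsetP ST /asboolP[x [xb xc [xV xT]]]; apply/asboolP; exists x.
by split => //; split => // i /ST; exact: xT.
Qed.

(** The relations are monomials, so the ideal is spanned by the monomials whose
    support is the set of equations of an empty face. *)
Lemma rel_idealP b c p : rel_ideal V b c p <-> sfilter (meets b c) p = 0.
Proof.
split=> [[C ->]|p0].
  rewrite sfilter_sum big1 // => S /asboolP nS; apply/mpolyP => m.
  rewrite mcoeff_sfilter mcoeff0; case: ifP => // mm.
  rewrite mulrC mcoeff_umonM; case: ifP => // Sm.
  by case: nS; apply/asboolP; exact: meetsS mm.
rewrite [p]mpolyE; apply: (sm_sum (N := rel_ideal V b c)) => m _.
have [pm|pm] := eqVneq p@_m 0; first by rewrite pm scale0r; exact: sm_zero.
have [q qE] : exists q, umon (mnm_supp m) * q = p@_m *: 'X_[m].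
  apply: umon_div; apply/mnm_supp_mem => j; rewrite mcoeffZ mcoeffX.
  by case: (eqVneq m j) => [->//|_]; rewrite mulr0 eqxx.
have bad : `[< ~ exists x : 'rV[R]_n, [/\ Delta V b x, Delta V c x & Hset V (mnm_supp m) x] >].
  apply/asboolP => ex; move/(congr1 (mcoeff m)): p0.
  rewrite mcoeff_sfilter mcoeff0 (_ : meets b c _ = true); last exact/asboolP.
  by move/eqP; rewrite (negPf pm).
exists (fun T => if T == mnm_supp m then q else 0).
rewrite -qE (bigD1 (mnm_supp m)) //= eqxx big1 ?addr0; first by rewrite mulrC.
by move=> T /andP[_ /negPf ->]; rewrite mul0r.
Qed.

Lemma sfilter_meets_eq b c p q : rel_ideal V b c (p - q) ->
  sfilter (meets b c) p = sfilter (meets b c) q.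
Proof. by move=> /rel_idealP/eqP; rewrite sfilterB subr_eq0 => /eqP. Qed.

(** An element of the algebra is determined by its entries, which are the normal
    forms of its components for the monomial ideals. *)
Definition entry (b c : chamber V) x : Zu :=
  sfilter (meets (val b) (val c)) ((qrepr (x : quot_mod (brel V)) : bpre V) (b, c)).

Lemma entry_pi b c (f : bpre V) :
  entry b c (bpi f) = sfilter (meets (val b) (val c)) (f (b, c)).
Proof.
apply: sfilter_meets_eq; have := @qreprP _ _ (brel V) f.
by move=> /(_ (b, c)); rewrite !ffunE.
Qed.

Lemma entryB b c x y : entry b c (x - y) = entry b c x - entry b c y.
Proof.
rewrite -[x](bpi_repr (V := V)) -[y](bpi_repr (V := V)).
set f := qrepr _; set g := qrepr _.
have -> : bpi f - bpi g = bpi (f - g :> bpre V) by exact/esym/qpiB.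
by rewrite !entry_pi !ffunE sfilterB.
Qed.

Lemma entry0 b c : entry b c 0 = 0.
Proof. by have := entryB b c 0 0; rewrite !subrr. Qed.

Lemma entryD b c x y : entry b c (x + y) = entry b c x + entry b c y.
Proof. by rewrite -{1}[y]opprK entryB -[- y]sub0r entryB entry0 sub0r opprK. Qed.

Lemma entry_sum b c (I : Type) (s : seq I) (P : pred I) (F : I -> B) :
  entry b c (\sum_(i <- s | P i) F i) = \sum_(i <- s | P i) entry b c (F i).
Proof. by apply: (big_morph (entry b c)) => [x y|]; rewrite ?entryD ?entry0. Qed.

Lemma entry_signed b c s x : entry b c (signed s x) = signed s (entry b c x).
Proof. by apply: signed_morph => u v; exact: entryB. Qed.

Lemma entry_eq0 x : (forall b c, entry b c x = 0) -> x = 0.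
Proof.
move=> H; rewrite -[x](bpi_repr (V := V)); apply/(qpi_eq0 (brel V)).
suff : brel_pred (qrepr (x : quot_mod (brel V))) by [].
by move=> -[b c]; apply/rel_idealP; exact: H.
Qed.

Lemma entry_nf b c x : sfilter (meets (val b) (val c)) (entry b c x) = entry b c x.
Proof. exact: sfilter_idem. Qed.

(** Normal forms may be taken before multiplying because left and right
    multiplication map relations to relations. *)
Lemma entry_mul b d x y : entry b d (x * y) = sfilter (meets (val b) (val d))
  (\sum_c entry b c x * entry c d y * umon (sset (val b) (val c) (val d))).
Proof.
rewrite -{1}[x](bpi_repr (V := V)) -{1}[y](bpi_repr (V := V)) bpiM entry_pi ffunE /=.
rewrite !sfilter_sum; apply: eq_bigr => c _; rewrite /entry /=.
set f : Zu := (qrepr _ : bpre V) _; set g : Zu := (qrepr _ : bpre V) _.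
set N := sfilter _ f; set N' := sfilter _ g; set u := umon _.
apply: sfilter_meets_eq.
have -> : f * g * u - N * N' * u = g * (u * (f - N)) + N * (u * (g - N')) by ring.
have nf (p : Zu) e e' : rel_ideal V e e' (p - sfilter (meets e e') p).
  by apply/rel_idealP; rewrite sfilterB sfilter_idem subrr.
apply: (sm_add (N := rel_ideal V _ _)); apply: (sm_scale (N := rel_ideal V _ _)).
  by apply: rel_ideal_comp; left; exact: nf.
by apply: rel_ideal_comp; right; exact: nf.
Qed.

Definition of_entries (F : chamber V -> chamber V -> Zu) : B := bpi [ffun p => F p.1 p.2].

Lemma entry_of b c F : entry b c (of_entries F) = sfilter (meets (val b) (val c)) (F b c).
Proof. by rewrite entry_pi ffunE. Qed.

Lemma entry_fgen b c d e : entry b c (fgen d e) =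
  if (b == d) && (c == e) then sfilter (meets (val b) (val c)) 1 else 0.
Proof.
rewrite entry_pi ffunE xpair_eqE; case: ifP => // _; exact: sfilter0.
Qed.

Lemma sfilter_meets_sset b c d p :
  sfilter (meets b d) (umon (sset b c d) * sfilter (meets b c) p) =
  sfilter (meets b d) (umon (sset b c d) * p).
Proof.
apply/esym/sfilter_meets_eq; rewrite -mulrBr; apply: rel_ideal_comp; left.
by apply/rel_idealP; rewrite sfilterB sfilter_idem subrr.
Qed.

Lemma entry_mul_fgen b c d e x : entry b e (x * fgen c d) =
  if e == d then sfilter (meets (val b) (val d))
    (umon (sset (val b) (val c) (val d)) * entry b c x) else 0.
Proof.
rewrite -{1}[x](bpi_repr (V := V)) bpiM entry_pi ffunE /=.
rewrite (bigD1 c) //= big1 ?addr0; last first.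
  by move=> c' cc; rewrite ffunE xpair_eqE (negPf cc) mulr0 mul0r.
rewrite ffunE xpair_eqE eqxx /=; case: eqVneq => [->|_]; last first.
  by rewrite mulr0 mul0r sfilter0.
by rewrite mulr1 mulrC /entry sfilter_meets_sset.
Qed.

Lemma entry_mul_egen b c d x : entry b d (x * egen c) = if d == c then entry b c x else 0.
Proof.
rewrite entry_mul_fgen sset_abb umon0 mul1r.
by case: eqP => // _; rewrite entry_nf.
Qed.

Lemma egen_entry (c : chamber V) x : (forall b d, d != c -> entry b d x = 0) -> x * egen c = x.
Proof.
move=> H; apply/eqP; rewrite -subr_eq0; apply/eqP/entry_eq0 => b d.
rewrite entryB entry_mul_egen; case: eqVneq => [->|dc]; first by rewrite subrr.
by rewrite H ?subrr.
Qed.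

Lemma fgen_egen (b c : chamber V) : fgen b c * egen c = fgen b c.
Proof.
apply: egen_entry => d e ec; rewrite entry_fgen (negPf ec) andbF //.
Qed.

Lemma egen_idem (c : chamber V) : egen c * egen c = egen c.
Proof. exact: fgen_egen. Qed.

Lemma fgen_deg (b c : chamber V) : gr_deg (sdist (val b) (val c))%:Z (fgen b c).
Proof.
eexists; split; last reflexivity; move=> p; rewrite ffunE; case: eqP => [->|_].
  by rewrite /pdist subrr; exact: mpoly_deg1.
exact: (grading0 (mpoly_grading n)).
Qed.

End Entries.

(** * Crossing walls away from the optimal vertex *)

Section Flips.
Variables (R : realType) (n k : nat) (V : polarized R n k).

Definition flip (a : signvec n) (S : {set 'I_n}) : signvec n :=
  [ffun i => a i (+) (i \in S)].

Lemma flip0 a : flip a set0 = a.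
Proof. by apply/ffunP => i; rewrite ffunE inE addbF. Qed.

Lemma flip_bounded a (S : {set 'I_n}) : a \in Pset V -> S \subset ~: bas_of V a ->
  flip a S \in bounded_signs V.
Proof.
move=> aP /subsetP Sx; apply: (bounded_of_basis aP) => i ix; rewrite ffunE.
have -> : (i \in S) = false; last by rewrite addbF.
by apply/negbTE/negP => /Sx; rewrite inE ix.
Qed.

Lemma meets_feasible b c T : meets V b c T -> c \in feasible_signs V.
Proof. by move=> /asboolP[x [_ xc _]]; rewrite inE; apply/asboolP; exists x. Qed.

Lemma meets_Pset b c T : c \in bounded_signs V -> meets V b c T -> c \in Pset V.
Proof. by move=> cB /meets_feasible cF; rewrite inE cF. Qed.

(** Crossing a wall away from the optimal vertex p makes the chamber smaller: the
    optimum over the flipped chamber lies on that wall, since the segment from it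
    to p would otherwise enter the flipped chamber with increasing xi; hence it is
    a vertex of Delta a, from which the simplex method leads to p. *)
Lemma flip1_lt (a c : chamber V) j : j \notin bas_of V (val a) ->
  val c = flip (val a) [set j] -> chamber_lt c a.
Proof.
move=> jx cE; have cj i : val c i = val a i (+) (i == j) by rewrite cE ffunE inE.
have [p [Hp pD pmax pn]] := chamber_vertex (valP a).
have [q [Hq qD qmax _]] := chamber_vertex (valP c).
have ci i : i != j -> sgn R (val c) i = sgn R (val a) i.
  by move=> ij; rewrite /sgn cj (negPf ij) addbF.
have cjN : sgn R (val c) j = - sgn R (val a) j.
  by rewrite /sgn cj eqxx addbT; case: (val a j); rewrite ?opprK.
rewrite /chamber_lt; apply/andP; split.
  by apply/eqP => ac; have := cj j; rewrite ac eqxx addbT; case: (val a j).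
have qa i : i != j -> 0 <= sgn R (val a) i * q 0 i.
  by move=> ij; rewrite -(ci i ij); exact: qD.2.
suff qj : q 0 j = 0.
  apply: (simplex_path (valP a) (bas_ofP (valP c)).1 Hq); split; first by case: qD.
  by move=> i; case: (eqVneq i j) => [->|/qa //]; rewrite qj mulr0.
apply/eqP/negP => /negP qj.
have qneg : sgn R (val a) j * q 0 j < 0.
  rewrite -oppr_gt0 -mulNr -cjN; exact: (Delta_lt0 qD qj).
have ppos := pn j jx.
have [||le eq] := basis_cone_max (valP a) Hp (y := q).
- by case: qD.
- by move=> i ix; apply: qa; apply: contraNneq jx => <-.
pose s := sgn R (val a) j.
pose t := - (s * q 0 j) / (s * p 0 j - s * q 0 j).
have den : 0 < s * p 0 j - s * q 0 j by rewrite /s; lra.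
have t0 : 0 < t by rewrite divr_gt0 // oppr_gt0.
have t1 : t <= 1 by rewrite ler_pdivrMr // mul1r; rewrite /s; lra.
have alg (s' t' u v : R) : - s' * (u + t' * (v - u)) = - (s' * u + t' * (s' * v - s' * u)).
  by ring.
(* The point of the segment from q to p on the wall j; as it belongs to Delta c,
   xi p cannot exceed xi q. *)
pose z := q + t *: (p - q).
have zD : Delta V (val c) z.
  split; first by apply: VetaD; [case: qD|apply: VetaB; [case: pD|case: qD]].
  move=> i; rewrite !mxE; case: (eqVneq i j) => [->|ij].
    rewrite cjN alg.
    by rewrite -/s /t divfK ?gt_eqF // addrN oppr0.
  rewrite ci //; have := qa i ij; have := pD.2 i; set si := sgn R _ i.
  have -> : si * (q 0 i + t * (p 0 i - q 0 i)) = (1 - t) * (si * q 0 i) + t * (si * p 0 i).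
    by move: si (t : R) (q 0 i) (p 0 i) => s' t' u v; ring.
  by move=> pi qi; apply: addr_ge0; apply: mulr_ge0 => //; lra.
have := qmax z zD; rewrite /z xiDZ gerDl pmulr_rle0 // xiD xiN subr_le0 => le2.
have qp : q = p by apply: eq; apply/eqP; rewrite eq_le le le2.
by move: qneg; rewrite qp ltNge ltW.
Qed.

Variable a : chamber V.
Local Notation x := (bas_of V (val a)).

(** The sets S for which the monomials with support T occur in the row b of the
    summand of the resolution attached to the chamber obtained by flipping S. *)
Definition support_family (b : signvec n) (T : {set 'I_n}) : {set {set 'I_n}} :=
  [set S : {set 'I_n} | [&& S \subset ~: x, [set j in S | b j == val a j] \subset T &
    meets V b (flip (val a) S) T]].

(** The walls that separate the optimal vertex of a from Delta b. *)
Definition facing (b : signvec n) : {set 'I_n} := [set j in ~: x | b j != val a j].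

(** The common points of two chambers form the face of either one on the walls where
    their signs differ; those in S with equal signs of a and b already belong to T. *)
Lemma meets_flip (b : signvec n) (S T : {set 'I_n}) : S \subset ~: x -> [set j in S | b j == val a j] \subset T ->
  meets V b (flip (val a) S) T =
  `[< exists y, Delta V b y /\
        Hset V ([set j in x | b j != val a j] :|: T :|: (facing b :\: S)) y >].
Proof.
move=> /subsetP Sx /subsetP ST; apply/asboolP/asboolP => [[y [yb ya [yV yT]]]|[y [yb [yV yH]]]].
  exists y; split => //; split => // i.
  rewrite !inE => /orP[/orP[/andP[ix ba]|/yT //]|/andP[iS /andP[ix ba]]].
    have iS : i \notin S by apply/negP => /Sx; rewrite inE ix.
    have := yb.2 i; have := ya.2 i; rewrite (sgn_flip (b := b)) ?ffunE ?(negPf iS) ?addbF 1?eq_sym //.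
    by rewrite oppr_ge0 => h1 h2; apply/eqP; rewrite -(sgn_mul_eq0 b i) eq_le h1.
  have := yb.2 i; have := ya.2 i; rewrite (sgn_flip (b := b)) ?ffunE ?(negPf iS) ?addbF 1?eq_sym //.
  by rewrite oppr_ge0 => h1 h2; apply/eqP; rewrite -(sgn_mul_eq0 b i) eq_le h1.
exists y; split => //; last by split => // i iT; apply: yH; rewrite !inE iT orbT.
split => // i; have [e|ne] := eqVneq (flip (val a) S i) (b i).
  by rewrite /sgn e; exact: yb.2.
rewrite yH ?mulr0 // !inE; move: ne; rewrite ffunE.
have := Sx i; have := ST i; rewrite !inE.
by case: (i \in S); case: (i \in x); case: (i \in T); case: (b i); case: (val a i) => //=;
  move=> H1 H2; try (by move: (H1 isT)); try (by move: (H2 isT)).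
Qed.

Lemma support_convex b T : set_convex (support_family b T).
Proof.
move=> S1 S S2; rewrite !inE => /and3P[S1x S1T S1m] /and3P[S2x S2T _] S12 SS2.
have Sx := subset_trans SS2 S2x.
have ST : [set j in S | b j == val a j] \subset T.
  apply: subset_trans S2T; apply/subsetP => j; rewrite !inE => /andP[+ ->].
  by rewrite andbT; exact: (subsetP SS2).
rewrite Sx ST /=; move: S1m; rewrite !meets_flip // => /asboolP[y [yb [yV yH]]].
apply/asboolP; exists y; split => //; split => // i; rewrite !inE => H; apply: yH.
rewrite !inE; case/orP: H => [->//|/andP[iS ->]].
by rewrite andbT (contra (subsetP S12 i) iS) !orbT.
Qed.

(** If T contains an index off the basis of a, adding or removing it does not affect
    membership. Otherwise the family is made of the walls of a face of Delta b that
    are visible from the optimal vertex of a, and the set S shows that there is one. *)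
Lemma support_acyclic b T S (M : zmodType) eps : sign_rule eps ->
  S \in support_family b T -> S != set0 -> acyclic M eps (support_family b T).
Proof.
move=> epsP SG S0.
have [[t tT tx]|nt] := pselect (exists2 t, t \in T & t \notin x).
  apply: (acyclic_toggle epsP (j := t) (@support_convex b T)) => U tU; rewrite !inE.
  have -> : (t |: U \subset ~: x) = (U \subset ~: x) by rewrite subUset sub1set inE tx.
  have [Ux|//] := boolP (U \subset _).
  have tUx : t |: U \subset ~: x by rewrite subUset sub1set inE tx.
  have -> : ([set j in t |: U | b j == val a j] \subset T) =
      ([set j in U | b j == val a j] \subset T).
    apply/subsetP/subsetP => H j; rewrite !inE => /andP[jU jb].
      by apply: H; rewrite !inE jU orbT.
    by case/orP: jU => [/eqP -> //|jU]; apply: H; rewrite !inE jU.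
  have [UT|//] := boolP ([set j in U | b j == val a j] \subset T).
  have tUT : [set j in t |: U | b j == val a j] \subset T.
    apply/subsetP => j; rewrite !inE => /andP[/orP[/eqP ->//|jU] jb].
    by apply: (subsetP UT); rewrite !inE jU.
  rewrite /= !meets_flip //; congr `[< _ >]; apply/propext.
  have E : [set j in x | b j != val a j] :|: T :|: (facing b :\: (t |: U)) =
      [set j in x | b j != val a j] :|: T :|: (facing b :\: U).
    by apply/setP => j; rewrite !inE; case: (eqVneq j t) => [->|//]; rewrite tT !orbT.
  by rewrite E.
have Tx t : t \in T -> t \in x by move=> tT; apply: contrapT => /negP tx; apply: nt; exists t.
have E : support_family b T =
    wall_family V b ([set j in x | b j != val a j] :|: T) set0 (facing b).
  apply/setP => U; rewrite !inE sub0set set0U /=.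
  have sub : (U \subset ~: x) && ([set j in U | b j == val a j] \subset T) =
      (U \subset facing b).
    apply/andP/subsetP => [[/subsetP Ux /subsetP UT] j jU|H].
      rewrite !inE; have := Ux j jU; rewrite inE => jx; rewrite jx /=.
      apply/negP => bj; have : j \in T by apply: UT; rewrite inE jU.
      by move=> /Tx; rewrite (negPf jx).
    split; apply/subsetP => j; first by move=> /H; rewrite !inE => /andP[].
    by rewrite inE => /andP[/H]; rewrite !inE => /andP[_ /negPf ->].
  rewrite -sub -andbA; case: (boolP (U \subset ~: x)) => //= Ux.
  by case: (boolP (_ \subset T)) => //= UT; rewrite meets_flip.
have [p [Hp pD _ pn]] := chamber_vertex (valP a).
rewrite E; apply: (visible_acyclic epsP (p := p)).
- by case: Hp.
- move=> i; rewrite !inE => /orP[/andP[ix _]|/Tx ix]; exact: Hp.2.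
- by rewrite -setI_eq0 set0I.
- move=> i neg; rewrite !inE.
  have ix : i \notin x by apply: contraTN neg => ix; rewrite (Hp.2 i ix) mulr0 ltxx.
  rewrite ix /=; apply: contraTneq neg => bi.
  by rewrite /sgn bi -leNgt; exact: pD.2.
- move=> i; rewrite !inE => /andP[ix ba]; rewrite (sgn_flip _ ba) oppr_le0; exact: pD.2.
- move: SG; rewrite E !inE sub0set set0U /= => /andP[/subsetP SD _].
  have /set0Pn[i /SD] := S0; rewrite !inE => /andP[ix ba]; exists i.
  by rewrite (sgn_flip _ ba) oppr_lt0; exact: pn.
Qed.

End Flips.

(** * Projective modules generated by idempotents *)

Section IdempotentSum.
Variables (A : grRing) (I : finType) (s : int).

Definition tuples : Type := {ffun I -> A^o}.
HB.instance Definition _ := GRing.Zmodule.on tuples.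
HB.instance Definition _ := GRing.Lmodule.on tuples.

Definition tuples_deg (m : int) (f : tuples) : Prop := forall i, gr_deg (m - s) (f i : A).

Let GA := gr_grading A.

Lemma tuples_sumE (J : Type) (r : seq J) (P : pred J) (F : J -> tuples) i :
  (\sum_(j <- r | P j) F j) i = \sum_(j <- r | P j) (F j i : A).
Proof. exact: sum_ffunE. Qed.

Definition tuples_hc (f : tuples) (m : int) : tuples := [ffun i => hc GA (f i) (m - s)].

Lemma tuples_hdecomp f : hdecomp tuples_deg f (tuples_hc f).
Proof.
split; first by move=> m i; rewrite ffunE; exact: hc_deg.
pose t := undup (flatten [seq [seq j + s | j <- hsupp GA (f i)] | i <- enum I]).
have tP m i : m \notin t -> hc GA (f i) (m - s) = 0.
  rewrite mem_undup => mt; apply: hsuppN; apply: contra mt => mt.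
  apply/flattenP; exists [seq j + s | j <- hsupp GA (f i)].
    by apply: (map_f (fun i => [seq j + s | j <- hsupp GA (f i)])); rewrite mem_enum.
  by apply/mapP; exists (m - s) => //; rewrite subrK.
exists t; split; first exact: undup_uniq.
  by move=> m mt; apply/ffunP => i; rewrite !ffunE tP.
apply/ffunP => i; rewrite tuples_sumE; under eq_bigr do rewrite ffunE.
rewrite [LHS](@hc_sumE _ _ GA _ [seq m - s | m <- t]).
- by rewrite big_map.
- by rewrite map_inj_uniq ?undup_uniq //; exact: addIr.
- move=> m mt; rewrite -[m](addrK s); apply: tP; apply: contra mt => mt.
  by apply/mapP; exists (m + s) => //; rewrite addrK.
Qed.

Fact tuples_grading : is_grading tuples_deg.
Proof.
apply: is_gradingI => [m|f|h [Dh [r [ur hr xr]]] m].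
- split; first by move=> i; rewrite ffunE; exact: (grading0 GA).
  by move=> f g df dg i; rewrite !ffunE; apply: (gradingB GA).
- by exists (tuples_hc f); exact: tuples_hdecomp.
- apply/ffunP => i; rewrite ffunE.
  have E : hdecomp (@gr_deg A) 0 (fun m => h (m + s) i : A).
    split; first by move=> j; have := Dh (j + s) i; rewrite addrK.
    exists [seq j - s | j <- r]; split.
    + by rewrite map_inj_uniq //; exact: addIr.
    + move=> j jr; rewrite hr ?ffunE //; apply: contra jr => jr.
      by apply/mapP; exists (j + s) => //; rewrite addrK.
    + rewrite big_map; under eq_bigr do rewrite subrK.
      by have := congr1 (fun f : tuples => f i) xr; rewrite tuples_sumE ffunE.
  have /(congr1 (fun f => f (m - s))) := hc_uniq GA E.
  by rewrite subrK hc0.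
Qed.

Fact tuples_scale i j (a : A) (f : tuples) :
  gr_deg i a -> tuples_deg j f -> tuples_deg (i + j) (a *: f).
Proof. by move=> da df l; rewrite ffunE -addrA; exact: gr_mul. Qed.

Definition gtuples : grMod A :=
  @GrMod A (tuples : lmodType A) tuples_deg tuples_grading tuples_scale.

Variable e : I -> A.
Hypothesis e0 : forall i, gr_deg 0 (e i).

Definition idem_pred (f : gtuples) : Prop :=
  forall i, ((f : tuples) i : A) * e i = (f : tuples) i.

Fact idem_zero : idem_pred 0.
Proof. by move=> i; rewrite ffunE mul0r. Qed.

Fact idem_lin (a : A) (f g : gtuples) : idem_pred f -> idem_pred g -> idem_pred (a *: f + g).
Proof.
move=> Hf Hg i; rewrite !ffunE mulrDl Hg.
by congr (_ + _); rewrite -[in RHS](Hf i); exact/esym/mulrA.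
Qed.

Definition idem_sub : submodule gtuples := Submodule idem_zero idem_lin.

Fact idem_hom f h : idem_sub f -> hdecomp (@gm_deg _ gtuples) f h -> forall m, idem_sub (h m).
Proof.
move=> Hf /(hc_uniq (gm_grading gtuples)) -> m.
have <- := hc_uniq (gm_grading gtuples) (tuples_hdecomp f).
move=> i; rewrite ffunE; have := @hc_mulr A 0 (f i) (e i) (m - s) (e0 i).
by rewrite subr0 => <-; rewrite (Hf i).
Qed.

(** For idempotents e i this is the direct sum of the projective modules A (e i), with
    generators in degree s. *)
Definition idem_mod : grMod A := gsub (HSubmodule idem_hom).

Definition tcoord (x : idem_mod) (i : I) : A := (val x : tuples) i.

Lemma tcoord_idem (x : idem_mod) i : tcoord x i * e i = tcoord x i.
Proof. exact: smP x i. Qed.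

Lemma tcoord_inj (x y : idem_mod) : (forall i, tcoord x i = tcoord y i) -> x = y.
Proof. by move=> H; apply: val_inj; apply/ffunP. Qed.

Lemma tcoord_lin (a : A) (x y : idem_mod) i : tcoord (a *: x + y) i = a * tcoord x i + tcoord y i.
Proof. by rewrite /tcoord smvD smvZ !ffunE. Qed.

Lemma tcoordB (x y : idem_mod) i : tcoord (x - y) i = tcoord x i - tcoord y i.
Proof. by rewrite /tcoord smvB !ffunE. Qed.

Lemma tcoord0 i : tcoord 0 i = 0.
Proof. by rewrite /tcoord smv0 ffunE. Qed.

Lemma tcoord_deg m (x : idem_mod) : gm_deg m x <-> forall i, gr_deg (m - s) (tcoord x i).
Proof. by []. Qed.

Definition of_tcoord (f : I -> A) (Hf : forall i, f i * e i = f i) : idem_mod :=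
  smk (N := idem_sub) (fun i => etrans (congr1 (fun z : A => z * e i) (ffunE f i))
    (etrans (Hf i) (esym (ffunE f i))) : ((finfun f : tuples) i : A) * e i = (finfun f : tuples) i).

Lemma tcoord_of (f : I -> A) (Hf : forall i, f i * e i = f i) i : tcoord (of_tcoord Hf) i = f i.
Proof. by rewrite /tcoord /= ffunE. Qed.

Hypothesis ee : forall i, e i * e i = e i.

Fact gen_subproof i j : (if j == i then e i else 0) * e j = if j == i then e i else 0.
Proof. by case: eqP => [->|_]; rewrite ?ee ?mul0r. Qed.

Definition gen i : idem_mod := of_tcoord (gen_subproof i).

Lemma gen_deg i : gm_deg s (gen i).
Proof.
apply/tcoord_deg => j; rewrite tcoord_of subrr; case: eqP => // _; exact: (grading0 GA).
Qed.

Lemma gen_sum (x : idem_mod) : x = \sum_i tcoord x i *: gen i.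
Proof.
apply: tcoord_inj => j; rewrite /tcoord smv_sum tuples_sumE.
under eq_bigr do rewrite smvZ ffunE -/(tcoord _ _).
rewrite (bigD1 j) //= big1 ?addr0.
  have -> : ((val (gen j) : tuples) j) = e j by have := tcoord_of (gen_subproof j) j; rewrite eqxx.
  exact/esym/tcoord_idem.
move=> i ij; have -> : ((val (gen i) : tuples) j) = 0.
  by have := tcoord_of (gen_subproof i) j; rewrite eq_sym (negPf ij).
exact: mulr0.
Qed.

Lemma gen_idem i : e i *: gen i = gen i.
Proof.
apply: tcoord_inj => j; rewrite -[X in tcoord X]addr0 tcoord_lin tcoord0 addr0 !tcoord_of.
by case: eqP; rewrite ?ee ?mulr0.
Qed.

Section Extend.
Variables (M : grMod A) (b : I -> M).
Definition extend (x : idem_mod) : M := \sum_i tcoord x i *: b i.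

Lemma extend_lin (a : A) x y : extend (a *: x + y) = a *: extend x + extend y.
Proof.
rewrite scaler_sumr -big_split; apply: eq_bigr => i _ /=.
by rewrite tcoord_lin scalerDl scalerA.
Qed.

Lemma extend_gen i : extend (gen i) = e i *: b i.
Proof.
rewrite /extend (bigD1 i) //= big1 ?addr0; first by rewrite tcoord_of eqxx.
by move=> j ji; rewrite tcoord_of (negPf ji) scale0r.
Qed.

Lemma extend_ghom d : (forall i, gm_deg (s + d) (b i)) -> is_ghom d extend.
Proof.
move=> bP; split; first exact: extend_lin.
move=> j x dx; apply: grading_sum; first exact: gm_grading.
move=> i _; have := gm_scale (dx i) (bP i).
by rewrite addrA subrK.
Qed.
End Extend.

Lemma idem_mod_projective : gprojective idem_mod.
Proof.
move=> M N p f Hp sp Hf.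
have /choice[b bP] : forall i, exists x : M, gm_deg s x /\ p x = f (gen i).
  move=> i; have [x px] := sp (f (gen i)).
  exists (hc (gm_grading M) x s); split; first exact: hc_deg.
  rewrite (ghom_hc Hp) px addr0; have := Hf.2 _ _ (gen_deg i); rewrite addr0.
  by move=> D; rewrite (hc_hom _ _ D) eqxx.
exists (extend b); split.
  by apply: extend_ghom => i; rewrite addr0; case: (bP i).
move=> x; rewrite [in RHS](gen_sum x) (ghom_sum Hf) (ghom_sum Hp).
by apply: eq_bigr => i _; rewrite (ghomZ Hf) (ghomZ Hp) (bP i).2.
Qed.

End IdempotentSum.

(** * The resolution of a standard module *)

Section Resolution.
Variables (R : realType) (n k : nat) (V : polarized R n k) (a : chamber V).
Local Notation Zu := {mpoly int[n]}.
Local Notation B := (Btilde V).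
Local Notation x := (bas_of V (val a)).
Local Notation fl := (flip (val a)).
Local Notation fam := (support_family a).
Local Notation eps := (@std_sign n).
Implicit Types (S T : {set 'I_n}) (z : Btilde V).

Definition flip_chamber S : option (chamber V) := insub (fl S).

Lemma flip_chamberP S c : flip_chamber S = Some c -> val c = fl S.
Proof. by rewrite /flip_chamber; case: insubP => // c' _ <- [<-]. Qed.

Lemma flip_chamber0 : flip_chamber set0 = Some a.
Proof. by rewrite /flip_chamber flip0 valK. Qed.

(** Flipping signs off the basis preserves boundedness, so that a flip which is not a
    chamber is infeasible. *)
Lemma flip_chamberN S b T : S \subset ~: x -> flip_chamber S = None -> meets V b (fl S) T = false.
Proof.
move=> Sx; rewrite /flip_chamber; case: insubP => // /negP nP _.
by apply/negP => /(meets_Pset (flip_bounded (valP a) Sx)).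
Qed.

Definition flip_gen S T : B :=
  if (flip_chamber S, flip_chamber T) is (Some c, Some d) then fgen c d else 0.

(** Zero for the sets that do not contribute, so that all terms of the resolution are
    indexed by the same type. *)
Definition summand (m : nat) S : B :=
  if (#|S| == m) && (S \subset ~: x) then flip_gen S S else 0.

Lemma flip_gen_idem S T : flip_gen S T * flip_gen T T = flip_gen S T.
Proof.
rewrite /flip_gen; case: (flip_chamber S) => [c|]; case: (flip_chamber T) => [d|] //;
  rewrite ?mul0r ?mulr0 //; exact: fgen_egen.
Qed.

Lemma summand_idem m S : summand m S * summand m S = summand m S.
Proof. by rewrite /summand; case: ifP; rewrite ?flip_gen_idem ?mul0r. Qed.

Lemma summand_deg m S : gr_deg 0 (summand m S).
Proof.
rewrite /summand /flip_gen; case: ifP => _; last exact: grading0 (gr_grading B) _.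
by case: (flip_chamber S) => [c|]; [exact: egen_deg|exact: grading0 (gr_grading B) _].
Qed.

Definition res_term (m : nat) : grMod B := idem_mod m%:Z (summand_deg m).

Lemma tcoord_summand0 m (y : res_term m) S : ~~ ((#|S| == m) && (S \subset ~: x)) -> tcoord y S = 0.
Proof. by move=> /negPf vS; rewrite -tcoord_idem /summand vS mulr0. Qed.

Definition res_diff_fun m (y : res_term m.+1) S : B :=
  \sum_(j | j \notin S) signed (eps j S) (tcoord y (j |: S) * flip_gen (j |: S) S).

Lemma mul_signed (s : bool) (u v : B) : signed s u * v = signed s (u * v).
Proof. by case: s; rewrite /signed ?mulNr. Qed.
Lemma signed_mul (s : bool) (u v : B) : u * signed s v = signed s (u * v).
Proof. by case: s; rewrite /signed ?mulrN. Qed.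

Lemma res_diff_idem m (y : res_term m.+1) S : res_diff_fun y S * summand m S = res_diff_fun y S.
Proof.
rewrite /res_diff_fun mulr_suml; apply: eq_bigr => j jS; rewrite mul_signed -mulrA.
congr (signed _ _); rewrite /summand; case: ifP => vS; first by rewrite flip_gen_idem.
rewrite tcoord_summand0 ?mul0r // cardsU1 jS eqSS subUset negb_and.
by move: vS => /negbT; rewrite !negb_and => /orP[->//|->]; rewrite !orbT.
Qed.

Definition res_diff m (y : res_term m.+1) : res_term m :=
  of_tcoord _ (summand_deg m) (res_diff_idem y).

Lemma tcoord_diff m (y : res_term m.+1) S : tcoord (res_diff y) S = res_diff_fun y S.
Proof. exact: tcoord_of. Qed.

Lemma flip_gen_deg j S : j \notin S -> gr_deg 1 (flip_gen (j |: S) S).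
Proof.
move=> jS; rewrite /flip_gen.
case Ec: (flip_chamber (j |: S)) => [c|]; last exact: grading0 (gr_grading B) _.
case Ed: (flip_chamber S) => [d|]; last exact: grading0 (gr_grading B) _.
have := fgen_deg c d; rewrite (flip_chamberP Ec) (flip_chamberP Ed).
suff -> : sdist (fl (j |: S)) (fl S) = 1%N by [].
rewrite /sdist (_ : [set i | _] = [set j]) ?cards1 //.
apply/setP => i; rewrite !inE !ffunE !inE; case: (eqVneq i j) => [->|_] /=.
  by rewrite (negPf jS) addbF addbT; case: (val a j).
by rewrite eqxx.
Qed.

Lemma res_diff_ghom m : is_ghom 0 (@res_diff m).
Proof.
split=> [c y y'|t y dy].
  apply: tcoord_inj => S; rewrite tcoord_lin !tcoord_diff /res_diff_fun mulr_sumr -big_split.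
  by apply: eq_bigr => j _ /=; rewrite tcoord_lin mulrDl signedD signed_mul mulrA.
apply/tcoord_deg => S; rewrite tcoord_diff addr0 /res_diff_fun.
apply: (grading_sum (gr_grading B)) => j jS.
have D : gr_deg (t - m%:Z) (tcoord y (j |: S) * flip_gen (j |: S) S).
  have := gr_mul (dy (j |: S)) (flip_gen_deg jS).
  suff -> : t - m.+1%:Z + 1 = t - m%:Z by [].
  by rewrite -addn1 PoszD opprD addrA subrK.
by case: (eps j S) => //; exact: gradingN (gr_grading B) _ _ D.
Qed.

Definition flip_entry (b : chamber V) S z : Zu :=
  if flip_chamber S is Some c then entry b c z else 0.

Lemma flip_entry_signed b S s z : flip_entry b S (signed s z) = signed s (flip_entry b S z).
Proof.
by rewrite /flip_entry; case: (flip_chamber S) => [c|]; [exact: entry_signed|rewrite signed0].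
Qed.

Lemma flip_entry_sum b S (I : Type) (r : seq I) (P : pred I) (F : I -> B) :
  flip_entry b S (\sum_(i <- r | P i) F i) = \sum_(i <- r | P i) flip_entry b S (F i).
Proof.
rewrite /flip_entry; case: (flip_chamber S) => [c|]; first exact: entry_sum.
by rewrite big1.
Qed.

Lemma flip_entryB b S z z' : flip_entry b S (z - z') = flip_entry b S z - flip_entry b S z'.
Proof.
by rewrite /flip_entry; case: (flip_chamber S) => [c|]; [exact: entryB|rewrite subr0].
Qed.

Lemma flip_entry0 b S : flip_entry b S 0 = 0.
Proof. by rewrite /flip_entry; case: (flip_chamber S) => // c; exact: entry0. Qed.

Lemma flip_entry_mul b S T z : T \subset ~: x -> flip_entry b T (z * flip_gen S T) =
  sfilter (meets V (val b) (fl T)) (umon (sset (val b) (fl S) (fl T)) * flip_entry b S z).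
Proof.
move=> Tx; rewrite /flip_entry /flip_gen.
case Ed: (flip_chamber T) => [d|]; last first.
  by rewrite (eq_sfilter (Q := fun=> false)) ?sfilter_false // => U; exact: flip_chamberN.
case Ec: (flip_chamber S) => [c|]; last by rewrite mulr0 entry0 mulr0 sfilter0.
by rewrite entry_mul_fgen eqxx (flip_chamberP Ec) (flip_chamberP Ed).
Qed.

Definition same_signs (b : chamber V) S : {set 'I_n} := [set j in S | val b j == val a j].

(** The monomial u_S' with S' = same_signs b S places the generator of the summand
    S in the right multidegree: after multiplication by it, the differential on
    each row becomes, on the monomials of a given support, the signed sum
    that defines [bd]. *)
Definition shifted_entry b S z : Zu := umon (same_signs b S) * flip_entry b S z.

(** Common points of Delta b and of the flipped chamber lie on the walls in
    [same_signs b S], so multiplying by their monomial does not affect the relations. *)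
Lemma umon_meets b S (p : Zu) : S \subset ~: x ->
  umon (same_signs b S) * sfilter (meets V (val b) (fl S)) p =
  sfilter (fun T => S \in fam (val b) T) (umon (same_signs b S) * p).
Proof.
move=> Sx; apply: sfilter_umon => T; rewrite inE Sx subsetUr /=.
apply/idP/idP; last by apply: meetsS; exact: subsetUl.
move=> /asboolP[y [yb ya [yV yT]]]; apply/asboolP; exists y; split => //; split => // i.
rewrite !inE => /orP[/yT //|/andP[iS /eqP ba]].
have := ya.2 i; have := yb.2 i; rewrite [X in _ -> 0 <= X -> _](sgn_flip (b := val b)).
  by rewrite oppr_ge0 => h1 h2; apply/eqP; rewrite -(sgn_mul_eq0 (val b) i) eq_le h1 h2.
by rewrite ffunE iS ba addbT; case: (val a i).
Qed.

Lemma shifted_entry_filter b S z : S \subset ~: x ->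
  sfilter (fun T => S \in fam (val b) T) (shifted_entry b S z) = shifted_entry b S z.
Proof.
move=> Sx; rewrite /shifted_entry -umon_meets // /flip_entry.
case Ec: (flip_chamber S) => [c|]; last by rewrite sfilter0.
by rewrite -(flip_chamberP Ec) entry_nf.
Qed.

Lemma shifted_entry_mul b S j z : j \notin S -> j |: S \subset ~: x ->
  shifted_entry b S (z * flip_gen (j |: S) S) =
  sfilter (fun T => S \in fam (val b) T) (shifted_entry b (j |: S) z).
Proof.
move=> jS; rewrite subUset sub1set inE => /andP[jx Sx].
rewrite /shifted_entry flip_entry_mul // umon_meets // mulrA umonU; last first.
  rewrite -setI_eq0; apply/eqP/setP => i; rewrite !inE !ffunE !inE.
  case: (eqVneq i j) => [->|_] /=; first by rewrite (negPf jS).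
  by rewrite eqxx !andbF.
congr (sfilter _ (umon _ * _)); apply/setP => i; rewrite !inE !ffunE !inE.
case: (eqVneq i j) => [->|_] /=.
  by rewrite (negPf jS); case: (val b j); case: (val a j).
by rewrite eqxx andbF orbF.
Qed.

Definition res_part b T m (y : res_term m) S : Zu :=
  sfilter (pred1 T) (shifted_entry b S (tcoord y S)).

Lemma shifted_entry0 b S : shifted_entry b S 0 = 0.
Proof. by rewrite /shifted_entry flip_entry0 mulr0. Qed.

Lemma res_partB b T m (y y' : res_term m) S : res_part b T (y - y') S = res_part b T y S - res_part b T y' S.
Proof. by rewrite /res_part tcoordB /shifted_entry flip_entryB mulrBr sfilterB. Qed.

Lemma res_part_valid b T m (y : res_term m) S :
  ~~ ((#|S| == m) && (S \subset ~: x)) -> res_part b T y S = 0.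
Proof. by move=> vS; rewrite /res_part tcoord_summand0 // shifted_entry0 sfilter0. Qed.

Lemma res_part_supported b T m (y : res_term m) : supported (fam (val b) T) (res_part b T y).
Proof.
move=> S SG; have [/andP[_ Sx]|] := boolP ((#|S| == m) && (S \subset ~: x)); last exact: res_part_valid.
rewrite /res_part -shifted_entry_filter // sfilter_sfilter.
rewrite (eq_sfilter (Q := fun=> false)) ?sfilter_false // => U /=.
by case: eqP => // ->; rewrite (negPf SG).
Qed.

Lemma res_part_diff b T m (y : res_term m.+1) S : res_part b T (res_diff y) S =
  if S \in fam (val b) T then bd eps (res_part b T y) S else 0.
Proof.
case: ifPn => SG; last exact: res_part_supported.
have Sx : S \subset ~: x by move: SG; rewrite inE => /and3P[].
rewrite /res_part tcoord_diff /res_diff_fun /shifted_entry flip_entry_sum mulr_sumr sfilter_sum.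
apply: eq_bigr => j jS; rewrite flip_entry_signed.
have -> s (u v : Zu) : u * signed s v = signed s (u * v) by case: s; rewrite /signed ?mulrN.
rewrite sfilter_signed; congr (signed _ _); rewrite -!/(shifted_entry _ _ _).
have [jSx|jSx] := boolP (j |: S \subset ~: x); last first.
  by rewrite tcoord_summand0 ?(negPf jSx) ?andbF // mul0r !shifted_entry0.
rewrite shifted_entry_mul // sfilter_sfilter; apply: eq_sfilter => U /=.
by case: eqP => // ->; rewrite SG.
Qed.

Lemma res_part_inj m (y : res_term m) : (forall b T S, res_part b T y S = 0) -> y = 0.
Proof.
move=> H; apply: tcoord_inj => S; rewrite tcoord0; apply: entry_eq0 => b d.
have [/andP[Sm Sx]|vS] := boolP ((#|S| == m) && (S \subset ~: x)); last first.
  by rewrite tcoord_summand0 // entry0.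
have : shifted_entry b S (tcoord y S) = 0.
  by rewrite [LHS]sfilter_supp_sum big1 // => T _; exact: H.
move=> /eqP; rewrite mulf_eq0 (negPf (umon_neq0 _)) /= => /eqP.
rewrite -tcoord_idem /summand Sm Sx /flip_entry /flip_gen /=.
case: (flip_chamber S) => [c|]; last by rewrite mulr0 entry0.
by rewrite !entry_mul_egen eqxx; case: eqP => // ->.
Qed.

(** For S in the family the support T contains [same_signs b S], so the prescribed
    polynomials can be divided by the corresponding monomial. *)
Lemma res_part_exists m (g : chamber V -> {set 'I_n} -> {set 'I_n} -> Zu) :
  (forall b T, supported (fam (val b) T) (g b T)) ->
  exists y : res_term m, forall b T S,
    res_part b T y S = if #|S| == m then sfilter (pred1 T) (g b T S) else 0.
Proof.
move=> gS.
have famS b T S : g b T S != 0 -> S \in fam (val b) T.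
  by apply: contraNT => /gS ->.
have /choice[w wP] : forall p : chamber V * {set 'I_n}, exists w : Zu,
    umon (same_signs p.1 p.2) * w = \sum_T sfilter (pred1 T) (g p.1 T p.2).
  move=> [b S] /=; apply: umon_div; rewrite sfilter_sum; apply: eq_bigr => T _.
  rewrite sfilter_sfilter; have [->|/famS] := eqVneq (g b T S) 0; first by rewrite !sfilter0.
  rewrite inE => /and3P[_ ST _]; apply: eq_sfilter => U /=.
  by case: eqP => [->|_]; rewrite ?andbF ?andbT.
pose val_at S : B := if (#|S| == m) && (S \subset ~: x) then
  if flip_chamber S is Some c then
    of_entries (fun b d => if d == c then w (b, S) else 0) else 0 else 0.
have val_idem S : val_at S * summand m S = val_at S.
  rewrite /val_at /summand /flip_gen; case: ifP => _; last by rewrite mul0r.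
  case: (flip_chamber S) => [c|]; last by rewrite mul0r.
  by apply: egen_entry => b d dc; rewrite entry_of (negPf dc) sfilter0.
exists (of_tcoord _ (summand_deg m) val_idem) => b T S; rewrite /res_part tcoord_of /val_at.
case: (eqVneq #|S| m) => [Sm|_] /=; last by rewrite shifted_entry0 sfilter0.
have [Sx|Sx] := boolP (S \subset ~: x); last first.
  rewrite shifted_entry0 (gS b T S) ?sfilter0 // inE negb_and Sx //.
have inv T' : S \in fam (val b) T' -> exists c, flip_chamber S = Some c.
  rewrite inE => /and3P[_ _]; case E: (flip_chamber S) => [c|]; first by exists c.
  by rewrite flip_chamberN.
case Ec: (flip_chamber S) => [c|]; last first.
  rewrite shifted_entry0 (gS b T S) ?sfilter0 //; apply/negP => /inv[c].
  by rewrite Ec.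
rewrite /shifted_entry /flip_entry Ec entry_of eqxx (flip_chamberP Ec) umon_meets //.
rewrite (wP (b, S)) /= sfilter_sfilter sfilter_sum (bigD1 T) //= big1 ?addr0.
  rewrite sfilter_sfilter; have [->|/famS SG] := eqVneq (g b T S) 0; first by rewrite !sfilter0.
  by apply: eq_sfilter => U /=; case: eqP => [->|]; rewrite ?andbF ?SG.
move=> T' T'T; rewrite sfilter_sfilter (eq_sfilter (Q := fun=> false)) ?sfilter_false //.
by move=> U /=; case: (eqVneq U T) => //= ->; rewrite [T == T']eq_sym (negPf T'T) andbF.
Qed.

(** Exactness, reduced to the acyclicity of the families of subsets: the only
    families that are not acyclic consist of the empty set alone. *)
Lemma res_exact_of_parts m (y : res_term m) :
  (forall b T S, S \in fam (val b) T -> bd eps (res_part b T y) S = 0) ->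
  (forall b T, (forall S, S \in fam (val b) T -> S = set0) -> res_part b T y set0 = 0) ->
  exists y', res_diff y' = y.
Proof.
move=> cyc exc.
have /choice[g gP] : forall p : chamber V * {set 'I_n}, exists g : {set 'I_n} -> Zu,
    supported (fam (val p.1) p.2) g /\
    forall S, S \in fam (val p.1) p.2 -> bd eps g S = res_part p.1 p.2 y S.
  move=> [b T] /=.
  have [[S SG S0]|nS] := pselect (exists2 S, S \in fam (val b) T & S != set0).
    apply: (support_acyclic (@std_signP n) SG S0); first exact: res_part_supported.
    exact: cyc.
  have only S : S \in fam (val b) T -> S = set0.
    by move=> SG; apply/eqP/negPn/negP => S0; apply: nS; exists S.
  exists (fun=> 0); split => // S SG; rewrite bd_eq0 // (only S SG).
  exact/esym/exc.
have [|y' y'P] := @res_part_exists m.+1 (fun b T => g (b, T)).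
  by move=> b T; case: (gP (b, T)).
exists y'; apply/eqP; rewrite -subr_eq0; apply/eqP/res_part_inj => b T S.
rewrite res_partB res_part_diff; case: ifPn => SG; last by rewrite res_part_supported ?subrr.
have [_ /(_ S SG) gd] := gP (b, T).
have [Sm|Sm] := eqVneq #|S| m; last first.
  rewrite [res_part b T y S]res_part_valid ?(negPf Sm) // subr0; apply: bd_eq0 => j jS.
  by rewrite y'P cardsU1 jS eqSS (negPf Sm).
have -> : res_part b T y S = sfilter (pred1 T) (bd eps (g (b, T)) S).
  by rewrite gd /res_part sfilter_sfilter; apply: eq_sfilter => U /=; rewrite andbb.
apply/eqP; rewrite subr_eq0 /bd sfilter_sum; apply/eqP/eq_bigr => j jS.
by rewrite y'P cardsU1 jS eqSS Sm eqxx sfilter_signed.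
Qed.

Lemma res_diff_diff m (y : res_term m.+2) : res_diff (res_diff y) = 0.
Proof.
apply: res_part_inj => b T S; rewrite res_part_diff; case: ifPn => // SG.
rewrite -[RHS](bd_bdG (@std_signP n) (@support_convex _ _ _ _ a (val b) T)
  (@res_part_supported b T _ y) SG).
by apply: bd_ext => j _; rewrite res_part_diff.
Qed.

Lemma res_diff_exact m (y : res_term m.+1) :
  res_diff y = 0 <-> exists y', res_diff y' = y.
Proof.
split=> [dy|[y' <-]]; last exact: res_diff_diff.
apply: res_exact_of_parts => [b T S SG|b T _]; last first.
  by rewrite res_part_valid // cards0.
have := res_part_diff b T y S; rewrite SG dy => <-.
by rewrite /res_part tcoord0 shifted_entry0 sfilter0.
Qed.

Lemma family_flip1 b T j : set0 \in fam b T -> j \notin x -> (j \in T) || (b j != val a j) ->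
  [set j] \in fam b T.
Proof.
rewrite !inE flip0 sub1set inE => /and3P[_ _ /asboolP[y [yb ya [yV yT]]]] jx jT.
rewrite jx /=; apply/andP; split.
  by apply/subsetP => i; rewrite !inE => /andP[/eqP -> e]; move: jT; rewrite e orbF.
apply/asboolP; exists y; split => //; split => // i; rewrite /sgn ffunE inE.
have [->|ij] := eqVneq i j; last by rewrite addbF; exact: ya.2.
suff -> : y 0 j = 0 by rewrite mulr0.
case/orP: jT => [/yT //|ba]; have := ya.2 j; have := yb.2 j; rewrite (sgn_flip _ ba) oppr_ge0.
by move=> h1 h2; apply/eqP; rewrite -(sgn_mul_eq0 (val a) j) eq_le h1 h2.
Qed.

(** The exceptional families {set0} occur for the rows b which agree with a off the
    basis and for the monomials in the variables of the basis. *)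
Lemma res_exact_start (y : res_term 0) :
  (forall b : chamber V, (forall i, i \notin x -> val b i = val a i) ->
     set_zero x (entry b a (tcoord y set0)) = 0) -> exists y', res_diff y' = y.
Proof.
move=> H; apply: res_exact_of_parts => [b T S SG|b T only].
  apply: bd_eq0 => j jS; apply: res_part_valid.
  by rewrite cardsU1 jS.
have [G0|G0] := boolP (set0 \in fam (val b) T); last exact: res_part_supported.
have no j : j \notin x -> ~~ ((j \in T) || (val b j != val a j)).
  move=> jx; apply/negP => /(family_flip1 G0 jx)/only/setP/(_ j).
  by rewrite !inE eqxx.
have Tx : T \subset x.
  apply/subsetP => j jT; apply/negPn/negP => /no; by rewrite jT.
have ba i : i \notin x -> val b i = val a i.
  by move=> /no; rewrite negb_or negbK => /andP[_ /eqP].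
rewrite /res_part /shifted_entry /flip_entry flip_chamber0.
have -> : same_signs b set0 = set0 by apply/setP => j; rewrite !inE.
rewrite /umon big_set0 mul1r; have := H b ba; rewrite set_zero_sfilter.
move=> /(congr1 (sfilter (pred1 T))); rewrite sfilter0 sfilter_sfilter => <-.
by apply: eq_sfilter => U /=; case: eqP => // ->; rewrite Tx.
Qed.

Fact lift0_subproof (z : projective_mod a) S :
  (if S == set0 then val z : B else 0) * summand 0 S = if S == set0 then val z : B else 0.
Proof.
case: eqP => [->|_]; last by rewrite mul0r.
rewrite /summand cards0 eqxx sub0set /= /flip_gen flip_chamber0.
by have [c ->] := smP z; rewrite -mulrA -/(egen a) egen_idem.
Qed.

Definition lift0 (z : projective_mod a) : res_term 0 :=
  of_tcoord _ (summand_deg 0) (lift0_subproof z).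

Lemma aug_subproof (y : res_term 0) : proj_sub a (tcoord y set0).
Proof.
exists (tcoord y set0); rewrite -[LHS]tcoord_idem /summand cards0 eqxx sub0set /=.
by rewrite /flip_gen flip_chamber0.
Qed.

Definition res_term0_proj (y : res_term 0) : projective_mod a := smk (aug_subproof y).

Lemma lift0K (z : projective_mod a) : res_term0_proj (lift0 z) = z.
Proof. by apply: val_inj; rewrite /= tcoord_of eqxx. Qed.

(** The differential out of degree one only involves chambers obtained from a by
    crossing a single wall, and these are smaller than a. *)
Lemma lower_diff (y : res_term 1) : lower a (res_term0_proj (res_diff y)).
Proof.
pose u j : B := signed (eps j set0) (tcoord y (j |: set0)).
have -> : res_term0_proj (res_diff y) =
    \sum_(j in 'I_n) smk (N := proj_sub a) (proj_intro a (u j * flip_gen (j |: set0) set0)).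
  apply: val_inj; rewrite smv_sum [LHS]tcoord_diff.
  apply: eq_big => [j|j _]; first by rewrite inE.
  rewrite /= /u mul_signed mul_signed; congr (signed _ _).
  rewrite -mulrA; congr (_ * _); rewrite /flip_gen flip_chamber0.
  by case: (flip_chamber _) => [c|]; rewrite ?mul0r // fgen_egen.
apply: sm_sum => j _; rewrite setU0.
case Ec: (flip_chamber [set j]) => [c|]; last first.
  exists [::]; split => //; rewrite big_nil /= /flip_gen Ec mulr0 mul0r //.
have [jx|jx] := boolP (j \in x).
  exists [::]; split => //; rewrite big_nil /= /u setU0 tcoord_summand0.
    by rewrite signed0 !mul0r.
  by rewrite sub1set inE jx andbF.
have E : u j * flip_gen [set j] set0 = u j * egen c * fgen c a.
  rewrite /flip_gen Ec flip_chamber0; congr (_ * _).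
  rewrite /u setU0 mul_signed; congr (signed _ _); rewrite -[LHS]tcoord_idem.
  by rewrite /summand cards1 sub1set inE jx /= /flip_gen Ec.
exists [:: (u j, c, fgen c a)]; split.
  by rewrite /= andbT (flip1_lt jx (flip_chamberP Ec)).
by rewrite big_seq1 smkE E.
Qed.

(** If c < a then c and a differ at some index off the basis, and for a row b agreeing
    with a there, products through c are multiples of the variable of that index.
    Conversely, if these entries vanish modulo the variables off the basis, the element
    is a boundary by [res_exact_start]. *)
Lemma lower_entries (z : projective_mod a) : lower a z <->
  forall b : chamber V, (forall i, i \notin x -> val b i = val a i) ->
    set_zero x (entry b a (val z)) = 0.
Proof.
split=> [[s [sa ->]] b ba|H]; last first.
  have [|y dy] := @res_exact_start (lift0 z).
    by move=> b ba; rewrite tcoord_of eqxx; exact: H.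
  by rewrite -[z]lift0K -dy; exact: lower_diff.
rewrite entry_sum set_zero_sfilter sfilter_sum big_seq big1 // => t /(allP sa) ta.
have [p [Hp pD _ pn]] := chamber_vertex (valP a).
rewrite -mulrA entry_mul sfilter_sfilter sfilter_sum big1 // => c _.
rewrite entry_mul_egen; case: eqP => [->|_]; last by rewrite !mul0r sfilter0.
have [i ix ci] : exists2 i, i \notin x & val t.1.2 i != val a i.
  apply: contrapT => nex; move: ta; apply/negP/(chamber_lt_vertex Hp).
  split=> [|i]; first by case: pD.
  have [ix|ix] := boolP (i \in x); first by rewrite (Hp.2 i ix) mulr0.
  have e : val t.1.2 i = val a i.
    by apply/eqP/negPn/negP => ci; apply: nex; exists i.
  by rewrite /sgn e; exact: pD.2.
rewrite mulrC sfilter_umon_sub (eq_sfilter (Q := fun=> false)) ?sfilter_false // => T.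
apply/negP => /and3P[/subsetP ST /subsetP Tx _].
have : i \in T by apply: ST; rewrite inE ba // eqxx eq_sym ci.
by move=> /Tx; rewrite (negPf ix).
Qed.

Definition res_augment (y : res_term 0) : standard a := qpi (lower a) (res_term0_proj y).

Lemma res_augment_ghom : is_ghom 0 res_augment.
Proof.
split=> [c y y'|j y dy].
  rewrite /res_augment -qpiZ -qpiD; congr (qpi _ _); apply: val_inj.
  by rewrite smvD smvZ /= tcoord_lin.
exists (res_term0_proj y); split => //; rewrite addr0.
by have := dy set0; rewrite subr0.
Qed.

Lemma res_augment_surj u : exists y, res_augment y = u.
Proof. by exists (lift0 (qrepr u)); rewrite /res_augment lift0K qreprK. Qed.

Lemma res_augment_exact y : res_augment y = 0 <-> exists y', res_diff y' = y.
Proof.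
split=> [/(qpi_eq0 (lower a))/lower_entries H|[y' <-]]; first exact: res_exact_start.
exact/(qpi_eq0 (lower a))/lower_diff.
Qed.

(** The Koszul-type resolution with one summand q^|S| B e for each set S of walls off
    the basis, e being the idempotent of the chamber obtained from a by crossing
    them. *)
Definition std_resolution : gresolution (standard a) :=
  @GResolution B (standard a) res_term res_diff res_augment
    (fun m => idem_mod_projective (summand_idem m)) res_diff_ghom res_augment_ghom
    res_augment_surj res_augment_exact res_diff_exact.

End Resolution.

(** * Coordinates on a standard module *)

Section Standard.
Variables (R : realType) (n k : nat) (V : polarized R n k) (b : chamber V).
Local Notation Zu := {mpoly int[n]}.
Local Notation B := (Btilde V).
Local Notation x := (bas_of V (val b)).
Implicit Types (c d : chamber V) (w : standard b) (z : Btilde V) (p q : Zu).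

Lemma entry_fgen_mul c c' d e z : entry d e (fgen c c' * z) =
  if d == c then sfilter (meets V (val c) (val e))
    (umon (sset (val c) (val c') (val e)) * entry c' e z) else 0.
Proof.
rewrite entry_mul; case: eqVneq => [->|dc]; last first.
  by rewrite big1 ?sfilter0 // => c2 _; rewrite entry_fgen (negPf dc) !mul0r.
rewrite (bigD1 c') //= [X in _ + X]big1 ?addr0; last first.
  by move=> c2 cc; rewrite entry_fgen (negPf cc) andbF !mul0r.
rewrite entry_fgen !eqxx /=; apply: sfilter_meets_eq.
set u := umon _; set N := sfilter _ 1; set y := entry _ _ _.
have -> : N * y * u - u * y = - y * (u * (1 - N)) by ring.
apply: (sm_scale (N := rel_ideal V _ _)); apply: rel_ideal_comp; left.
by apply/rel_idealP; rewrite sfilterB sfilter_idem subrr.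
Qed.

Lemma entry_scalar c d q z : entry c d (Zu_scalar V q * z) =
  sfilter (meets V (val c) (val d)) (q * entry c d z).
Proof.
rewrite -{1}[z](bpi_repr (V := V)) bpiM /Zu_scalar_pre bmul_preZl bmul_pre1l entry_pi ffunE.
apply: sfilter_meets_eq; rewrite /entry -mulrBr; apply: (sm_scale (N := rel_ideal V _ _)).
by apply/rel_idealP; rewrite sfilterB sfilter_idem subrr.
Qed.

Definition in_cone c : bool := [forall i in ~: x, val c i == val b i].

Lemma in_coneP c : reflect (forall i, i \notin x -> val c i = val b i) (in_cone c).
Proof.
apply: (iffP forall_inP) => [H i ix|H i]; first by apply/eqP/H; rewrite inE.
by rewrite inE => /H ->.
Qed.

(** The optimal vertex of b lies in both chambers, so monomials in the variables of
    its basis are never relations. *)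
Lemma set_zero_meets c p : in_cone c ->
  set_zero x (sfilter (meets V (val c) (val b)) p) = set_zero x p.
Proof.
move=> /in_coneP cx; rewrite !set_zero_sfilter sfilter_sfilter; apply: eq_sfilter => T.
case: (boolP (T \subset x)) => //= /subsetP Tx.
have [p0 [Hp pD _ _]] := chamber_vertex (valP b).
apply/asboolP; exists p0; split => //.
  split=> [|i]; first by case: pD.
  have [ix|ix] := boolP (i \in x); first by rewrite (Hp.2 i ix) mulr0.
  by rewrite /sgn cx //; exact: pD.2.
by split=> [|i /Tx]; [case: pD|exact: Hp.2].
Qed.

(** Coordinates on the standard module: the row c is a free module of rank one over
    Z[u_x] if c lies in the feasible cone of the basis of b, and zero otherwise. *)
Definition stdc c w : Zu :=
  if in_cone c then set_zero x (entry c b (val (qrepr w : projective_mod b))) else 0.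

Lemma set_zeroB (S : {set 'I_n}) p q : set_zero S (p - q) = set_zero S p - set_zero S q.
Proof. by rewrite !set_zero_sfilter sfilterB. Qed.
Lemma set_zero0 (S : {set 'I_n}) : set_zero S 0 = 0 :> Zu.
Proof. by rewrite set_zero_sfilter sfilter0. Qed.
Lemma set_zeroK (S : {set 'I_n}) p : set_zero S (set_zero S p) = set_zero S p.
Proof. by rewrite !set_zero_sfilter sfilter_idem. Qed.

Lemma stdc_pi c (z : projective_mod b) : stdc c (qpi (lower b) z) =
  if in_cone c then set_zero x (entry c b (val z)) else 0.
Proof.
rewrite /stdc; case: ifP => // cx; apply/eqP; rewrite -subr_eq0 -set_zeroB -entryB.
have /lower_entries H := @qreprP _ _ (lower b) z.
by apply/eqP; have := H c (elimT (in_coneP c) cx); rewrite smvB.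
Qed.

Lemma stdcB c w w' : stdc c (w - w') = stdc c w - stdc c w'.
Proof.
rewrite -[w](qreprK (N := lower b)) -[w'](qreprK (N := lower b)) -qpiB !stdc_pi.
by case: ifP; rewrite ?subrr // smvB entryB set_zeroB.
Qed.

Lemma stdc0 c : stdc c 0 = 0.
Proof. by have := stdcB c 0 0; rewrite !subrr. Qed.

Lemma stdc_sum c (I : Type) (s : seq I) (P : pred I) (F : I -> standard b) :
  stdc c (\sum_(i <- s | P i) F i) = \sum_(i <- s | P i) stdc c (F i).
Proof.
apply: (big_morph (stdc c)) => [w w'|]; last exact: stdc0.
by rewrite -{1}[w']opprK stdcB -[- w']sub0r stdcB stdc0 sub0r opprK.
Qed.

Lemma stdc_signed c s w : stdc c (signed s w) = signed s (stdc c w).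
Proof. by apply: signed_morph => u v; exact: stdcB. Qed.

Lemma stdc_eq0 w : (forall c, stdc c w = 0) -> w = 0.
Proof.
move=> H; rewrite -[w](qreprK (N := lower b)); apply/(qpi_eq0 (lower b))/lower_entries.
by move=> c /(introT (in_coneP c)) cx; have := H c; rewrite /stdc cx.
Qed.

Lemma stdcN c w : ~~ in_cone c -> stdc c w = 0.
Proof. by move=> /negPf cx; rewrite /stdc cx. Qed.

Lemma stdc_in c w : set_zero x (stdc c w) = stdc c w.
Proof. by rewrite /stdc; case: ifP => _; rewrite ?set_zeroK // set_zero0. Qed.

Lemma val_scale (y : B) (z : projective_mod b) : val (y *: z) = y * val z :> B.
Proof. exact: (@smvZ _ _ (proj_sub b)). Qed.

Lemma stdc_fgen c c' d w : stdc d ((fgen c c' : B) *: w) =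
  if (d == c) && in_cone c then set_zero x (umon (sset (val c) (val c') (val b))) * stdc c' w
  else 0.
Proof.
rewrite -[w](qreprK (N := lower b)) -qpiZ !stdc_pi val_scale entry_fgen_mul.
case: eqVneq => [->|_] /=; last by case: ifP; rewrite ?set_zero0.
case: ifP => // cx; rewrite set_zero_meets // set_zeroM; case: ifPn => // c'x.
have [i ix ci] : exists2 i, i \notin x & val c' i != val b i.
  by move: c'x; rewrite negb_forall => /existsP[i]; rewrite negb_imply inE => /andP[]; exists i.
rewrite mulr0; suff -> : set_zero x (umon (sset (val c) (val c') (val b))) = 0 by rewrite mul0r.
rewrite set_zero_sfilter -[umon _]mulr1 sfilter_umon_sub.
rewrite (eq_sfilter (Q := fun=> false)) ?sfilter_false // => T.
apply/negP => /andP[/subsetP ST /subsetP Tx].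
have : i \in T.
  by apply: ST; rewrite inE (elimT (in_coneP c) cx) // eqxx eq_sym ci.
by move=> /Tx; rewrite (negPf ix).
Qed.

Lemma stdc_egen c d w : stdc d ((egen c : B) *: w) = if d == c then stdc c w else 0.
Proof.
rewrite stdc_fgen sset_aab umon0 set_zero1 mul1r.
case: eqP => //= _; case: ifPn => // cx; by rewrite stdcN.
Qed.

Lemma stdc_scalar c q w : stdc c ((Zu_scalar V q : B) *: w) = set_zero x q * stdc c w.
Proof.
rewrite -[w](qreprK (N := lower b)) -qpiZ !stdc_pi val_scale entry_scalar.
by case: ifP => cx; rewrite ?mulr0 // set_zero_meets // set_zeroM.
Qed.

Lemma sfilter_deg t (P : pred {set 'I_n}) p : mpoly_deg t p -> mpoly_deg t (sfilter P p).
Proof.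
move=> /mpoly_degP dp; apply/mpoly_degP => m mt; rewrite mcoeff_sfilter.
by case: ifP => // _; exact: dp.
Qed.

Lemma stdc_deg t c w : gm_deg t w -> mpoly_deg (t - (sdist (val c) (val b))%:Z) (stdc c w).
Proof.
move=> [z [[f [df zf]] ->]]; rewrite stdc_pi; case: ifP => _; last first.
  exact: grading0 (mpoly_grading n) _.
rewrite set_zero_sfilter; apply: sfilter_deg; rewrite zf entry_pi; apply: sfilter_deg.
exact: df.
Qed.

Definition stdgen c p : standard b :=
  qpi (lower b) (smk (N := proj_sub b) (proj_intro b (Zu_scalar V p * fgen c b))).

Lemma stdc_gen c d p : stdc d (stdgen c p) = if (d == c) && in_cone c then set_zero x p else 0.
Proof.
rewrite stdc_pi smkE entry_mul_egen eqxx entry_scalar entry_fgen eqxx andbT.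
case: eqVneq => [->|_] /=; last by case: ifP; rewrite ?mulr0 ?sfilter0 ?set_zero0.
case: ifP => // cx; rewrite set_zero_meets // set_zeroM set_zero_meets // set_zero1.
by rewrite mulr1.
Qed.

End Standard.

(** * Homomorphisms into a standard module *)

Section ExtendHom.
Variables (C A : grRing) (phi : central_map C A) (I : finType) (s : int) (e : I -> A).
Hypothesis e0 : forall i, gr_deg 0 (e i).
Variables (W : grMod A) (v : I -> W).

(** The images of the generators need not be homogeneous; their homogeneous components
    give the homogeneous components of the map. *)
Fact extend_subproof : extend (e0 := e0) (s := s) v \in @hom_pred A (idem_mod s e0) W.
Proof.
have -> : extend (e0 := e0) (s := s) v =
    \sum_(i <- enum I) \sum_(m <- hsupp (gm_grading W) (v i))
      (fun y : idem_mod s e0 => tcoord y i *: hc (gm_grading W) (v i) m).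
  apply/funext => y; rewrite fct_sumE big_enum; apply: eq_bigr => i _.
  by rewrite fct_sumE {1}[v i](hsupp_sum (gm_grading W)) scaler_sumr.
apply: hom_pred_sum => i _; apply: hom_pred_sum => m _.
apply: (@is_ghom_hom _ _ _ (m - s)); split=> [a y y'|j y dy].
  by rewrite tcoord_lin scalerDl scalerA.
have := gm_scale (dy i) (hc_deg (gm_grading W) m (v i)).
by rewrite -addrA [- s + m]addrC.
Qed.

Definition hom_extend : gHom phi (idem_mod s e0) W :=
  exist (fun g => g \in @hom_pred A (idem_mod s e0) W) _ extend_subproof.

End ExtendHom.

Section HomComplex.
Variables (R : realType) (n k : nat) (V : polarized R n k) (a b : chamber V).
Local Notation Zu := {mpoly int[n]}.
Local Notation B := (Btilde V).
Local Notation xa := (bas_of V (val a)).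
Local Notation xb := (bas_of V (val b)).
Local Notation fl := (flip (val a)).
Local Notation phi := (Zu_to_Btilde V).
Local Notation Hom m := (gHom phi (res_term a m) (standard b)).
Implicit Types (S T Z : {set 'I_n}).

Definition rgen m S : res_term a m := gen m%:Z (summand_deg a m) (summand_idem a m) S.

Lemma rgen_deg m S : gm_deg m%:Z (rgen m S).
Proof. exact: gen_deg. Qed.

Lemma rgen_sum m (y : res_term a m) : y = \sum_S tcoord y S *: rgen m S.
Proof. exact: gen_sum. Qed.

Lemma rgen_idem m S : summand a m S *: rgen m S = rgen m S.
Proof. exact: gen_idem. Qed.

Lemma tcoord_rgen m S T : tcoord (rgen m S) T = if T == S then summand a m S else 0.
Proof. exact: tcoord_of. Qed.

Definition homc m (f : Hom m) S : Zu :=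
  if flip_chamber a S is Some c then stdc c (val f (rgen m S)) else 0.

Definition cone_flips : {set {set 'I_n}} :=
  [set S : {set 'I_n} | (S \subset ~: xa) && [forall i in ~: xb, fl S i == val b i]].

Lemma cone_flipsP S : reflect (S \subset ~: xa /\ forall i, i \notin xb -> fl S i = val b i)
  (S \in cone_flips).
Proof.
rewrite inE; apply: (iffP andP) => [[Sx /forall_inP H]|[Sx H]]; split => //.
  by move=> i ix; apply/eqP/H; rewrite inE.
by apply/forall_inP => i; rewrite inE => /H ->.
Qed.

Lemma cone_flips_chamber S : S \in cone_flips -> exists2 c, flip_chamber a S = Some c & in_cone b c.
Proof.
move=> /cone_flipsP[Sx Sb].
have P : fl S \in Pset V.
  rewrite inE (flip_bounded (valP a) Sx) andbT inE; apply/asboolP.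
  have [p [Hp pD _ _]] := chamber_vertex (valP b); exists p; split; first by case: pD.
  move=> i; have [ix|ix] := boolP (i \in xb); first by rewrite (Hp.2 i ix) mulr0.
  by rewrite /sgn Sb //; exact: pD.2.
exists (exist (fun s => s \in Pset V) _ P); first by rewrite /flip_chamber insubT.
by apply/in_coneP => i /Sb.
Qed.

Lemma homc0 m (f : Hom m) S : ~~ ((#|S| == m) && (S \in cone_flips)) -> homc f S = 0.
Proof.
move=> nS; rewrite /homc; case Ec: (flip_chamber a S) => [c|//].
have [cx|/stdcN -> //] := boolP (in_cone b c).
rewrite -rgen_idem homEZ /summand; case: ifP; last by rewrite scale0r stdc0.
move=> /andP[Sm Sx]; case/negP: nS; rewrite Sm; apply/cone_flipsP; split => // i ix.
by rewrite -(flip_chamberP Ec); exact: (elimT (in_coneP b c) cx).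
Qed.

Lemma homcB m (f g : Hom m) S : homc (f - g) S = homc f S - homc g S.
Proof.
rewrite /homc; case: (flip_chamber a S) => [c|]; last by rewrite subrr.
exact: stdcB.
Qed.

Lemma homcZ m q (f : Hom m) S : homc ((q : Zu) *: f) S = set_zero xb q * homc f S.
Proof.
rewrite /homc; case: (flip_chamber a S) => [c|]; last by rewrite mulr0.
exact: stdc_scalar.
Qed.

Lemma homcD m (f g : Hom m) S : homc (f + g) S = homc f S + homc g S.
Proof.
have h0 : homc (0 : Hom m) S = 0.
  by rewrite /homc; case: (flip_chamber _ _) => // c; exact: stdc0.
by rewrite -{1}[g]opprK homcB -[- g]sub0r homcB h0 sub0r opprK.
Qed.

Lemma homc_in m (f : Hom m) S : set_zero xb (homc f S) = homc f S.
Proof.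
rewrite /homc; case: (flip_chamber a S) => [c|]; first exact: stdc_in.
exact: set_zero0.
Qed.

Lemma homc_eq0 m (f : Hom m) : (forall S, homc f S = 0) -> f = 0.
Proof.
move=> H; apply: val_inj; apply/funext => y; rewrite {1}[y]rgen_sum homE_sum big1 //.
move=> S _; rewrite homEZ; suff -> : val f (rgen m S) = 0 by rewrite scaler0.
have := H S; rewrite /homc -rgen_idem homEZ /summand /flip_gen.
case: ifP => _; last by rewrite scale0r.
case: (flip_chamber a S) => [c|]; last by rewrite scale0r.
rewrite stdc_egen eqxx => f0; apply: stdc_eq0 => d; rewrite stdc_egen.
by case: eqP.
Qed.

(** Homomorphisms out of the resolution can be prescribed by their coordinates, as its
    terms are sums of projectives generated by idempotents. *)
Lemma hom_exists m (p : {set 'I_n} -> Zu) : exists f : Hom m, forall S,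
  homc f S = if (#|S| == m) && (S \in cone_flips) then set_zero xb (p S) else 0.
Proof.
pose v S : standard b := if flip_chamber a S is Some c then stdgen b c (p S) else 0.
exists (hom_extend phi m%:Z (summand_deg a m) v) => S.
case: ifPn => [/andP[Sm SG]|]; last exact: homc0.
have [c Ec cx] := cone_flips_chamber SG; have /cone_flipsP[Sx _] := SG.
rewrite /homc Ec /= (@extend_gen _ _ _ _ _ (summand_idem a m)) /summand Sm Sx /=.
by rewrite /flip_gen /v Ec stdc_egen eqxx stdc_gen eqxx cx.
Qed.

Lemma homc_diff m (f : Hom m) (f' : Hom m.+1) T :
  (forall y, val f' y = val f (res_diff y)) -> T \in cone_flips -> #|T| = m.+1 ->
  homc f' T = \sum_(j in T) signed (std_sign j (T :\ j))
    (set_zero xb (umon (sset (fl T) (fl (T :\ j)) (val b))) * homc f (T :\ j)).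
Proof.
move=> f'E TG Tm; have [c Ec cx] := cone_flips_chamber TG; have /cone_flipsP[Tx _] := TG.
rewrite {1}/homc Ec f'E [res_diff _]rgen_sum homE_sum stdc_sum.
pose F j S : Zu := signed (std_sign j S) (stdc c
  ((tcoord (rgen m.+1 T) (j |: S) * flip_gen a (j |: S) S) *: val f (rgen m S))).
transitivity (\sum_(S : {set 'I_n}) \sum_(j | j \notin S) F j S).
  apply: eq_bigr => S _; rewrite homEZ tcoord_diff /res_diff_fun scaler_suml stdc_sum.
  apply: eq_bigr => j _; rewrite /F -stdc_signed; congr stdc.
  by case: (std_sign j S); rewrite /signed ?scaleNr.
rewrite (exchange_big_dep xpredT) //= [RHS]big_mkcond; apply: eq_bigr => j _ /=.
case: ifP => jT; last first.
  apply: big1 => S _; rewrite /F tcoord_rgen; case: eqP => [E|_].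
    by move: jT; rewrite -E !inE eqxx.
  by rewrite mul0r scale0r stdc0 signed0.
rewrite (bigD1 (T :\ j)) ?inE ?eqxx //= big1 ?addr0; last first.
  move=> S /andP[jS ST]; rewrite /F tcoord_rgen; case: eqP => [E|_].
    by case/eqP: ST; rewrite -E setU1K.
  by rewrite mul0r scale0r stdc0 signed0.
rewrite /F setD1K // tcoord_rgen eqxx /summand Tm eqxx Tx /=; congr signed.
rewrite -scalerA {1}/flip_gen Ec stdc_egen eqxx /flip_gen Ec /homc.
case Ed: (flip_chamber a (T :\ j)) => [d|]; last by rewrite scale0r stdc0 mulr0.
by rewrite stdc_fgen eqxx cx (flip_chamberP Ec) (flip_chamberP Ed).
Qed.

(** The differential multiplies by the variables in [extra_opposite], and is an
    isomorphism in the direction of the other elements of [extra_vars]. *)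
Definition extra_vars : {set 'I_n} := ~: xa :&: xb.
Definition extra_opposite : {set 'I_n} := [set j in extra_vars | val a j != val b j].

Lemma extra_opposite_sub : extra_opposite \subset xb.
Proof. by apply/subsetP => j; rewrite !inE => /andP[/andP[]]. Qed.

Lemma set_zero_umon S Z : S \subset Z -> set_zero Z (umon S) = umon S :> Zu.
Proof.
move=> SZ; rewrite set_zero_sfilter; apply/mnm_supp_mem => m.
rewrite umonE mcoeffX; case: (eqVneq (set_mnm S) m) => // <- _; apply: subset_trans SZ.
apply/subsetP => i; rewrite inE mnmE; by case: (i \in S).
Qed.

(** The monomial in front absorbs the variables by which the differential multiplies,
    which turns the differential into the signed sum [bd]. As the complex is
    cohomological, it is read through the complement Z of the set of flips. *)
Definition shifted_homc m (f : Hom m) Z : Zu := umon (extra_opposite :&: Z) * homc f (~: Z).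

Lemma shifted_homc_diff m (f : Hom m) (f' : Hom m.+1) Z :
  (forall y, val f' y = val f (res_diff y)) -> ~: Z \in cone_flips -> #|~: Z| = m.+1 ->
  shifted_homc f' Z = bd (@dual_sign n) (shifted_homc f) Z.
Proof.
move=> f'E ZG Zm; rewrite /shifted_homc (homc_diff f'E ZG Zm) mulr_sumr.
rewrite /bd; apply: eq_big => [j|j]; rewrite inE // => jZ.
have cE : ~: (j |: Z) = ~: Z :\ j.
  by apply/setP => i; rewrite !inE negb_or.
rewrite /dual_sign cE.
have -> s (u v : Zu) : u * signed s v = signed s (u * v) by case: s; rewrite /signed ?mulrN.
congr signed; have [jG|jG] := boolP (~: Z :\ j \in cone_flips); last first.
  by rewrite (@homc0 _ f) ?(negPf jG) ?andbF // !mulr0.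
have /cone_flipsP[_ jb] := jG; have /cone_flipsP[/subsetP Zx Zb] := ZG.
have jx : j \notin xa by have := Zx j; rewrite !inE; apply.
have jxb : j \in xb.
  apply/negPn/negP => jxb; have := jb j jxb; rewrite -(Zb j jxb) !ffunE !inE eqxx jZ /=.
  by rewrite addbF addbT; case: (val a j).
have sE : sset (fl (~: Z)) (fl (~: Z :\ j)) (val b) = extra_opposite :&: [set j].
  apply/setP => i; rewrite !inE !ffunE !inE; case: (eqVneq i j) => [->|ij] /=.
    by rewrite jx jxb jZ addbF addbT andbT /=; case: (val a j); case: (val b j).
  rewrite andbF; case: eqP => //= <-; by rewrite eqxx.
rewrite sE set_zero_umon; last by apply: subset_trans extra_opposite_sub; exact: subsetIl.
rewrite mulrA umonU; last first.
  rewrite -setI_eq0; apply/eqP/setP => i; rewrite !inE.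
  by case: (eqVneq i j) => [->|_]; rewrite ?(negPf jZ) ?andbF.
by congr (umon _ * _); rewrite -setIUr setUC.
Qed.

Definition hom_part T m (f : Hom m) Z : Zu := sfilter (pred1 T) (shifted_homc f Z).

Definition hom_family T : {set {set 'I_n}} :=
  [set Z : {set 'I_n} | [&& ~: Z \in cone_flips, extra_opposite :&: Z \subset T & T \subset xb]].

Lemma in_hom_family T Z : (Z \in hom_family T) =
  [&& ~: Z \in cone_flips, extra_opposite :&: Z \subset T & T \subset xb].
Proof. exact: in_set. Qed.

Lemma hom_part_card T m (f : Hom m) Z : #|~: Z| != m -> hom_part T f Z = 0.
Proof. by move=> Zm; rewrite /hom_part /shifted_homc homc0 ?(negPf Zm) // mulr0 sfilter0. Qed.

Lemma shifted_homc_filter m (f : Hom m) Z : sfilter (fun T => Z \in hom_family T) (shifted_homc f Z) = shifted_homc f Z.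
Proof.
have [ZG|ZG] := boolP (~: Z \in cone_flips); last first.
  by rewrite /shifted_homc homc0 ?(negPf ZG) ?andbF // mulr0 sfilter0.
apply/mnm_supp_mem => m0; rewrite inE ZG /=.
rewrite -{1}[shifted_homc f Z](_ : set_zero xb (shifted_homc f Z) = _); last first.
  rewrite /shifted_homc set_zeroM homc_in set_zero_umon //.
  by apply: subset_trans extra_opposite_sub; exact: subsetIl.
rewrite set_zero_sfilter mcoeff_sfilter; case: (_ \subset xb); rewrite ?eqxx // andbT.
by rewrite mcoeff_umonM; case: (_ \subset _); rewrite ?eqxx.
Qed.

Lemma hom_part_supported T m (f : Hom m) : supported (hom_family T) (hom_part T f).
Proof.
move=> Z ZG; rewrite /hom_part -shifted_homc_filter sfilter_sfilter.
rewrite (eq_sfilter (Q := fun=> false)) ?sfilter_false // => U /=.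
by case: eqP => // ->; rewrite (negPf ZG).
Qed.

Lemma hom_part_diff T m (f : Hom m) (f' : Hom m.+1) Z :
  (forall y, val f' y = val f (res_diff y)) ->
  hom_part T f' Z = if Z \in hom_family T then bd (@dual_sign n) (hom_part T f) Z else 0.
Proof.
move=> f'E; case: ifPn => [ZG|]; last exact: hom_part_supported.
have [Zm|Zm] := eqVneq #|~: Z| m.+1; last first.
  rewrite hom_part_card //; apply/esym/bd_eq0 => j jZ; apply: hom_part_card.
  apply: contra Zm => /eqP Zm; rewrite (cardsD1 j) !inE jZ -Zm.
  by apply/eqP; congr (_.+1); apply: eq_card => i; rewrite !inE negb_or.
rewrite /hom_part (shifted_homc_diff f'E) //; last by move: ZG; rewrite inE => /and3P[].
by rewrite sfilter_sum; apply: eq_bigr => j _; rewrite sfilter_signed.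
Qed.

Lemma hom_part_inj m (f : Hom m) : (forall T Z, hom_part T f Z = 0) -> f = 0.
Proof.
move=> H; apply: homc_eq0 => S.
have : shifted_homc f (~: S) = 0 by rewrite [LHS]sfilter_supp_sum big1 // => T _; exact: H.
by move=> /eqP; rewrite mulf_eq0 (negPf (umon_neq0 _)) setCK => /eqP.
Qed.

Lemma hom_partB T m (f g : Hom m) Z : hom_part T (f - g) Z = hom_part T f Z - hom_part T g Z.
Proof. by rewrite /hom_part /shifted_homc homcB mulrBr sfilterB. Qed.

Lemma hom_part_exists m (g : {set 'I_n} -> {set 'I_n} -> Zu) :
  (forall T, supported (hom_family T) (g T)) ->
  exists f : Hom m, forall T Z,
    hom_part T f Z = if #|~: Z| == m then sfilter (pred1 T) (g T Z) else 0.
Proof.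
move=> gS.
have famZ T Z : g T Z != 0 -> Z \in hom_family T by apply: contraNT => /gS ->.
have /choice[w wP] Z : exists w : Zu,
    umon (extra_opposite :&: Z) * w = \sum_T sfilter (pred1 T) (g T Z).
  apply: umon_div; rewrite sfilter_sum; apply: eq_bigr => T _.
  rewrite sfilter_sfilter; have [->|/famZ] := eqVneq (g T Z) 0; first by rewrite !sfilter0.
  rewrite inE => /and3P[_ UT _]; apply: eq_sfilter => U /=.
  by case: eqP => [->|_]; rewrite ?andbF ?andbT.
have [f fE] := hom_exists m (fun S => w (~: S)).
exists f => T Z; have [Zm|Zm] := eqVneq #|~: Z| m; last exact: hom_part_card.
rewrite /hom_part /shifted_homc fE Zm eqxx setCK /=; case: ifPn => ZG; last first.
  by rewrite (gS T Z) ?mulr0 ?sfilter0 // inE (negPf ZG).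
have -> : umon (extra_opposite :&: Z) * set_zero xb (w Z) =
    set_zero xb (\sum_T' sfilter (pred1 T') (g T' Z)).
  rewrite -wP set_zeroM set_zero_umon //.
  by apply: subset_trans extra_opposite_sub; exact: subsetIl.
rewrite set_zero_sfilter sfilter_sfilter sfilter_sum (bigD1 T) //= big1 ?addr0.
  rewrite sfilter_sfilter; have [->|/famZ] := eqVneq (g T Z) 0; first by rewrite !sfilter0.
  rewrite inE => /and3P[_ _ Tx]; apply: eq_sfilter => U /=.
  by case: eqP => [->|_]; rewrite ?Tx.
move=> T' T'T; rewrite sfilter_sfilter (eq_sfilter (Q := fun=> false)) ?sfilter_false //.
by move=> U /=; case: (eqVneq U T) => //= ->; rewrite [T == T']eq_sym (negPf T'T) andbF.
Qed.

Lemma hom_family_convex T : set_convex (hom_family T).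
Proof.
move=> Z1 Z Z2; rewrite !in_hom_family => /and3P[/cone_flipsP[/subsetP Z1x Z1b] _ Tx].
move=> /and3P[/cone_flipsP[_ Z2b] UZ _] /subsetP Z1Z /subsetP ZZ2.
rewrite Tx andbT; apply/andP; split; last first.
  by apply: subset_trans UZ; apply: setIS; exact/subsetP.
apply/cone_flipsP; split.
  by apply/subsetP => i; rewrite inE => iZ; apply: Z1x; rewrite inE; apply: contra iZ; exact: Z1Z.
move=> i ix; have := Z1b i ix; have := Z2b i ix; rewrite !ffunE !inE.
have := Z1Z i; have := ZZ2 i.
case: (i \in Z1); case: (i \in Z); case: (i \in Z2) => //= h1 h2;
  first [by move: (h1 isT) | by move: (h2 isT)].
Qed.

(** When the differential does not multiply by u_j, or u_j occurs in the monomial, adding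
    or removing j does not affect membership. *)
Lemma hom_family_acyclic T j : j \in extra_vars -> (val a j == val b j) || (j \in T) ->
  acyclic Zu (@dual_sign n) (hom_family T).
Proof.
rewrite !inE => /andP[jx jxb] jT.
apply: (acyclic_toggle (@dual_signP n) (j := j) (@hom_family_convex T)) => Z jZ.
rewrite !inE; congr (_ && (_ && _)).
- have agree (i : 'I_n) : i != j -> (i \in ~: (j |: Z)) = (i \in ~: Z).
    by move=> ij; rewrite !inE (negPf ij).
  apply/andP/andP => -[/subsetP Zx /forall_inP Zb]; split.
  + apply/subsetP => i; have [->|ij] := eqVneq i j; first by rewrite !inE jx.
    by rewrite agree //; exact: Zx.
  + apply/forall_inP => i ix; have ij : i != j.
      by apply: contraTneq ix => ->; rewrite inE jxb.
    by have := Zb i ix; rewrite !ffunE agree.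
  + apply/subsetP => i; have [->|ij] := eqVneq i j; first by rewrite !inE jx.
    by rewrite -agree //; exact: Zx.
  + apply/forall_inP => i ix; have ij : i != j.
      by apply: contraTneq ix => ->; rewrite inE jxb.
    by have := Zb i ix; rewrite !ffunE agree.
- apply/subsetP/subsetP => H i; rewrite !inE => /andP[iU].
    case/orP => [/eqP ij|iZ]; last by apply: H; rewrite !inE iU.
    by move: iU jT; rewrite ij => /andP[_ /negPf ->].
  by move=> iZ; apply: H; rewrite !inE iU iZ orbT.
Qed.

(** A family that cannot be contracted consists of complements of sets that contain
    all of [extra_vars]; there is at most one such set, and it contributes to a single
    cohomological degree. *)
Lemma hom_exact i (f : gHom phi (std_resolution a i) (standard b)) : cocycle f ->
  (forall S, S \in cone_flips -> extra_vars \subset S ->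
     (forall j, j \in extra_vars -> val a j != val b j) -> #|S| != i) ->
  coboundary f.
Proof.
move=> fc exc.
pose f' := precomp (res_diff_ghom a i) f : Hom i.+1.
have f'0 : f' = 0 by apply: val_inj; apply/funext => y; exact: fc.
have cyc T Z : Z \in hom_family T -> bd (@dual_sign n) (hom_part T (f : Hom i)) Z = 0.
  move=> ZG; have := @hom_part_diff T i f f' Z (fun=> erefl).
  rewrite ZG => <-; rewrite f'0 /hom_part /shifted_homc /homc.
  case: (flip_chamber _ _) => [c|]; last by rewrite mulr0 sfilter0.
  by rewrite stdc0 mulr0 sfilter0.
have /choice[g gP] T : exists g, supported (hom_family T) g /\
    forall Z, Z \in hom_family T -> bd (@dual_sign n) g Z = hom_part T (f : Hom i) Z.
  have [[j jY jT]|nj] := pselect (exists2 j, j \in extra_vars & (val a j == val b j) || (j \in T)).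
    apply: (hom_family_acyclic jY jT); first exact: hom_part_supported.
    exact: cyc.
  have nj' j : j \in extra_vars -> val a j != val b j /\ j \notin T.
    move=> jY; apply/andP; rewrite -negb_or; apply/negP => jT; apply: nj; by exists j.
  exists (fun=> 0); split => // Z ZG; rewrite bd_eq0 //; apply/esym/hom_part_card.
  move: ZG; rewrite inE => /and3P[ZG /subsetP UT _]; apply: exc => //.
    apply/subsetP => j jY; rewrite inE; apply/negP => jZ.
    have [ab /negP] := nj' j jY; apply; apply: UT.
    by rewrite in_setI jZ andbT inE jY ab.
  by move=> j /nj'[].
case: i f fc exc f' f'0 cyc gP => [|i] f fc exc f' f'0 cyc gP.
  apply: (@hom_part_inj 0) => T Z; have [Z0|Z0] := eqVneq #|~: Z| 0%N; last exact: hom_part_card.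
  have [ZG|ZG] := boolP (Z \in hom_family T); last exact: hom_part_supported.
  have [_ <- //] := gP T; apply: bd_eq0 => j jZ.
  by move/eqP: Z0; rewrite cards_eq0 => /eqP/setP/(_ j); rewrite !inE jZ.
have [|h hE] := @hom_part_exists i g; first by move=> T; case: (gP T).
exists h; pose h' := precomp (res_diff_ghom a i) h : Hom i.+1.
suff -> : f = h' by [].
apply/eqP; rewrite -subr_eq0; apply/eqP/(@hom_part_inj i.+1) => T Z.
rewrite hom_partB (@hom_part_diff T i h h' Z (fun=> erefl)).
case: ifPn => ZG; last by rewrite hom_part_supported ?subrr.
have [_ /(_ Z ZG) gd] := gP T.
have [Zm|Zm] := eqVneq #|~: Z| i.+1; last first.
  rewrite hom_part_card // sub0r; apply/eqP; rewrite oppr_eq0; apply/eqP/bd_eq0 => j jZ.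
  apply: hom_part_card; apply: contra Zm => /eqP Zm; rewrite (cardsD1 j) !inE jZ -Zm.
  by apply/eqP; congr (_.+1); apply: eq_card => l; rewrite !inE negb_or.
have -> : hom_part T (f : Hom i.+1) Z = sfilter (pred1 T) (bd (@dual_sign n) (g T) Z).
  by rewrite gd /hom_part sfilter_idem.
apply/eqP; rewrite subr_eq0 /bd sfilter_sum; apply/eqP/eq_bigr => j jZ.
rewrite hE sfilter_signed; suff -> : #|~: (j |: Z)| == i by [].
rewrite -eqSS -Zm (cardsD1 j (~: Z)) !inE jZ; apply/eqP; congr (_.+1).
by apply: eq_card => l; rewrite !inE negb_or.
Qed.

End HomComplex.

(** * Quotients of polynomial rings by variables *)

Section PolynomialQuotient.
Variable n : nat.
Local Notation Zu := {mpoly int[n]}.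
Implicit Types (z y : {set 'I_n}).

Lemma set_zero_sub z y (p : Zu) : y \subset z -> set_zero z (set_zero y p) = set_zero y p.
Proof.
move=> yz; rewrite !set_zero_sfilter sfilter_sfilter; apply: eq_sfilter => T.
by case: (boolP (T \subset y)) => [Ty|_]; rewrite ?andbF // (subset_trans Ty yz).
Qed.

Lemma set_zero_compl z y (p : Zu) :
  set_zero (z :\: y) (set_zero z p) = set_zero (z :\: y) p.
Proof.
rewrite !set_zero_sfilter sfilter_sfilter; apply: eq_sfilter => T.
by case: (boolP (T \subset _ :\: _)) => [/subset_trans/(_ (subsetDl _ _)) ->|].
Qed.

Definition topolyin z (p : Zu) (pz : set_zero z p = p) : polyin z :=
  exist (fun q => q \in polyin_pred z) p (introT (polyinP z p) pz).

Lemma polyin_zero z (p : polyin z) : set_zero z (val p) = val p.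
Proof. exact/polyinP/valP. Qed.

Lemma umon1 (j : 'I_n) : umon [set j] = 'X_j :> Zu.
Proof. by rewrite /umon big_set1. Qed.

Lemma var_idealP z y (p : gpolyin z) : y \subset z ->
  var_ideal z y p <-> set_zero (z :\: y) (val p) = 0.
Proof.
move=> yz; split=> [[c ->]|p0].
  rewrite set_zero_sfilter sfilter_sum big1 // => j jy.
  rewrite -umon1 sfilter_umon_sub (eq_sfilter (Q := fun=> false)) ?sfilter_false // => T.
  apply/negP => /andP[]; rewrite sub1set => jT /subsetP/(_ j jT).
  by rewrite inE jy.
have /choice[q qP] T : exists q : 'I_n -> Zu,
    sfilter (pred1 T) (val p) = \sum_(j in y) 'X_j * q j.
  have [[j jy jT]|nj] := pselect (exists2 j, j \in y & j \in T).
    have [|q qE] := @umon_div _ [set j] (sfilter (pred1 T) (val p)).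
      rewrite sfilter_sfilter; apply: eq_sfilter => U /=.
      by case: eqP => [->|_]; rewrite ?andbF // sub1set jT.
    exists (fun i => if i == j then q else 0); rewrite (bigD1 j) //= eqxx -umon1 qE.
    by rewrite big1 ?addr0 // => i /andP[_ /negPf ->]; rewrite mulr0.
  exists (fun=> 0); rewrite big1 => [|j _]; last exact: mulr0.
  have := congr1 (sfilter (pred1 T)) p0.
  rewrite -(polyin_zero p) !set_zero_sfilter !sfilter_sfilter sfilter0.
  move=> E; rewrite -[RHS]E; apply: eq_sfilter => U /=; case: eqP => //= ->.
  case: (boolP (T \subset z)) => //= [/subsetP Tz|_]; last by rewrite andbF.
  rewrite andbT; apply/esym/subsetP => i iT; rewrite inE Tz // andbT.
  by apply/negP => iy; apply: nj; exists i.
have cP j : set_zero z (set_zero z (\sum_T q T j)) = set_zero z (\sum_T q T j).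
  exact: set_zeroK.
exists (fun j => topolyin (cP j)) => /=.
have pE : val p = \sum_(j in y) \sum_T 'X_j * q T j.
  rewrite [LHS]sfilter_supp_sum (eq_bigr _ (fun T _ => qP T)); exact: exchange_big.
rewrite -(polyin_zero p) pE set_zero_sfilter sfilter_sum; apply: eq_bigr => j jy /=.
by rewrite -mulr_sumr -!set_zero_sfilter set_zeroM -umon1 set_zero_umon // sub1set (subsetP yz).
Qed.

Lemma polyquot_iso z y : y \subset z -> giso (gpolyquot z y) (gpolyin (z :\: y)).
Proof.
move=> yz; pose f (p : gpolyin z) : gpolyin (z :\: y) :=
  topolyin (set_zeroK (z :\: y) (val p)).
apply: (@giso_quot _ _ _ (var_ideal z y) f).
- split=> [c p q|j p dp].
    apply: val_inj => /=; rewrite !set_zero_sfilter sfilterD -!set_zero_sfilter.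
    by rewrite set_zeroM set_zero_compl.
  by rewrite addr0; have := sfilter_deg (P := fun T : {set 'I_n} => T \subset z :\: y) dp; rewrite -set_zero_sfilter.
- move=> p; have pz : set_zero z (val p) = val p.
    rewrite -(polyin_zero p); apply: set_zero_sub; exact: subsetDl.
  by exists (topolyin pz); apply: val_inj; rewrite /= polyin_zero.
- move=> p; split=> [fp|H]; first by apply/(var_idealP p yz); exact: (congr1 val fp).
  by apply: val_inj; exact/(var_idealP p yz).
Qed.
End PolynomialQuotient.

(** * The top cohomology of the complex of homomorphisms *)

Section TopDegree.
Variables (R : realType) (n k : nat) (V : polarized R n k) (a b : chamber V).
Local Notation Zu := {mpoly int[n]}.
Local Notation xa := (bas_of V (val a)).
Local Notation xb := (bas_of V (val b)).
Local Notation fl := (flip (val a)).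
Local Notation phi := (Zu_to_Btilde V).
Local Notation Hom m := (gHom phi (res_term a m) (standard b)).
Local Notation Y := (extra_vars a b).
Implicit Types (S T Z : {set 'I_n}).

Lemma chamber_mu (c : chamber V) : mu V (bas_of V (val c)) = val c.
Proof. by have [] := bas_ofP (valP c). Qed.

(** Off the basis of b the flips leading to the feasible cone of b are prescribed; on it
    they are free, but must avoid the basis of a. *)
Definition forced_flips : {set 'I_n} := [set j in ~: xa :&: ~: xb | val a j != val b j].
Definition top_flips : {set 'I_n} := forced_flips :|: Y.

Lemma top_flips_card : #|top_flips| = (#|forced_flips| + #|Y|)%N.
Proof.
rewrite cardsU (_ : forced_flips :&: Y = set0) ?cards0 ?subn0 //.
by apply/setP => i; rewrite !inE; case: (i \in xb); rewrite ?andbF.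
Qed.

Lemma cone_flips_forced S : S \in cone_flips a b -> forall i, i \notin xb -> (i \in S) = (i \in forced_flips).
Proof.
move=> /cone_flipsP[/subsetP Sx Sb] i ix; rewrite !inE ix andbT.
have := Sb i ix; rewrite ffunE => <-; have := Sx i; rewrite inE.
case: (i \in S) => [/(_ isT) ->|_]; first by case: (val a i).
by rewrite addbF eqxx andbF.
Qed.

Lemma cone_flips_sub_top S : S \in cone_flips a b -> S \subset top_flips.
Proof.
move=> SG; apply/subsetP => i iS; rewrite inE.
have [ix|ix] := boolP (i \in xb); last by rewrite -(cone_flips_forced SG ix) iS.
have /cone_flipsP[/subsetP Sx _] := SG; have := Sx i iS.
by rewrite !inE ix => ->; rewrite orbT.
Qed.

Lemma cone_flips_top S : S \in cone_flips a b -> Y \subset S -> S = top_flips.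
Proof.
move=> SG YS; apply/eqP; rewrite eqEsubset cone_flips_sub_top //= subUset YS andbT.
apply/subsetP => i iN; rewrite (cone_flips_forced SG) //.
by move: iN; rewrite !inE => /andP[/andP[]].
Qed.

Lemma cone_of_flips S : S \in cone_flips a b -> bcone V xa :&: fcone V xb != set0.
Proof.
move=> /cone_flipsP[/subsetP Sx Sb]; apply/set0Pn; exists (fl S); rewrite !inE.
rewrite !chamber_mu; apply/andP; split.
  apply/forall_inP => i ix; rewrite ffunE; have := Sx i; rewrite inE ix.
  by case: (i \in S) => [/(_ isT)|_]; rewrite ?addbF.
by apply/forall_inP => i; rewrite inE => /Sb ->.
Qed.

Lemma cone_top_flips : bcone V xa :&: fcone V xb != set0 -> top_flips \in cone_flips a b.
Proof.
move=> /set0Pn[c /setIP[]].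
rewrite [c \in bcone _ _]inE [c \in fcone _ _]inE !chamber_mu.
move=> /forall_inP ca /forall_inP cb; apply/cone_flipsP; split.
  by apply/subsetP => i; rewrite !inE => /orP[/andP[/andP[]]|/andP[]].
move=> i ix; rewrite ffunE !inE ix (negPf ix) andbF orbF andbT.
have [ia|ia] /= := boolP (i \in xa).
  have := ca i ia; have := cb i; rewrite inE => /(_ ix) /eqP -> /eqP ->.
  by rewrite addbF.
by case: (val a i); case: (val b i).
Qed.

Hypothesis TG : top_flips \in cone_flips a b.
Hypothesis Yab : forall j, j \in Y -> val a j != val b j.

Lemma extra_opposite_full : extra_opposite a b = Y.
Proof.
by apply/setP => j; rewrite in_set; case: (boolP (j \in Y)) => //= /Yab ->.
Qed.

Lemma extra_in_top j : j \in Y -> j \in top_flips.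
Proof. by move=> jY; rewrite inE jY orbT. Qed.

Lemma top_flips_del j : j \in Y -> top_flips :\ j \in cone_flips a b.
Proof.
move=> jY; have /cone_flipsP[Tx Tb] := TG; apply/cone_flipsP; split.
  by apply: subset_trans Tx; exact: subsetDl.
move=> i ix; rewrite -(Tb i ix) !ffunE in_setD1; have -> // : i != j.
by apply: contraNneq ix => ->; move: jY; rewrite !inE => /andP[].
Qed.

Lemma homc_top_diff m (f : Hom m) (f' : Hom m.+1) :
  (forall y, val f' y = val f (res_diff y)) -> #|top_flips| = m.+1 ->
  homc f' top_flips = \sum_(j in Y) 'X_j * signed (dual_sign j (~: top_flips)) (homc f (top_flips :\ j)).
Proof.
move=> f'E Tm; have := shifted_homc_diff f'E (Z := ~: top_flips); rewrite setCK => /(_ TG Tm).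
have -> : shifted_homc f' (~: top_flips) = homc f' top_flips.
  rewrite /shifted_homc setCK (_ : _ :&: _ = set0) ?umon0 ?mul1r // extra_opposite_full.
  by apply/setP => i; rewrite in_setI in_setC in_set0; apply/negP => /andP[/extra_in_top ->].
move=> ->; rewrite /bd [RHS]big_mkcond [LHS]big_mkcond; apply: eq_bigr => j _.
rewrite in_setC negbK; have cE : ~: (j |: ~: top_flips) = top_flips :\ j.
  by apply/setP => i; rewrite !in_set negb_or negbK.
rewrite /shifted_homc cE; case: (boolP (j \in Y)) => jY.
  rewrite extra_in_top // extra_opposite_full; have -> : Y :&: (j |: ~: top_flips) = [set j].
    apply/setP => i; rewrite in_setI in_setU1 in_setC in_set1.
    case: (eqVneq i j) => [->|_] /=; first by rewrite jY.
    by apply/negP => /andP[/extra_in_top ->].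
  by rewrite umon1; case: (dual_sign _ _); rewrite /signed ?mulrN.
case: ifP => // jT; suff -> : homc f (top_flips :\ j) = 0 by rewrite mulr0 signed0.
apply: homc0; rewrite negb_and; apply/orP; right; apply/negP => /cone_flips_forced/(_ j).
have jN : j \in forced_flips by move: jT; rewrite in_setU (negPf jY) orbF.
have jx : j \notin xb by move: jN; rewrite !inE => /andP[/andP[]].
by move=> /(_ jx); rewrite jN in_setD1 eqxx.
Qed.

Lemma cone_flips_only S : S \in cone_flips a b -> #|S| = #|top_flips| -> S = top_flips.
Proof. by move=> SG ST; apply/eqP; rewrite eqEcard cone_flips_sub_top // ST leqnn. Qed.

Definition top_val m (f : Hom m) : gpolyin xb := topolyin (homc_in f top_flips).

Lemma top_inj i (f : Hom i) : #|top_flips| = i -> homc f top_flips = 0 -> f = 0.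
Proof.
move=> Ti f0; apply: homc_eq0 => S.
have [/andP[/eqP Si SG]|] := boolP ((#|S| == i) && (S \in cone_flips a b)); last exact: homc0.
by rewrite (cone_flips_only SG) // Si Ti.
Qed.

(** A coboundary combines the coordinates on the sets with one flip less, each multiplied
    by the variable of the missing flip. *)
Lemma top_coboundary i (f : gHom phi (std_resolution a i) (standard b)) : #|top_flips| = i ->
  coboundary f <-> var_ideal xb Y (top_val (f : Hom i)).
Proof.
case: i f => [|i] f Ti.
  have Y0 j : j \in Y -> False.
    by move=> /extra_in_top jT; move/eqP: Ti; rewrite cards_eq0 => /eqP T0; rewrite T0 inE in jT.
  split=> [->|[c cE]].
    exists (fun=> 0); rewrite big1 => [|j /Y0 //] /=.
    by rewrite /homc; case: (flip_chamber _ _) => // c; exact: stdc0.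
  apply: (top_inj Ti); rewrite -[LHS]/(val (top_val (f : Hom 0))) cE big1 // => j /Y0 //.
split=> [[g gE]|[c cE]].
  have cP j : set_zero xb (signed (dual_sign j (~: top_flips)) (homc (g : Hom i) (top_flips :\ j))) =
      signed (dual_sign j (~: top_flips)) (homc (g : Hom i) (top_flips :\ j)).
    by rewrite set_zero_sfilter sfilter_signed -set_zero_sfilter homc_in.
  by exists (fun j => topolyin (cP j)); exact: homc_top_diff gE Ti.
have [g gE] := @hom_exists _ _ _ _ a b i (fun S => \sum_(j in Y | S == top_flips :\ j)
   signed (dual_sign j (~: top_flips)) (val (c j))).
exists g; pose h := precomp (res_diff_ghom a i) g : Hom i.+1.
suff -> : f = h by [].
apply/eqP; rewrite -subr_eq0; apply/eqP/(top_inj Ti); rewrite homcB.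
rewrite (@homc_top_diff i g h (fun=> erefl) Ti) -[homc f top_flips]/(val (top_val (f : Hom i.+1))) cE.
rewrite -sumrB big1 // => j jY; rewrite -mulrBr gE top_flips_del //.
have -> : #|top_flips :\ j| == i by move: Ti; rewrite (cardsD1 j) extra_in_top // add1n => -[->].
rewrite /= (bigD1 j) ?jY ?eqxx //= big1 ?addr0; last first.
  move=> l /andP[/andP[lY /eqP E] lj]; have /setP/(_ l) := E.
  by rewrite !in_setD1 eqxx lj extra_in_top.
rewrite set_zero_sfilter sfilter_signed -set_zero_sfilter polyin_zero signedK subrr.
exact: mulr0.
Qed.

Lemma top_flips_sdist : (sdist (val a) (val b) = #|top_flips| + sdist (fl top_flips) (val b))%N.
Proof.
rewrite /sdist; set D := [set i | _]; have TD : top_flips \subset D.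
  apply/subsetP => i; rewrite in_setU => /orP[|/Yab]; last by rewrite inE.
  by rewrite !inE => /andP[].
have -> : [set i | fl top_flips i != val b i] = D :\: top_flips.
  apply/setP => i; rewrite in_setD [i \in D]inE [LHS]inE ffunE.
  have := subsetP TD i; rewrite [i \in D]inE.
  case: (i \in top_flips) => [/(_ isT)|_]; last by rewrite addbF.
  by case: (val a i); case: (val b i).
by rewrite -[in LHS](cardsID top_flips D) (setIidPr TD).
Qed.

(** In the top degree the only summand that matters is that of [top_flips], and every
    homomorphism is a cocycle. *)
Lemma top_iso i : #|top_flips| = i ->
  giso (cohomology phi (standard b) (std_resolution a) i)
    (gshift (ext_shift (val a) (val b) i) (gpolyquot xb Y)).
Proof.
move=> Ti; pose f (g : cocycles phi (standard b) (std_resolution a) i) :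
    gshift (ext_shift (val a) (val b) i) (gpolyquot xb Y) :=
  qpi (var_ideal xb Y) (top_val (val g : Hom i)).
apply: (@giso_quot _ _ _ _ f).
- split=> [q g h|t g dg].
    rewrite /f -qpiZ -qpiD; congr (qpi _ _); apply: val_inj => /=.
    have E : homc ((q : Zu) *: (val g : Hom i) + (val h : Hom i)) top_flips =
        set_zero xb q * homc (val g : Hom i) top_flips + homc (val h : Hom i) top_flips.
      by rewrite homcD homcZ.
    exact: E.
  exists (top_val (val g : Hom i)); split => //.
  rewrite addr0; suff H : mpoly_deg (t - ext_shift (val a) (val b) i) (homc (val g : Hom i) top_flips).
    exact: H.
  rewrite /homc; case Ec: (flip_chamber a top_flips) => [c|]; last first.
    exact: grading0 (mpoly_grading n) _.
  have := stdc_deg (c := c) (dg.2 _ _ (rgen_deg a i top_flips)).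
  rewrite (flip_chamberP Ec) /ext_shift top_flips_sdist Ti.
  suff -> : (i%:Z + t - (sdist (fl top_flips) (val b))%:Z) =
      t - ((i + sdist (fl top_flips) (val b))%N%:Z - (2 * i)%N%:Z) by [].
  by rewrite PoszD mul2n -addnn PoszD; ring.
- move=> y; pose p : polyin xb := qrepr (y : gpolyquot xb Y).
  have [g gE] := @hom_exists _ _ _ _ a b i (fun=> val p).
  have gc : @cocycle _ _ phi _ (standard b) (std_resolution a) i g.
    move=> u; pose g' := precomp (res_diff_ghom a i) g : Hom i.+1.
    suff : g' = 0 by move=> /(congr1 (fun h : Hom i.+1 => val h u)).
    apply: homc_eq0 => S.
    have [/andP[/eqP Si SG]|] := boolP ((#|S| == i.+1) && (S \in cone_flips a b));
      last exact: homc0.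
    by have := subset_leq_card (cone_flips_sub_top SG); rewrite Si Ti ltnn.
  exists (smk (N := gcocycles phi (standard b) (std_resolution a) i) gc).
  rewrite /f -[RHS](qreprK (N := var_ideal xb Y)); congr (qpi _ _); apply: val_inj.
  by rewrite /= gE Ti eqxx TG /= polyin_zero.
- move=> g; split=> [/(qpi_eq0 (var_ideal xb Y)) H|/(top_coboundary _ Ti) H].
    exact/(top_coboundary (val g) Ti).
  exact/(qpi_eq0 (var_ideal xb Y)).
Qed.

End TopDegree.

(** * Ext in degree zero *)

Section HomExt.
Variables (C A : grRing) (phi : central_map C A) (U W : grMod A) (P : gresolution U).

(** A cocycle in degree zero factors through the augmentation, and so do its homogeneous
    components, which are again cocycles; hence the induced map is a sum of homogeneous
    ones. *)
Lemma hom_ext0 : giso (gHom phi U W) (cohomology phi W P 0).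
Proof.
pose f (g : gHom phi U W) : gHom phi (P 0%N) W := precomp (res_aug_ghom P) g.
have fc g : cocycle (f g).
  move=> y /=; have -> : res_aug (res_d y) = 0 by apply/res_exact0; exists y.
  exact: homE0.
pose F g : cohomology phi W P 0 :=
  qpi (gcoboundaries phi W P 0) (smk (N := gcocycles phi W P 0) (fc g)).
exists F; split.
  split=> [c g h|j g dg].
    rewrite /F -qpiZ -qpiD; congr (qpi _ _); apply: val_inj; exact: val_inj.
  exists (smk (N := gcocycles phi W P 0) (fc g)); split => //.
  exact: (precomp_ghom phi W (res_aug_ghom P)).2 dg.
apply: inj_surj_bij => [g h /(qpi_eq (gcoboundaries phi W P 0)) gh|y].
  have {}gh : f g - f h = 0 by [].
  apply: val_inj; apply/funext => u; have [v <-] := @res_aug_surj _ _ P u.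
  apply/eqP; rewrite -subr_eq0; apply/eqP.
  exact: (congr1 (fun q : gHom phi (P 0%N) W => val q v) gh).
pose g := val (qrepr y); have gc : cocycle g := smP (qrepr y).
have /choice[r rP] u : exists v : P 0%N, res_aug v = u by exact: (@res_aug_surj _ _ P u).
have kill (h : gHom phi (P 0%N) W) v v' : cocycle h -> res_aug v = res_aug v' ->
    val h v = val h v'.
  move=> hc0 vv'; have /res_exact0[w wP] : res_aug (v - v') = 0.
    by rewrite (ghomB _ _ (res_aug_ghom P)) vv' subrr.
  apply/eqP; rewrite -subr_eq0 -homEB -wP; apply/eqP; exact: hc0.
have gmc m := cocycle_hom gc (hcP (gm_grading (gHom phi (P 0%N) W)) g) m.
have H := hdecomp_homv (hcP (gm_grading (gHom phi (P 0%N) W)) g).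
have q_in : hdecomp (@is_ghom A U W) (val g \o r)
    (fun m => val (hc (gm_grading (gHom phi (P 0%N) W)) g m) \o r).
  have [Dh [s [us hs gE]]] := H; split; last first.
    exists s; split => //; first by move=> m /hs ->.
    by apply/funext => u /=; rewrite gE !fct_sumE.
  move=> m; have [hL hD] := Dh m; split.
    move=> c u v /=; rewrite -hL; apply: kill; first exact: gmc.
    by rewrite (res_aug_ghom P).1 !rP.
  move=> j u du /=; rewrite (kill _ (r u) (hc (gm_grading (P 0%N)) (r u) j) (gmc m)).
    by apply: hD; exact: hc_deg.
  by rewrite (ghom_hc (res_aug_ghom P)) rP addr0 (hc_hom _ _ du) eqxx.
pose q : gHom phi U W := exist (fun h => h \in @hom_pred A U W) _ (hom_intro q_in).
exists q; rewrite -[y](qreprK (N := gcoboundaries phi W P 0)); congr (qpi _ _).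
apply: val_inj; apply: val_inj; apply/funext => v /=.
exact: kill gc (rP _).
Qed.

End HomExt.

(** * The Ext groups between standard modules *)

(** All variables have positive degree, so the homogeneous polynomials of degree zero are
    the constants. *)
Lemma polyin_deg0 n (z : {set 'I_n}) : exists phi : {additive 'rV[int]_1 -> gpolyin z},
  injective phi /\ forall p : gpolyin z, gm_deg 0 p <-> exists v, p = phi v.
Proof.
have cin (c : int) : set_zero z (c%:MP : {mpoly int[n]}) = c%:MP.
  rewrite set_zero_sfilter; apply/mnm_supp_mem => m; rewrite mcoeffC.
  case: (eqVneq m 0%MM) => [-> _|_]; last by rewrite mulr0.
  by apply/subsetP => i; rewrite inE mnm0E.
pose f (v : 'rV[int]_1) : gpolyin z := topolyin (cin (v 0 0)).
have fA : zmod_morphism f.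
  by move=> u v; apply: val_inj; rewrite /= !mxE mpolyCB.
pose fM := GRing.isZmodMorphism.Build _ _ f fA.
pose phi : {additive 'rV[int]_1 -> gpolyin z} := HB.pack f fM.
exists phi; split=> [u v /(congr1 (fun p : gpolyin z => (val p)@_0%MM)) /=|p].
  by rewrite !mcoeffC eqxx !mulr1 => E; apply/rowP => i; rewrite ord1.
split=> [dp|[v ->]].
  exists (\row__ (val p)@_0%MM); apply: val_inj => /=; rewrite mxE.
  apply/mpolyP => m; rewrite mcoeffC; have /mpoly_degP H := dp.
  case: (eqVneq m 0%MM) => [->|m0]; first by rewrite mulr1.
  rewrite mulr0; apply: H => /eqP; rewrite eqz_nat muln_eq0 /= mdeg_eq0 (negPf m0).
  by [].
by apply/mpoly_degP => m m0 /=; rewrite mcoeffC; case: (eqVneq m 0%MM) m0 => [->|]; rewrite ?mdeg0 ?mulr0.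
Qed.

Section Vanishing.
Variables (R : realType) (n k : nat) (V : polarized R n k) (a b : chamber V).
Local Notation xa := (bas_of V (val a)).
Local Notation xb := (bas_of V (val b)).
Local Notation phi := (Zu_to_Btilde V).

Lemma ext_std_resolution i :
  giso (Ext phi i (standard a) (standard b))
       (cohomology phi (standard b) (std_resolution a) i).
Proof. exact: cohomology_iso. Qed.

Lemma ext_vanish i :
  ~ [/\ bcone V xa :&: fcone V xb != set0,
        forall j, j \in ~: xa :&: xb -> val a j != val b j
      & i = (#|[set j in ~: xa :&: ~: xb | val a j != val b j]| + #|~: xa :&: xb|)%N] ->
  forall y : Ext phi i (standard a) (standard b), y = 0.
Proof.
move=> nz; apply: giso_eq0 (ext_std_resolution i) _ => y.
rewrite -[y](qreprK (N := gcoboundaries phi (standard b) (std_resolution a) i)).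
apply/(qpi_eq0 (gcoboundaries phi (standard b) (std_resolution a) i)).
apply: hom_exact; first exact: smP (qrepr y).
move=> S SG YS Yab; apply/eqP => Si; apply: nz; split => //; first exact: cone_of_flips SG.
by rewrite -Si (cone_flips_top SG YS) top_flips_card.
Qed.

Lemma ext_top i : [/\ bcone V xa :&: fcone V xb != set0,
        forall j, j \in ~: xa :&: xb -> val a j != val b j
      & i = (#|[set j in ~: xa :&: ~: xb | val a j != val b j]| + #|~: xa :&: xb|)%N] ->
  giso (Ext phi i (standard a) (standard b))
       (gshift (ext_shift (val a) (val b) i) (gpolyquot xb (~: xa :&: xb))).
Proof.
move=> [/cone_top_flips TG Yab iE]; apply: giso_trans (ext_std_resolution i) _.
by apply: top_iso => //; rewrite iE top_flips_card.
Qed.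

End Vanishing.

Theorem corollary5p5 (R : realType) (n k : nat) (V : polarized R n k)
    (a b : chamber V) (i : nat) :
  let al := signs a in
  let be := signs b in
  let xa := bas_of V al in
  let xb := bas_of V be in
  let E := fun m => Ext (Zu_to_Btilde V) m (standard a) (standard b) in
  let H := gHom (Zu_to_Btilde V) (standard a) (standard b) in
  let nonzero :=
    [/\ bcone V xa :&: fcone V xb != set0,
        forall j, j \in ~: xa :&: xb -> al j != be j
      & i = (#|[set j in ~: xa :&: ~: xb | al j != be j]|
             + #|~: xa :&: xb|)%N] in
  let s := ext_shift al be i in
  (~ nonzero -> forall x : E i, x = 0) /\
  (nonzero ->
     giso (E i) (gshift s (gpolyquot xb (~: xa :&: xb))) /\
     giso (gshift s (gpolyquot xb (~: xa :&: xb)))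
          (gshift s (gpolyin (xa :&: xb)))) /\
  giso H (E 0%N) /\
  (a <> b -> forall f : H, f = 0) /\
  (a = b -> giso H (gpolyin xa)) /\
  (exists phi : {additive 'rV[int]_(a == b) -> H},
     injective phi /\ forall f : H, gm_deg 0 f <-> exists v, f = phi v).
Proof.
move=> al be xa xb E H nonzero s.
have HE : giso H (E 0%N) by exact: hom_ext0.
have quotE : giso (gpolyquot xb (~: xa :&: xb)) (gpolyin (xa :&: xb)).
  have <- : xb :\: (~: xa :&: xb) = xa :&: xb.
    by apply/setP => j; rewrite !inE; case: (j \in xa); case: (j \in xb).
  by apply: polyquot_iso; exact: subsetIr.
have H0 : a <> b -> forall f : H, f = 0.
  move=> ab; apply: giso_eq0 HE _; apply: ext_vanish => -[_ _ /esym/eqP].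
  rewrite addn_eq0 => /andP[_]; rewrite cards_eq0 => /eqP Y0; apply: ab.
  have [aB aE] := bas_ofP (valP a); have [bB bE] := bas_ofP (valP b).
  apply: val_inj; rewrite -aE -bE; congr (mu V _); apply/esym/eqP.
  have /basesP[ak _] := aB; have /basesP[bk _] := bB.
  rewrite eqEcard ak bk leqnn andbT; apply/subsetP => j jb; apply/negPn/negP => ja.
  by move/setP/(_ j): Y0; rewrite !inE ja jb.
have H1 : a = b -> giso H (gpolyin xa).
  move=> ab; apply: giso_trans HE _; subst b.
  have nz : [/\ bcone V xa :&: fcone V xa != set0,
        forall j, j \in ~: xa :&: xa -> al j != al j
      & 0%N = (#|[set j in ~: xa :&: ~: xa | al j != al j]| + #|~: xa :&: xa|)%N].
    split.
    - apply/set0Pn; exists al; rewrite !inE !(chamber_mu a).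
      by apply/andP; split; apply/forall_inP.
    - by move=> j; rewrite !inE; case: (j \in xa).
    - rewrite setIC setICr cards0 addn0; apply/esym/eqP; rewrite cards_eq0; apply/eqP/setP => j.
      by rewrite !inE eqxx andbF.
  apply: giso_trans (ext_top nz) _.
  have -> : ext_shift (val a) (val a) 0 = 0 by rewrite /ext_shift sdist_refl.
  apply: giso_trans (giso_gshift0 _) _; apply: giso_trans quotE _.
  rewrite setIid; exists id; split; [exact: ghom_id|by exists id].
split; first exact: ext_vanish.
split.
  by move=> nz; split; [exact: ext_top|exact: giso_gshift].
split=> //; split=> //; split=> //.
case: (eqVneq a b) => [ab|/eqP ab] /=; last first.
  exists (GRing.Additive.clone _ _ (\0 : 'rV[int]_0 -> H) _); split.
    by move=> u v _; rewrite (thinmx0 u) (thinmx0 v).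
  move=> f; rewrite (H0 ab f); split=> _; first by exists 0.
  exact: grading0 (gm_grading H) _.
have [g [Hg [h gK hK]]] := giso_sym (H1 ab).
have [psi [psi_inj psiP]] := polyin_deg0 xa.
pose f v : H := g (psi v).
have fA : zmod_morphism f.
  by move=> u v; rewrite /f raddfB (ghomB _ _ Hg).
pose fM := GRing.isZmodMorphism.Build _ _ f fA.
pose ph : {additive 'rV[int]_1 -> H} := HB.pack f fM.
exists ph; split=> [u v /(can_inj gK) /psi_inj //|q].
split=> [dq|[v ->]].
  have /psiP[v hv] : gm_deg 0 (h q).
    by have := (ghom_inv Hg gK hK).2 0 q dq; rewrite addr0.
  by exists v; rewrite /= /f -hv hK.
have := Hg.2 0 (psi v); rewrite addr0; apply; apply/psiP; by exists v.
Qed.
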